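(* There is a properly $3$-REA set $A \subseteq \omega$ which cannot be extended to a properly $4$-REA set; that is, $A$ is properly $3$-REA and there is no $e \in \omega$ such that $A \oplus W_e^A$ is Turing equivalent to a properly $4$-REA set. Moreover, the set $A$ can also be taken to be $\Delta^0_2$.
   Context: Notation: $W_e^X$ is the $e$-th set recursively enumerable (r.e.) in $X$; $\langle x,y\rangle = \frac12(x+y)(x+y+1)+y$ is the standard pairing bijection $\omega^2\to\omega$; $A \oplus B = \{2x : x \in A\} \cup \{2x+1 : x \in B\}$; $\bigoplus_{m \in S} X_m = \{\langle m,x\rangle : m \in S,\ x \in X_m\}$. $n$-REA sets: Given a (possibly partial) computable function $f$ and a set $X\subseteq\omega$, define inductively $\widehat{\mathcal J}_f^{0}(X) = X$, $\widehat{\mathcal J}_f^{m+1}(X) = W_{f(m)}^{\mathcal J_f^m(X)}$ (taken to be $\emptyset$ if $f(m)$ diverges), and $\mathcal J_f^n(X) = \bigoplus_{m<n+1}\widehat{\mathcal J}_f^m(X)$. A set $C$ is $n$-REA if $C = \mathcal J_f^n(\emptyset)$ for some such $f$. (Up to Turing degree: a $1$-REA set is an r.e. set, and an $(n+1)$-REA set is a set of the form $B \oplus W_e^B$ with $B$ an $n$-REA set.) A set $B$ is properly $n$-REA if $B$ is $n$-REA and $B$ is not Turing equivalent to any $m$-REA set with $m<n$. An $n$-REA set $A$ can be extended to a properly $(n+1)$-REA set if there is a properly $(n+1)$-REA set that is Turing equivalent to a set of the form $A \oplus W_e^A$ for some $e\in\omega$. *)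

(* Defs.v *)
From Stdlib Require Import Arith Lia Cantor.

Definition set := nat -> Prop.
Definition same_set (A B : set) : Prop := forall x, A x <-> B x.
Definition empty : set := fun _ => False.

Definition pair (x y : nat) : nat := Cantor.to_nat (x, y).
Definition pi1 (z : nat) : nat := fst (Cantor.of_nat z).
Definition pi2 (z : nat) : nat := snd (Cantor.of_nat z).

Lemma pair_formula x y : pair x y = (x + y) * (x + y + 1) / 2 + y.
Proof.
  pose proof (Cantor.to_nat_spec x y) as H; fold (pair x y) in H.
  assert (E : (x + y) * (x + y + 1) = (pair x y - y) * 2) by nia.
  rewrite E, Nat.div_mul by lia; nia.
Qed.

Lemma pair_inj x y x' y' : pair x y = pair x' y' -> x = x' /\ y = y'.
Proof. unfold pair; intros H; apply Cantor.to_nat_inj in H; now injection H. Qed.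

(** Programs with an oracle.  All functions are unary, several arguments being
    combined with [pair]; the identity is [Pair Left Right]. *)
Inductive code : Set :=
| Zero | Succ | Left | Right | Query
| Pair (c d : code)
| Comp (c d : code)
| Prec (c d : code)
| Mu (c : code).

(** [eval X c n y]: program [c] with oracle [X] halts on [n] with output [y].
    [Prec c d] is the function [h] such that [h <a,0> = c a] and
    [h <a,i+1> = d <a,<i,h <a,i>>>]; [Mu c] sends [a] to the least [n] with
    [c <a,n> = 0], provided that [c <a,i>] is defined for all [i < n]. *)
Fixpoint eval (X : set) (c : code) : nat -> nat -> Prop :=
  match c with
  | Zero => fun _ y => y = 0
  | Succ => fun n y => y = S n
  | Left => fun n y => y = pi1 n
  | Right => fun n y => y = pi2 n
  | Query => fun n y => (X n /\ y = 1) \/ (~ X n /\ y = 0)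
  | Pair c d => fun n y => exists a b, eval X c n a /\ eval X d n b /\ y = pair a b
  | Comp c d => fun n y => exists m, eval X d n m /\ eval X c m y
  | Prec c d => fun n =>
      nat_rect (fun _ => nat -> Prop)
        (eval X c (pi1 n))
        (fun i h y => exists z, h z /\ eval X d (pair (pi1 n) (pair i z)) y)
        (pi2 n)
  | Mu c => fun a n =>
      eval X c (pair a n) 0 /\
      forall i, i < n -> exists k, eval X c (pair a i) (S k)
  end.

Lemma eval_functional X c : forall n y z, eval X c n y -> eval X c n z -> y = z.
Proof.
  induction c as [ | | | | | c IHc d IHd | c IHc d IHd | c IHc d IHd | c IHc];
    cbn [eval]; intros n y z Hy Hz; try congruence.
  - intuition congruence.
  - destruct Hy as (a & b & Ha & Hb & ->), Hz as (a' & b' & Ha' & Hb' & ->).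
    now rewrite (IHc _ _ _ Ha Ha'), (IHd _ _ _ Hb Hb').
  - destruct Hy as (m & Hm & Hy), Hz as (m' & Hm' & Hz).
    rewrite (IHd _ _ _ Hm' Hm) in Hz; eauto.
  - revert y z Hy Hz; induction (pi2 n) as [ | i IHi]; cbn; intros y z Hy Hz.
    + eauto.
    + destruct Hy as (u & Hu & Hy), Hz as (v & Hv & Hz).
      rewrite (IHi _ _ Hv Hu) in Hz; eauto.
  - destruct Hy as [Hy0 Hy], Hz as [Hz0 Hz].
    destruct (Nat.lt_trichotomy y z) as [L | [E | L]]; trivial.
    + destruct (Hz _ L) as [k Hk]; discriminate (IHc _ _ _ Hy0 Hk).
    + destruct (Hy _ L) as [k Hk]; discriminate (IHc _ _ _ Hz0 Hk).
Qed.

Fixpoint encode (c : code) : nat :=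
  match c with
  | Zero => pair 0 0
  | Succ => pair 1 0
  | Left => pair 2 0
  | Right => pair 3 0
  | Query => pair 4 0
  | Pair c d => pair 5 (pair (encode c) (encode d))
  | Comp c d => pair 6 (pair (encode c) (encode d))
  | Prec c d => pair 7 (pair (encode c) (encode d))
  | Mu c => pair 8 (encode c)
  end.

Lemma encode_inj c : forall d, encode c = encode d -> c = d.
Proof.
  induction c; intros d' H; destruct d'; cbn [encode] in H;
    apply pair_inj in H; destruct H as [Ht H]; try discriminate Ht; trivial.
  1-3: apply pair_inj in H; destruct H; f_equal; auto.
  f_equal; auto.
Qed.

(** The graph of the [e]-th partial function computable in [X]; it is nowhere
    defined when [e] is not the number of a program. *)
Definition phi (e : nat) (X : set) (n y : nat) : Prop :=
  exists c, encode c = e /\ eval X c n y.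

Definition W (e : nat) (X : set) : set := fun x => exists y, phi e X x y.

Definition turing_le (A B : set) : Prop :=
  exists e, forall x, (A x -> phi e B x 1) /\ (~ A x -> phi e B x 0).
Definition turing_equiv (A B : set) : Prop := turing_le A B /\ turing_le B A.

(** Partial functions are given by their graphs. *)
Definition partial_computable (f : nat -> nat -> Prop) : Prop :=
  exists e, forall n y, f n y <-> phi e empty n y.
Definition computable (A : set) : Prop := turing_le A empty.

Definition Sigma02 (A : set) : Prop :=
  exists R, computable R /\
    forall x, A x <-> exists a, forall b, R (pair x (pair a b)).
Definition Pi02 (A : set) : Prop :=
  exists R, computable R /\
    forall x, A x <-> forall a, exists b, R (pair x (pair a b)).
Definition Delta02 (A : set) : Prop := Sigma02 A /\ Pi02 A.

Definition join (A B : set) : set := fun z =>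
  (exists x, A x /\ z = 2 * x) \/ (exists x, B x /\ z = 2 * x + 1).
Definition bigjoin (M : set) (X : nat -> set) : set := fun z =>
  exists m x, M m /\ X m x /\ z = pair m x.

(** [W_{f(m)}^Y], which is empty if [f(m)] diverges. *)
Definition W_at (f : nat -> nat -> Prop) (m : nat) (Y : set) : set := fun x =>
  exists e, f m e /\ W e Y x.

(** [J] is built by adding one column at a time, which makes the recursion
    structural; [J_bigjoin] shows that [J f n X] is the join of the
    [Jhat f m X] for [m < n + 1]. *)
Fixpoint J (f : nat -> nat -> Prop) (n : nat) (X : set) : set :=
  match n with
  | 0 => fun z => exists x, X x /\ z = pair 0 x
  | S n' => fun z =>
      J f n' X z \/ exists x, W_at f n' (J f n' X) x /\ z = pair (S n') x
  end.

Definition Jhat (f : nat -> nat -> Prop) (m : nat) (X : set) : set :=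
  match m with
  | 0 => X
  | S m' => W_at f m' (J f m' X)
  end.

Lemma J_bigjoin f n X :
  same_set (J f n X) (bigjoin (fun m => m < n + 1) (fun m => Jhat f m X)).
Proof.
  induction n as [ | n IH]; intros z; cbn [J]; split.
  - intros (x & Hx & ->); exists 0, x; auto.
  - intros (m & x & Hm & Hx & ->); replace m with 0 in * by lia; eauto.
  - intros [H | (x & Hx & ->)].
    + apply IH in H; destruct H as (m & x & Hm & Hx & ->).
      exists m, x; repeat split; trivial; lia.
    + exists (S n), x; repeat split; trivial; lia.
  - intros (m & x & Hm & Hx & ->).
    destruct (Nat.eq_dec m (S n)) as [-> | Hne].
    + right; exists x; auto.
    + left; apply IH; exists m, x; repeat split; trivial; lia.
Qed.

Definition REA (n : nat) (C : set) : Prop :=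
  exists f, partial_computable f /\ same_set C (J f n empty).

Definition properly_REA (n : nat) (B : set) : Prop :=
  REA n B /\ forall m C, m < n -> REA m C -> ~ turing_equiv B C.

(** Used for [n]-REA sets [A]. *)
Definition extends_to_properly_REA_succ (n : nat) (A : set) : Prop :=
  exists B, properly_REA (n + 1) B /\ exists e, turing_equiv B (join A (W e A)).

(* Main.v *)
(** Strategy [i] has to refute the [i]-th pair of reductions between the limit [limA] of the
    approximations [An] and a 2-REA set [C].  Whenever the two sides agree up to its current
    number [x], it puts [x] into the set ([Fwd]); at a later agreement it may return to the
    approximation of the stage [t] of an earlier [Fwd] ([Act2]), and at the next one undo that
    return ([Act3]).  Then [x] has been out, in, out and in again, and [C] would have had to
    follow, which a set with only two r.e. levels cannot do.

    The stages jumped over by an [Act3] form an r.e. set, those jumped over by an [Act2] that is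
    never undone are r.e. in it, and the limit is the union of the approximations at the
    remaining stages.  Hence the three together form a 3-REA set equivalent to the limit.

    To keep [A + W_e^A] 3-REA as well, a computation [kap] that appears while it can still be
    destroyed by the next number of a strategy is recorded as a letter in the word of that
    strategy, and an [Act2] to [t] is allowed only when the current word equals the word at
    [t].  If some longer word has been left on the stack of possible returns, the letter
    commits to never returning to a stage above it.  Thus "the computation [kap] destroyed at
    stage [d] will not come back by a return" is a [Sigma_1] fact about commitments, "[kap],
    present at [s0], is destroyed for good" is r.e. in the first column, and "[kap] is present
    in the end" is r.e. in the first two, so that [W_e^A] can be added to the three columns
    without changing their form.  A strategy acts only finitely often since its words are
    repetition-free over a fixed finite alphabet and cannot be stacked forever. *)

Require Import Defs.
From Stdlib Require Import Arith Lia List Bool Cantor Classical ClassicalEpsilon Sorted.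
Import ListNotations.

(** The obstacle is that [A] together with [W_e^A] must compute every column of the presentation, so
    each r.e. fact in a column has to be settled by a stage that can be recognized from these two
    sets. For the jumped stages this works because an [Act2] removes, and an [Act3] restores, a
    number that no stage up to the [Fwd] contained: agreement of two approximations below the
    earlier stage already forces the one to be an ancestor of the other. For commitments and kicks
    the stage must also be right about the one computation concerned. Here the test of each letter
    against the stacked words pays off: when an [Act2] to [t] finds its word repeated, every
    destruction since [t] of a computation in the word has been committed. Letters are limited to
    [kap <= rst p] to keep alphabets finite; strategies too early to record [kap] are excluded by a
    parameter [be >= kap], a length below which the set is supposed to be final. No strategy deals
    with a particular [e]: the set and its extensions come from one construction and differ only in
    the computations selected for the columns. *)

Lemma pi1_pair a b : pi1 (pair a b) = a.
Proof. unfold pi1, pair. now rewrite Cantor.cancel_of_to. Qed.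
Lemma pi2_pair a b : pi2 (pair a b) = b.
Proof. unfold pi2, pair. now rewrite Cantor.cancel_of_to. Qed.
Lemma pair_pi z : pair (pi1 z) (pi2 z) = z.
Proof.
  unfold pair, pi1, pi2. rewrite <- surjective_pairing. apply Cantor.cancel_to_of.
Qed.
Lemma pair_bound a b : a <= pair a b /\ b <= pair a b.
Proof. pose proof (Cantor.to_nat_spec a b); fold (pair a b) in *; nia. Qed.
Global Opaque pair pi1 pi2.

(** * Encodings, and computable functions between encoded types *)

Class Enc (T : Type) := enc : T -> nat.
#[export] Instance enc_nat : Enc nat := fun n => n.
#[export] Instance enc_bool : Enc bool := fun b => if b then 1 else 0.
#[export] Instance enc_prod {S T} `{Enc S} `{Enc T} : Enc (S * T) :=
  fun p => pair (enc (fst p)) (enc (snd p)).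
#[export] Instance enc_list {T} `{Enc T} : Enc (list T) :=
  fix f l := match l with nil => 0 | a :: l => S (pair (enc a) (f l)) end.
#[export] Instance enc_option {T} `{Enc T} : Enc (option T) :=
  fun o => match o with None => 0 | Some a => S (enc a) end.

(** Lets the construction be written with ordinary functions on lists, options and records and be
    shown computable afterwards, through the codes. *)
Definition cmp (X : set) {S T} `{Enc S} `{Enc T} (f : S -> T) : Prop :=
  exists c, forall a, eval X c (enc a) (enc (f a)).

Section Cmp.
Variable X : set.

Section Basic.
Context {A B C : Type} `{Enc A} `{Enc B} `{Enc C}.

Lemma cmp_ext (f g : A -> B) : (forall a, f a = g a) -> cmp X f -> cmp X g.
Proof. intros E [c Hc]; exists c; intros a; now rewrite <- E. Qed.

Lemma cmp_comp (g : B -> C) (f : A -> B) :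
  cmp X g -> cmp X f -> cmp X (fun x => g (f x)).
Proof. intros [d Hd] [c Hc]; exists (Comp d c); intros a; cbn; eauto. Qed.

Lemma cmp_num (n : nat) : cmp X (fun _ : A => n).
Proof.
  induction n as [ | n [c Hc]].
  - exists Zero; cbn; auto.
  - exists (Comp Succ c); intros a; cbn; eauto.
Qed.

Lemma cmp_const (b : B) : cmp X (fun _ : A => b).
Proof. destruct (cmp_num (enc b)) as [c Hc]; exists c; intros a; apply Hc. Qed.

Lemma cmp_enc (f : A -> B) : cmp X f -> cmp X (fun x => enc (f x)).
Proof. intros [c Hc]; exists c; intros a; apply Hc. Qed.

Lemma cmp_pair (f : A -> B) (g : A -> C) :
  cmp X f -> cmp X g -> cmp X (fun x => (f x, g x)).
Proof. intros [c Hc] [d Hd]; exists (Pair c d); intros a; cbn; eauto. Qed.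

Lemma cmp_fst (f : A -> B * C) : cmp X f -> cmp X (fun x => fst (f x)).
Proof.
  intros [c Hc]; exists (Comp Left c); intros a; cbn; eexists; split; eauto.
  unfold enc at 2, enc_prod; now rewrite pi1_pair.
Qed.

Lemma cmp_snd (f : A -> B * C) : cmp X f -> cmp X (fun x => snd (f x)).
Proof.
  intros [c Hc]; exists (Comp Right c); intros a; cbn; eexists; split; eauto.
  unfold enc at 2, enc_prod; now rewrite pi2_pair.
Qed.

Lemma cmp_natrec (f : A -> B) (g : A -> nat -> B -> B) (h : A -> nat) :
  cmp X f -> cmp X (fun q : A * (nat * B) => g (fst q) (fst (snd q)) (snd (snd q))) ->
  cmp X h ->
  cmp X (fun x => nat_rect (fun _ => B) (f x) (fun i z => g x i z) (h x)).
Proof.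
  intros [c Hc] [d Hd] [e He].
  destruct (fun P => P : cmp X (fun x : A => x)) as [i Hi].
  { exists (Pair Left Right); intros a; cbn; do 2 eexists; repeat split.
    now rewrite pair_pi. }
  exists (Comp (Prec c d) (Pair i e)); intros a; cbn.
  eexists; split; [ do 2 eexists; repeat split; eauto | ].
  rewrite pi1_pair, pi2_pair.
  generalize (h a); intros n; unfold enc at 2, enc_nat.
  induction n as [ | n IH]; cbn; [ apply Hc | ].
  eexists; split; [ exact IH | apply (Hd (a, (n, _))) ].
Qed.
End Basic.

Lemma cmp_id {A} `{Enc A} : cmp X (fun x : A => x).
Proof.
  exists (Pair Left Right); intros a; cbn; do 2 eexists; repeat split.
  now rewrite pair_pi.
Qed.

Section Nat.
Context {A : Type} `{Enc A}.
Implicit Types f g : A -> nat.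

Lemma cmp_S f : cmp X f -> cmp X (fun x => S (f x)).
Proof. intros [c Hc]; exists (Comp Succ c); intros a; cbn; eauto. Qed.

Lemma cmp_npair f g : cmp X f -> cmp X g -> cmp X (fun x => Defs.pair (f x) (g x)).
Proof. intros Hf Hg; destruct (cmp_pair f g Hf Hg) as [c Hc]; exists c; intros a; apply Hc. Qed.

Lemma cmp_pi1 f : cmp X f -> cmp X (fun x => pi1 (f x)).
Proof. intros [c Hc]; exists (Comp Left c); intros a; cbn; eauto. Qed.

Lemma cmp_pi2 f : cmp X f -> cmp X (fun x => pi2 (f x)).
Proof. intros [c Hc]; exists (Comp Right c); intros a; cbn; eauto. Qed.

Lemma cmp_if {B} `{Enc B} (b : A -> bool) (f g : A -> B) :
  cmp X b -> cmp X f -> cmp X g -> cmp X (fun x => if b x then f x else g x).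
Proof.
  intros Hb Hf Hg.
  apply cmp_ext with (f := fun x => nat_rect (fun _ => B) (g x) (fun _ _ => f x) (enc (b x))).
  { intros a; now destruct (b a). }
  apply (cmp_natrec g (fun x _ _ => f x) (fun x => enc (b x))); trivial.
  apply (cmp_comp f fst); trivial. apply cmp_fst, cmp_id.
Qed.

Lemma cmp_pred f : cmp X f -> cmp X (fun x => pred (f x)).
Proof.
  intros Hf.
  apply cmp_ext with (f := fun x => nat_rect (fun _ => nat) 0 (fun i _ => i) (f x)).
  { intros a; now destruct (f a). }
  apply (cmp_natrec (fun _ => 0) (fun _ i _ => i) f); [ apply cmp_const | | exact Hf ].
  apply cmp_fst, cmp_snd, cmp_id.
Qed.

Lemma cmp_add f g : cmp X f -> cmp X g -> cmp X (fun x => f x + g x).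
Proof.
  intros Hf Hg.
  apply cmp_ext with (f := fun x => nat_rect (fun _ => nat) (g x) (fun _ z => S z) (f x)).
  { intros a; induction (f a) as [ | n IH]; cbn; trivial; now rewrite IH. }
  apply (cmp_natrec g (fun _ _ z => S z) f); [ exact Hg | | exact Hf ].
  destruct (cmp_snd snd (cmp_snd _ (cmp_id (A := A * (nat * nat))))) as [c Hc].
  exists (Comp Succ c); intros a; cbn; eauto.
Qed.
End Nat.

Section Nat2.
Context {A : Type} `{Enc A}.
Implicit Types f g : A -> nat.

Lemma cmp_sub f g : cmp X f -> cmp X g -> cmp X (fun x => f x - g x).
Proof.
  intros Hf Hg.
  apply cmp_ext with (f := fun x => nat_rect (fun _ => nat) (f x) (fun _ z => pred z) (g x)).
  { intros a; induction (g a) as [ | n IH]; cbn; [ lia | ]. rewrite IH; lia. }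
  apply (cmp_natrec f (fun _ _ z => pred z) g); [ exact Hf | | exact Hg ].
  apply cmp_pred, cmp_snd, cmp_snd, cmp_id.
Qed.

Lemma cmp_eq0 f : cmp X f -> cmp X (fun x => f x =? 0).
Proof.
  intros Hf.
  apply cmp_ext with (f := fun x => nat_rect (fun _ => bool) true (fun _ _ => false) (f x)).
  { intros a; now destruct (f a). }
  apply (cmp_natrec (fun _ => true) (fun _ _ _ => false) f); [ apply cmp_const | apply cmp_const | exact Hf ].
Qed.

Lemma cmp_leb f g : cmp X f -> cmp X g -> cmp X (fun x => f x <=? g x).
Proof.
  intros Hf Hg.
  apply cmp_ext with (f := fun x => f x - g x =? 0).
  { intros a; apply eq_true_iff_eq; rewrite Nat.eqb_eq, Nat.leb_le; lia. }
  now apply cmp_eq0, cmp_sub.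
Qed.

Lemma cmp_ltb f g : cmp X f -> cmp X g -> cmp X (fun x => f x <? g x).
Proof. intros; apply (cmp_leb (fun x => S (f x)) g); trivial; now apply cmp_S. Qed.

Lemma cmp_negb b : cmp X b -> cmp X (fun x : A => negb (b x)).
Proof. intros; apply (cmp_if b (fun _ => false) (fun _ => true)); trivial; apply cmp_const. Qed.

Lemma cmp_andb (b b' : A -> bool) : cmp X b -> cmp X b' -> cmp X (fun x => b x && b' x).
Proof. intros; apply (cmp_if b b' (fun _ => false)); trivial; apply cmp_const. Qed.

Lemma cmp_orb (b b' : A -> bool) : cmp X b -> cmp X b' -> cmp X (fun x => b x || b' x).
Proof. intros; apply (cmp_if b (fun _ => true) b'); trivial; apply cmp_const. Qed.

Lemma cmp_eqb f g : cmp X f -> cmp X g -> cmp X (fun x => f x =? g x).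
Proof.
  intros Hf Hg.
  apply cmp_ext with (f := fun x => (f x <=? g x) && (g x <=? f x)).
  { intros a; apply eq_true_iff_eq; rewrite andb_true_iff, Nat.eqb_eq, !Nat.leb_le; lia. }
  apply cmp_andb; now apply cmp_leb.
Qed.

Lemma cmp_beqb (b b' : A -> bool) : cmp X b -> cmp X b' -> cmp X (fun x => eqb (b x) (b' x)).
Proof.
  intros. apply cmp_ext with (f := fun x => if b x then b' x else negb (b' x)).
  { intros a; now destruct (b a), (b' a). }
  apply cmp_if; trivial. now apply cmp_negb.
Qed.

Context {B C : Type} `{Enc B} `{Enc C}.

Lemma cmp_cons (f : A -> B) (g : A -> list B) :
  cmp X f -> cmp X g -> cmp X (fun x => f x :: g x).
Proof.
  intros Hf Hg. destruct (cmp_S _ (cmp_npair _ _ (cmp_enc _ Hf) (cmp_enc _ Hg))) as [c Hc].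
  exists c; intros a; apply Hc.
Qed.

Lemma cmp_Some (f : A -> B) : cmp X f -> cmp X (fun x => Some (f x)).
Proof. intros Hf. destruct (cmp_S _ (cmp_enc _ Hf)) as [c Hc]. exists c; intros a; apply Hc. Qed.

End Nat2.

Section Case.
Context {A B C : Type} `{Enc A} `{Enc B} `{Enc C}.

(* [Prec] with a 0/1 counter: [d] may diverge where [v] vanishes. *)
Lemma cmp_case_code (v : A -> nat) (f h : A -> C) (d : code) :
  cmp X v -> cmp X f ->
  (forall a, v a = 0 -> f a = h a) ->
  (forall a p, v a = S p -> eval X d (Defs.pair (enc a) p) (enc (h a))) ->
  cmp X h.
Proof.
  intros Hv [c Hc] Hz HS.
  assert (Hs : cmp X (fun x => if v x =? 0 then 0 else 1)).
  { apply cmp_if; [ now apply cmp_eq0 | apply cmp_const | apply cmp_const ]. }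
  destruct Hs as [s Hs].
  destruct (cmp_pair (fun x => x) (fun x => pred (v x)) (cmp_id (A := A)) (cmp_pred _ Hv))
    as [q Hq].
  exists (Comp (Prec (Comp c Left) (Comp d Left)) (Pair q s)); intros a.
  specialize (Hs a); specialize (Hq a); specialize (Hc a).
  specialize (Hz a); specialize (HS a).
  cbn [eval]; eexists; split; [ do 2 eexists; repeat split; eauto | ].
  rewrite pi1_pair, pi2_pair. unfold enc at 1, enc_nat.
  destruct (v a) as [ | p]; cbn.
  - eexists; split; [ reflexivity | ]. unfold enc at 1, enc_prod; cbn.
    rewrite pi1_pair. now rewrite <- Hz.
  - exists (enc (f a)); split.
    + eexists; split; [ reflexivity | ]. unfold enc at 1, enc_prod; cbn.
      now rewrite pi1_pair.
    + eexists; split; [ reflexivity | ]. rewrite pi1_pair. now apply HS.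
Qed.

Lemma cmp_list_case (l : A -> list B) (f : A -> C) (g : A -> B -> list B -> C) :
  cmp X l -> cmp X f ->
  cmp X (fun q : A * (B * list B) => g (fst q) (fst (snd q)) (snd (snd q))) ->
  cmp X (fun x => match l x with nil => f x | b :: t => g x b t end).
Proof.
  intros Hl Hf [d Hd].
  apply (cmp_case_code (fun x => enc (l x)) f) with (d := d); trivial.
  - intros a; now destruct (l a).
  - intros a p E. destruct (l a) as [ | b t]; [ discriminate | ].
    injection E as <-. apply (Hd (a, (b, t))).
Qed.

Lemma cmp_option_case (o : A -> option B) (f : A -> C) (g : A -> B -> C) :
  cmp X o -> cmp X f ->
  cmp X (fun q : A * B => g (fst q) (snd q)) ->
  cmp X (fun x => match o x with Some b => g x b | None => f x end).
Proof.
  intros Hl Hf [d Hd].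
  apply (cmp_case_code (fun x => enc (o x)) f) with (d := d); trivial.
  - intros a; now destruct (o a).
  - intros a p E. destruct (o a) as [ b | ]; [ | discriminate ].
    injection E as <-. apply (Hd (a, b)).
Qed.

Lemma cmp_iter (F : A -> B -> B) (n : A -> nat) (i : A -> B) :
  cmp X (fun q : A * B => F (fst q) (snd q)) -> cmp X n -> cmp X i ->
  cmp X (fun x => Nat.iter (n x) (F x) (i x)).
Proof.
  intros HF Hn Hi.
  apply cmp_ext with (f := fun x => nat_rect (fun _ => B) (i x) (fun _ z => F x z) (n x)).
  { intros a; now induction (n a) as [ | m IH]; cbn; [ | rewrite IH ]. }
  apply (cmp_natrec i (fun x _ z => F x z) n); trivial.
  apply (cmp_comp (fun q : A * B => F (fst q) (snd q))
           (fun q : A * (nat * B) => (fst q, snd (snd q)))); trivial.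
  apply cmp_pair; [ apply cmp_fst, cmp_id | apply cmp_snd, cmp_snd, cmp_id ].
Qed.

Lemma length_enc (l : list B) : length l <= enc l.
Proof.
  induction l as [ | b l IH]; cbn; trivial.
  change (enc (b :: l)) with (S (Defs.pair (enc b) (enc l))).
  pose proof (pair_bound (enc b) (enc l)). lia.
Qed.
End Case.

Section Fold.
Context {A B C : Type} `{Enc A} `{Enc B} `{Enc C}.

(** The code of a list bounds its length, so consuming one element [enc l] times empties the list;
    on the empty list the step does nothing, and the surplus iterations are harmless. *)
Lemma cmp_fold_left (F : A -> C -> B -> C) (l : A -> list B) (i : A -> C) :
  cmp X (fun q : A * (C * B) => F (fst q) (fst (snd q)) (snd (snd q))) ->
  cmp X l -> cmp X i ->
  cmp X (fun x => fold_left (fun c b => F x c b) (l x) (i x)).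
Proof.
  intros HF Hl Hi.
  set (G := fun x (z : list B * C) =>
    match fst z with nil => z | b :: t => (t, F x (snd z) b) end).
  apply cmp_ext with (f := fun x => snd (Nat.iter (enc (l x)) (G x) (l x, i x))).
  { intros a. pose proof (length_enc (l a)) as L. revert L.
    generalize (enc (l a)) as n; generalize (i a) as c.
    induction (l a) as [ | b t IH]; intros c n L.
    - assert (E : Nat.iter n (G a) (nil, c) = (nil, c)).
      { clear. induction n as [ | n IH]; trivial. now rewrite Nat.iter_succ, IH. }
      now rewrite E.
    - destruct n as [ | n]; cbn in L; [ lia | ].
      rewrite Nat.iter_succ_r. cbn. apply IH. lia. }
  apply cmp_snd, cmp_iter.
  - unfold G. apply (cmp_list_case (fun q => fst (snd q)) (fun q => snd q)
      (fun q b t => (t, F (fst q) (snd (snd q)) b))).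
    + apply cmp_fst, cmp_snd, cmp_id.
    + apply cmp_snd, cmp_id.
    + apply cmp_pair; [ apply cmp_snd, cmp_snd, cmp_id | ].
      apply (cmp_comp (fun q : A * (C * B) => F (fst q) (fst (snd q)) (snd (snd q)))
        (fun q : (A * (list B * C)) * (B * list B) =>
           (fst (fst q), (snd (snd (fst q)), fst (snd q))))); trivial.
      apply cmp_pair; [ apply cmp_fst, cmp_fst, cmp_id | ].
      apply cmp_pair; [ apply cmp_snd, cmp_snd, cmp_fst, cmp_id | apply cmp_fst, cmp_snd, cmp_id ].
  - exact (cmp_enc l Hl).
  - now apply cmp_pair.
Qed.
End Fold.

Section Fold2.
Context {A B C : Type} `{Enc A} `{Enc B} `{Enc C}.

Lemma cmp_rev (l : A -> list B) : cmp X l -> cmp X (fun x => rev (l x)).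
Proof.
  intros Hl. apply cmp_ext with (f := fun x => fold_left (fun c b => b :: c) (l x) nil).
  { intros a. rewrite <- (app_nil_r (rev (l a))). generalize (@nil B).
    induction (l a) as [ | b t IH]; intros m; cbn; trivial. now rewrite IH, <- app_assoc. }
  apply (cmp_fold_left (fun _ c b => b :: c)); trivial.
  - apply cmp_cons; [ apply cmp_snd, cmp_snd, cmp_id | apply cmp_fst, cmp_snd, cmp_id ].
  - apply cmp_const.
Qed.

Lemma cmp_fold_right (F : A -> B -> C -> C) (i : A -> C) (l : A -> list B) :
  cmp X (fun q : A * (B * C) => F (fst q) (fst (snd q)) (snd (snd q))) ->
  cmp X i -> cmp X l ->
  cmp X (fun x => fold_right (fun b c => F x b c) (i x) (l x)).
Proof.
  intros HF Hi Hl.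
  apply cmp_ext with (f := fun x => fold_left (fun c b => F x b c) (rev (l x)) (i x)).
  { intros a. rewrite <- fold_left_rev_right. now rewrite rev_involutive. }
  apply (cmp_fold_left (fun x c b => F x b c)); trivial.
  - apply (cmp_comp (fun q : A * (B * C) => F (fst q) (fst (snd q)) (snd (snd q)))
        (fun q : A * (C * B) => (fst q, (snd (snd q), fst (snd q))))); trivial.
    apply cmp_pair; [ apply cmp_fst, cmp_id | ].
    apply cmp_pair; [ apply cmp_snd, cmp_snd, cmp_id | apply cmp_fst, cmp_snd, cmp_id ].
  - now apply cmp_rev.
Qed.
End Fold2.

Section Lists.
Context {A B C : Type} `{Enc A} `{Enc B} `{Enc C}.

Lemma cmp_app (l m : A -> list B) : cmp X l -> cmp X m -> cmp X (fun x => l x ++ m x).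
Proof.
  intros Hl Hm.
  apply cmp_ext with (f := fun x => fold_right (fun b c => b :: c) (m x) (l x)).
  { intros a; induction (l a) as [ | b t IH]; cbn; trivial; now rewrite IH. }
  apply (cmp_fold_right (fun _ b c => b :: c)); trivial.
  apply cmp_cons; [ apply cmp_fst, cmp_snd, cmp_id | apply cmp_snd, cmp_snd, cmp_id ].
Qed.

Lemma cmp_map (f : A -> B -> C) (l : A -> list B) :
  cmp X (fun q : A * B => f (fst q) (snd q)) -> cmp X l ->
  cmp X (fun x => map (fun b => f x b) (l x)).
Proof.
  intros Hf Hl.
  apply cmp_ext with (f := fun x => fold_right (fun b c => f x b :: c) nil (l x)).
  { intros a; induction (l a) as [ | b t IH]; cbn; trivial; now rewrite IH. }
  apply (cmp_fold_right (fun x b c => f x b :: c)); trivial; [ | apply cmp_const ].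
  apply cmp_cons; [ | apply cmp_snd, cmp_snd, cmp_id ].
  apply (cmp_comp (fun q : A * B => f (fst q) (snd q))
          (fun q : A * (B * list C) => (fst q, fst (snd q)))); trivial.
  apply cmp_pair; [ apply cmp_fst, cmp_id | apply cmp_fst, cmp_snd, cmp_id ].
Qed.

Lemma cmp_filter (f : A -> B -> bool) (l : A -> list B) :
  cmp X (fun q : A * B => f (fst q) (snd q)) -> cmp X l ->
  cmp X (fun x => filter (fun b => f x b) (l x)).
Proof.
  intros Hf Hl.
  apply cmp_ext with (f := fun x => fold_right (fun b c => if f x b then b :: c else c) nil (l x)).
  { intros a; induction (l a) as [ | b t IH]; cbn; trivial; now rewrite IH. }
  apply (cmp_fold_right (fun x b c => if f x b then b :: c else c)); trivial;
    [ | apply cmp_const ].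
  apply cmp_if;
    [ | apply cmp_cons; [ apply cmp_fst, cmp_snd, cmp_id | apply cmp_snd, cmp_snd, cmp_id ]
    | apply cmp_snd, cmp_snd, cmp_id ].
  apply (cmp_comp (fun q : A * B => f (fst q) (snd q))
          (fun q : A * (B * list B) => (fst q, fst (snd q)))); trivial.
  apply cmp_pair; [ apply cmp_fst, cmp_id | apply cmp_fst, cmp_snd, cmp_id ].
Qed.

Lemma cmp_existsb (f : A -> B -> bool) (l : A -> list B) :
  cmp X (fun q : A * B => f (fst q) (snd q)) -> cmp X l ->
  cmp X (fun x => existsb (fun b => f x b) (l x)).
Proof.
  intros Hf Hl.
  apply cmp_ext with (f := fun x => fold_right (fun b c => f x b || c) false (l x)).
  { intros a; induction (l a) as [ | b t IH]; cbn; trivial; now rewrite IH. }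
  apply (cmp_fold_right (fun x b c => f x b || c)); trivial; [ | apply cmp_const ].
  apply cmp_orb; [ | apply cmp_snd, cmp_snd, cmp_id ].
  apply (cmp_comp (fun q : A * B => f (fst q) (snd q))
          (fun q : A * (B * bool) => (fst q, fst (snd q)))); trivial.
  apply cmp_pair; [ apply cmp_fst, cmp_id | apply cmp_fst, cmp_snd, cmp_id ].
Qed.

Lemma cmp_forallb (f : A -> B -> bool) (l : A -> list B) :
  cmp X (fun q : A * B => f (fst q) (snd q)) -> cmp X l ->
  cmp X (fun x => forallb (fun b => f x b) (l x)).
Proof.
  intros Hf Hl.
  apply cmp_ext with (f := fun x => negb (existsb (fun b => negb (f x b)) (l x))).
  { intros a; induction (l a) as [ | b t IH]; cbn; trivial.
    rewrite <- IH. now destruct (f a b). }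
  apply cmp_negb. apply (cmp_existsb (fun x b => negb (f x b))); trivial.
  now apply cmp_negb.
Qed.

Lemma cmp_find (f : A -> B -> bool) (l : A -> list B) :
  cmp X (fun q : A * B => f (fst q) (snd q)) -> cmp X l ->
  cmp X (fun x => find (fun b => f x b) (l x)).
Proof.
  intros Hf Hl.
  apply cmp_ext with
    (f := fun x => fold_right (fun b c => if f x b then Some b else c) None (l x)).
  { intros a; induction (l a) as [ | b t IH]; cbn; trivial; now rewrite IH. }
  apply (cmp_fold_right (fun x b c => if f x b then Some b else c)); trivial;
    [ | apply cmp_const ].
  apply cmp_if; [ | apply cmp_Some, cmp_fst, cmp_snd, cmp_id | apply cmp_snd, cmp_snd, cmp_id ].
  apply (cmp_comp (fun q : A * B => f (fst q) (snd q))
          (fun q : A * (B * option B) => (fst q, fst (snd q)))); trivial.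
  apply cmp_pair; [ apply cmp_fst, cmp_id | apply cmp_fst, cmp_snd, cmp_id ].
Qed.

Lemma cmp_length (l : A -> list B) : cmp X l -> cmp X (fun x => length (l x)).
Proof.
  intros Hl.
  apply cmp_ext with (f := fun x => fold_right (fun _ c => S c) 0 (l x)).
  { intros a; induction (l a) as [ | b t IH]; cbn; trivial; now rewrite IH. }
  apply (cmp_fold_right (fun _ _ c => S c)); trivial; [ | apply cmp_const ].
  apply cmp_S, cmp_snd, cmp_snd, cmp_id.
Qed.

Lemma cmp_tl (l : A -> list B) : cmp X l -> cmp X (fun x => tl (l x)).
Proof.
  intros Hl. apply (cmp_list_case l (fun _ => nil) (fun _ _ t => t)); trivial.
  - apply cmp_const.
  - apply cmp_snd, cmp_snd, cmp_id.
Qed.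

End Lists.

Section Skipn.
Context {A B : Type} `{Enc A} `{Enc B}.

Lemma cmp_skipn (n : A -> nat) (l : A -> list B) :
  cmp X n -> cmp X l -> cmp X (fun x => skipn (n x) (l x)).
Proof.
  intros Hn Hl. apply cmp_ext with (f := fun x => Nat.iter (n x) (@tl B) (l x)).
  { intros a. generalize (l a). induction (n a) as [ | m IH]; intros t; trivial.
    rewrite Nat.iter_succ_r, IH. destruct t; trivial. cbn. now rewrite skipn_nil. }
  apply (cmp_iter (fun _ z => tl z)); trivial. apply cmp_tl, cmp_snd, cmp_id.
Qed.

Lemma cmp_nth_error (l : A -> list B) (n : A -> nat) :
  cmp X l -> cmp X n -> cmp X (fun x => nth_error (l x) (n x)).
Proof.
  intros Hl Hn.
  apply cmp_ext with
    (f := fun x => match skipn (n x) (l x) with nil => None | b :: _ => Some b end).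
  { intros a. generalize (l a). induction (n a) as [ | m IH]; intros [ | b t]; cbn; trivial. }
  apply (cmp_list_case (fun x => skipn (n x) (l x)) (fun _ => None) (fun _ b _ => Some b)).
  - now apply cmp_skipn.
  - apply cmp_const.
  - apply cmp_Some, cmp_fst, cmp_snd, cmp_id.
Qed.
End Skipn.

Section Lists2.
Context {A B C : Type} `{Enc A} `{Enc B} `{Enc C}.

Lemma cmp_nth (n : A -> nat) (l : A -> list B) (d : A -> B) :
  cmp X n -> cmp X l -> cmp X d -> cmp X (fun x => nth (n x) (l x) (d x)).
Proof.
  intros Hn Hl Hd.
  apply cmp_ext with
    (f := fun x => match nth_error (l x) (n x) with Some b => b | None => d x end).
  { intros a. rewrite <- nth_default_eq. reflexivity. }
  apply (cmp_option_case (fun x => nth_error (l x) (n x)) d (fun _ b => b)); trivial.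
  - now apply cmp_nth_error.
  - apply cmp_snd, cmp_id.
Qed.

Lemma cmp_firstn (n : A -> nat) (l : A -> list B) :
  cmp X n -> cmp X l -> cmp X (fun x => firstn (n x) (l x)).
Proof.
  intros Hn Hl.
  apply cmp_ext with (f := fun x => rev (skipn (length (l x) - n x) (rev (l x)))).
  { intros a. now rewrite firstn_skipn_rev. }
  apply cmp_rev, cmp_skipn; [ apply cmp_sub; [ apply cmp_length | ] | apply cmp_rev ]; trivial.
Qed.

Lemma cmp_seq (s n : A -> nat) : cmp X s -> cmp X n -> cmp X (fun x => seq (s x) (n x)).
Proof.
  intros Hs Hn.
  apply cmp_ext with
    (f := fun x => nat_rect (fun _ => list nat) nil (fun i z => z ++ [s x + i]) (n x)).
  { intros a. induction (n a) as [ | m IH]; trivial. rewrite seq_S, <- IH. reflexivity. }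
  apply (cmp_natrec (fun _ => nil) (fun x i z => z ++ [s x + i]) n); trivial.
  - apply cmp_const.
  - apply cmp_app; [ apply cmp_snd, cmp_snd, cmp_id | ].
    apply cmp_cons; [ | apply cmp_const ].
    apply cmp_add; [ | apply cmp_fst, cmp_snd, cmp_id ].
    apply (cmp_comp s fst); trivial. apply cmp_fst, cmp_id.
Qed.
End Lists2.
End Cmp.

(** Words are compared through their codes in the construction, because [=?] on numbers is known to
    be computable. *)
Lemma enc_list_inj (l m : list nat) : enc l = enc m -> l = m.
Proof.
  revert m; induction l as [ | a l IH]; intros [ | b m] E; trivial; try discriminate.
  injection E as E. apply pair_inj in E. destruct E as [E1 E2].
  f_equal; [ exact E1 | now apply IH ].
Qed.

(* Redefined below for further computable functions. *)
Ltac cmp_user := fail.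
(** Syntax directed: the outermost function of the body selects the closure lemma, the patterns
    [@?a x] abstracting its arguments over the variable. The last case eta-expands a function given
    without its argument. *)
Ltac cmp_step :=
  cbn beta;
  first
  [ assumption
  | match goal with |- Enc _ => typeclasses eauto end
  | apply cmp_id | apply cmp_const
  | cmp_user
  | match goal with
    | |- cmp _ (fun x => fst (@?a x)) => eapply cmp_fst
    | |- cmp _ (fun x => snd (@?a x)) => eapply cmp_snd
    | |- cmp _ (fun x => (@?a x, @?b x)) => eapply cmp_pair
    | |- cmp _ (fun x => if @?a x then @?b x else @?c x) => eapply cmp_if
    | |- cmp _ (fun x => S (@?a x)) => eapply cmp_S
    | |- cmp _ (fun x => pred (@?a x)) => eapply cmp_pred
    | |- cmp _ (fun x => @?a x + @?b x) => eapply cmp_add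
    | |- cmp _ (fun x => @?a x - @?b x) => eapply cmp_sub
    | |- cmp _ (fun x => Defs.pair (@?a x) (@?b x)) => eapply cmp_npair
    | |- cmp _ (fun x => pi1 (@?a x)) => eapply cmp_pi1
    | |- cmp _ (fun x => pi2 (@?a x)) => eapply cmp_pi2
    | |- cmp _ (fun x => @?a x <=? @?b x) => eapply cmp_leb
    | |- cmp _ (fun x => @?a x <? @?b x) => eapply cmp_ltb
    | |- cmp _ (fun x => @?a x =? @?b x) => eapply cmp_eqb
    | |- cmp _ (fun x => eqb (@?a x) (@?b x)) => eapply cmp_beqb
    | |- cmp _ (fun x => negb (@?a x)) => eapply cmp_negb
    | |- cmp _ (fun x => @?a x && @?b x) => eapply cmp_andb
    | |- cmp _ (fun x => @?a x || @?b x) => eapply cmp_orb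
    | |- cmp _ (fun x => @?a x :: @?b x) => eapply cmp_cons
    | |- cmp _ (fun x => Some (@?a x)) => eapply cmp_Some
    | |- cmp _ (fun x => (match @?a x with nil => @?b x | cons h t => @?c x h t end)) => eapply cmp_list_case
    | |- cmp _ (fun x => (match @?a x with None => @?b x | Some h => @?c x h end)) => eapply cmp_option_case
    | |- cmp _ (fun x => fold_left (@?a x) (@?b x) (@?c x)) => eapply cmp_fold_left
    | |- cmp _ (fun x => fold_right (@?a x) (@?b x) (@?c x)) => eapply cmp_fold_right
    | |- cmp _ (fun x => @?a x ++ @?b x) => eapply cmp_app
    | |- cmp _ (fun x => rev (@?a x)) => eapply cmp_rev
    | |- cmp _ (fun x => map (@?a x) (@?b x)) => eapply cmp_map
    | |- cmp _ (fun x => filter (@?a x) (@?b x)) => eapply cmp_filter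
    | |- cmp _ (fun x => existsb (@?a x) (@?b x)) => eapply cmp_existsb
    | |- cmp _ (fun x => forallb (@?a x) (@?b x)) => eapply cmp_forallb
    | |- cmp _ (fun x => find (@?a x) (@?b x)) => eapply cmp_find
    | |- cmp _ (fun x => length (@?a x)) => eapply cmp_length
    | |- cmp _ (fun x => tl (@?a x)) => eapply cmp_tl
    | |- cmp _ (fun x => skipn (@?a x) (@?b x)) => eapply cmp_skipn
    | |- cmp _ (fun x => nth_error (@?a x) (@?b x)) => eapply cmp_nth_error
    | |- cmp _ (fun x => nth (@?a x) (@?b x) (@?c x)) => eapply cmp_nth
    | |- cmp _ (fun x => firstn (@?a x) (@?b x)) => eapply cmp_firstn
    | |- cmp _ (fun x => seq (@?a x) (@?b x)) => eapply cmp_seq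
    | |- cmp _ (fun x => Nat.iter (@?a x) (@?b x) (@?c x)) => eapply cmp_iter
    | |- cmp _ (fun x => enc (@?a x)) => eapply cmp_enc
    | Hs : cmp ?X ?s |- cmp ?X (fun x => ?s (@?a x)) => apply (cmp_comp X s a Hs)
    | |- cmp ?X ?f =>
        lazymatch f with fun _ => _ => fail | _ => change (cmp X (fun x => f x)) end
    end ].
Ltac cmp_auto := repeat cmp_step.

Definition memb (n : nat) (l : list nat) : bool := existsb (fun m => Nat.eqb m n) l.
Lemma memb_iff n l : memb n l = true <-> In n l.
Proof.
  unfold memb; rewrite existsb_exists; split.
  - intros (m & Hm & E). apply Nat.eqb_eq in E. now subst.
  - intros Hn; exists n; split; trivial. apply Nat.eqb_refl.
Qed.
Lemma cmp_memb {A} `{Enc A} X (n : A -> nat) l :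
  cmp X n -> cmp X l -> cmp X (fun x => memb (n x) (l x)).
Proof.
  intros. unfold memb.
  apply (cmp_comp X (fun q : nat * list nat => existsb (fun m => m =? fst q) (snd q))
     (fun x => (n x, l x))); cmp_auto.
Qed.

Ltac cmp_user ::= first [ eapply cmp_memb ].

(** * A universal machine with explicit stack *)

Notation frame := (nat * (nat * (nat * nat)))%type.
Notation cfg := (bool * (nat * (nat * list frame)))%type.

Definition ecfg (e n : nat) (s : list frame) : cfg := (false, (e, (n, s))).
Definition rcfg (v : nat) (s : list frame) : cfg := (true, (0, (v, s))).

Definition step_eval (b : nat) (L : list nat) (e n : nat) (s : list frame) : cfg :=
  if pi1 e =? 0 then rcfg 0 s
  else if pi1 e =? 1 then rcfg (S n) s
  else if pi1 e =? 2 then rcfg (pi1 n) s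
  else if pi1 e =? 3 then rcfg (pi2 n) s
  else if pi1 e =? 4 then
    if n <? b then rcfg (if memb n L then 1 else 0) s else ecfg e n s
  else if pi1 e =? 5 then ecfg (pi1 (pi2 e)) n ((0, (pi2 (pi2 e), (n, 0))) :: s)
  else if pi1 e =? 6 then ecfg (pi2 (pi2 e)) n ((2, (pi1 (pi2 e), (0, 0))) :: s)
  else if pi1 e =? 7 then ecfg (pi1 (pi2 e)) (pi1 n) ((3, (pi2 (pi2 e), (n, 0))) :: s)
  else ecfg (pi2 e) (pair n 0) ((4, (pi2 e, (n, 0))) :: s).

(** Frame tags: 0 and 1 wait for the first and the second component of a [Pair] (in frame 1 the slot
    [d] holds the first value), 2 for the inner program of a [Comp]; 3 is the loop of a [Prec] and 4
    the search of a [Mu], with [i] as counter. *)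
Definition step_ret1 (v t d n i : nat) (s : list frame) : cfg :=
  if t =? 0 then ecfg d n ((1, (v, (0, 0))) :: s)
  else if t =? 1 then rcfg (pair d v) s
  else if t =? 2 then ecfg d v s
  else if t =? 3 then
    if i =? pi2 n then rcfg v s
    else ecfg d (pair (pi1 n) (pair i v)) ((3, (d, (n, S i))) :: s)
  else if v =? 0 then rcfg i s
  else ecfg d (pair n (S i)) ((4, (d, (n, S i))) :: s).

Definition step_ret (v : nat) (s : list frame) : cfg :=
  match s with
  | nil => rcfg v nil
  | f :: s => step_ret1 v (fst f) (fst (snd f)) (fst (snd (snd f))) (snd (snd (snd f))) s
  end.

Definition step (b : nat) (L : list nat) (c : cfg) : cfg :=
  if fst c then step_ret (fst (snd (snd c))) (snd (snd (snd c)))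
  else step_eval b L (fst (snd c)) (fst (snd (snd c))) (snd (snd (snd c))).

Definition res (c : cfg) : option nat :=
  match snd (snd (snd c)) with
  | nil => if fst c then Some (fst (snd (snd c))) else None
  | _ => None
  end.

(* [k] bounds both the number of steps and the queries; a larger query blocks. *)
Definition exec (k : nat) (L : list nat) (e n : nat) : option nat :=
  res (Nat.iter k (step k L) (ecfg e n nil)).

Section CmpExec.
Context {T : Type} `{Enc T} (X : set).

Lemma cmp_step_eval (b : T -> nat) L e n s :
  cmp X b -> cmp X L -> cmp X e -> cmp X n -> cmp X s ->
  cmp X (fun x => step_eval (b x) (L x) (e x) (n x) (s x)).
Proof. intros; unfold step_eval, rcfg, ecfg; cmp_auto. Qed.

Lemma cmp_step_ret1 (v t d n i : T -> nat) s :
  cmp X v -> cmp X t -> cmp X d -> cmp X n -> cmp X i -> cmp X s ->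
  cmp X (fun x => step_ret1 (v x) (t x) (d x) (n x) (i x) (s x)).
Proof. intros; unfold step_ret1, rcfg, ecfg; cmp_auto. Qed.
End CmpExec.

Section CmpExec2.
Context {T : Type} `{Enc T} (X : set).

Lemma cmp_stepM (b : T -> nat) L c :
  cmp X b -> cmp X L -> cmp X c -> cmp X (fun x => step (b x) (L x) (c x)).
Proof.
  intros Hb HL Hc.
  apply (cmp_comp X (fun q : nat * (list nat * cfg) => step (fst q) (fst (snd q)) (snd (snd q)))
    (fun x => (b x, (L x, c x)))); [ | cmp_auto ].
  unfold step. apply cmp_if; [ cmp_auto | | apply cmp_step_eval; cmp_auto ].
  unfold step_ret. eapply cmp_list_case; [ cmp_auto | unfold rcfg; cmp_auto | ].
  apply cmp_step_ret1; cmp_auto.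
Qed.
End CmpExec2.

Lemma cmp_exec {T} `{Enc T} (X : set) (k : T -> nat) L e n :
  cmp X k -> cmp X L -> cmp X e -> cmp X n ->
  cmp X (fun x => exec (k x) (L x) (e x) (n x)).
Proof.
  intros Hk HL He Hn.
  apply (cmp_comp X (fun q : nat * (list nat * (nat * nat)) =>
     exec (fst q) (fst (snd q)) (fst (snd (snd q))) (snd (snd (snd q))))
    (fun x => (k x, (L x, (e x, n x))))); [ | cmp_auto ].
  unfold exec.
  assert (R : cmp X res) by (unfold res; cmp_auto).
  apply (cmp_comp X res); trivial.
  eapply cmp_iter; [ | cmp_auto | unfold ecfg; cmp_auto ].
  apply cmp_stepM; cmp_auto.
Qed.

Ltac cmp_user ::= first [ eapply cmp_memb | eapply cmp_exec ].

Lemma res_ecfg e n s : res (ecfg e n s) = None.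
Proof. now destruct s. Qed.

Lemma step_final b L c y : res c = Some y -> res (step b L c) = Some y.
Proof.
  destruct c as [r [e [v [ | f s]]]]; unfold res; cbn; [ | discriminate ].
  destruct r; [ now intros [= ->] | discriminate ].
Qed.

Lemma iter_final b L j c y : res c = Some y -> res (Nat.iter j (step b L) c) = Some y.
Proof. intros E; induction j; cbn; trivial; now apply step_final. Qed.

Lemma iter_final_le b L j k c y : j <= k ->
  res (Nat.iter j (step b L) c) = Some y -> res (Nat.iter k (step b L) c) = Some y.
Proof.
  intros Hk R. replace k with ((k - j) + j) by lia. rewrite Nat.iter_add.
  now apply iter_final.
Qed.

(** Only a query depends on the bound. Either both machines answer it alike, or the smaller one is
    blocked, and a blocked configuration repeats itself without ever giving a result. *)
Lemma step_mono b L b' L' c :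
  b <= b' -> (forall m, m < b -> In m L <-> In m L') ->
  step b' L' c = step b L c \/ (step b L c = c /\ res c = None).
Proof.
  intros Hb HL. destruct c as [[ | ] [e [n s]]]; [ now left | ].
  unfold step; cbn [fst snd]; unfold step_eval.
  destruct (pi1 e =? 0), (pi1 e =? 1), (pi1 e =? 2), (pi1 e =? 3), (pi1 e =? 4),
    (pi1 e =? 5), (pi1 e =? 6), (pi1 e =? 7); auto.
  all: destruct (Nat.ltb_spec n b); [ left | right; split; trivial; apply res_ecfg ].
  all: destruct (Nat.ltb_spec n b'); [ | lia ].
  all: replace (memb n L') with (memb n L); trivial.
  all: apply eq_true_iff_eq; rewrite !memb_iff; auto.
Qed.

Lemma iter_mono b L b' L' j c y :
  b <= b' -> (forall m, m < b -> In m L <-> In m L') ->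
  res (Nat.iter j (step b L) c) = Some y -> res (Nat.iter j (step b' L') c) = Some y.
Proof.
  intros Hb HL; revert c; induction j as [ | j IH]; intros c; [ auto | ].
  rewrite !Nat.iter_succ_r.
  destruct (step_mono b L b' L' c Hb HL) as [E | [E1 E2]].
  - rewrite E. apply IH.
  - intros R. exfalso. rewrite E1 in R.
    assert (N : forall i, Nat.iter i (step b L) c = c).
    { intros i; induction i as [ | i IHi]; trivial. now rewrite Nat.iter_succ, IHi. }
    rewrite N in R. congruence.
Qed.

(** The use principle: [k] bounds the running time and the queries at once, so agreement of the
    oracles below [k] preserves the computation. *)
Lemma exec_mono k L k' L' e n y :
  k <= k' -> (forall m, m < k -> In m L <-> In m L') ->
  exec k L e n = Some y -> exec k' L' e n = Some y.
Proof.
  unfold exec; intros Hk HL R.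
  apply (iter_mono k L k' L') in R; trivial.
  revert R; now apply iter_final_le.
Qed.

Definition agree_below (k : nat) (L : list nat) (X : set) : Prop :=
  forall m, m < k -> In m L <-> X m.

Ltac unstep :=
  unfold step at 1; cbn [fst snd ecfg rcfg];
  cbn [encode]; unfold step_eval, step_ret, step_ret1;
  rewrite ?pi1_pair, ?pi2_pair; cbn [Nat.eqb fst snd];
  rewrite ?pi1_pair, ?pi2_pair.

Lemma step_Zero b L n s : step b L (ecfg (encode Zero) n s) = rcfg 0 s.
Proof. now unstep. Qed.
Lemma step_Succ b L n s : step b L (ecfg (encode Succ) n s) = rcfg (S n) s.
Proof. now unstep. Qed.
Lemma step_Left b L n s : step b L (ecfg (encode Left) n s) = rcfg (pi1 n) s.
Proof. now unstep. Qed.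
Lemma step_Right b L n s : step b L (ecfg (encode Right) n s) = rcfg (pi2 n) s.
Proof. now unstep. Qed.
Lemma step_Query b L n s : step b L (ecfg (encode Query) n s) =
  if n <? b then rcfg (if memb n L then 1 else 0) s else ecfg (encode Query) n s.
Proof. now unstep. Qed.
Lemma step_Pair b L n s c d : step b L (ecfg (encode (Pair c d)) n s) =
  ecfg (encode c) n ((0, (encode d, (n, 0))) :: s).
Proof. now unstep. Qed.
Lemma step_Comp b L n s c d : step b L (ecfg (encode (Comp c d)) n s) =
  ecfg (encode d) n ((2, (encode c, (0, 0))) :: s).
Proof. now unstep. Qed.
Lemma step_Prec b L n s c d : step b L (ecfg (encode (Prec c d)) n s) =
  ecfg (encode c) (pi1 n) ((3, (encode d, (n, 0))) :: s).
Proof. now unstep. Qed.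
Lemma step_Mu b L n s c : step b L (ecfg (encode (Mu c)) n s) =
  ecfg (encode c) (pair n 0) ((4, (encode c, (n, 0))) :: s).
Proof. now unstep. Qed.
Lemma step_r0 b L v d n i s : step b L (rcfg v ((0, (d, (n, i))) :: s)) =
  ecfg d n ((1, (v, (0, 0))) :: s).
Proof. now unstep. Qed.
Lemma step_r1 b L v d n i s : step b L (rcfg v ((1, (d, (n, i))) :: s)) = rcfg (pair d v) s.
Proof. now unstep. Qed.
Lemma step_r2 b L v d n i s : step b L (rcfg v ((2, (d, (n, i))) :: s)) = ecfg d v s.
Proof. now unstep. Qed.
Lemma step_r3 b L v d n i s : step b L (rcfg v ((3, (d, (n, i))) :: s)) =
  if i =? pi2 n then rcfg v s
    else ecfg d (pair (pi1 n) (pair i v)) ((3, (d, (n, S i))) :: s).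
Proof. now unstep. Qed.
Lemma step_r4 b L v d n i s : step b L (rcfg v ((4, (d, (n, i))) :: s)) =
  if v =? 0 then rcfg i s else ecfg d (pair n (S i)) ((4, (d, (n, S i))) :: s).
Proof. now unstep. Qed.
Global Opaque step.

Section Correct.
Variable X : set.

(** The stack [s] is arbitrary so that the runs of subprograms can be chained, and [b'] is only
    bounded below so that several subprograms can share one bound. *)
Lemma exec_fw c : forall n v, eval X c n v ->
  exists b j, forall b' L s, b <= b' -> agree_below b L X ->
    Nat.iter j (step b' L) (ecfg (encode c) n s) = rcfg v s.
Proof.
  induction c as [ | | | | | c IHc d IHd | c IHc d IHd | c IHc d IHd | c IHc];
    intros n v E.
  - exists 0, 1; intros b' L s _ _. cbn in E; subst. cbn. apply step_Zero.
  - exists 0, 1; intros b' L s _ _. cbn in E; subst. cbn. apply step_Succ.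
  - exists 0, 1; intros b' L s _ _. cbn in E; subst. cbn. apply step_Left.
  - exists 0, 1; intros b' L s _ _. cbn in E; subst. cbn. apply step_Right.
  - exists (S n), 1; intros b' L s Hb HL. cbn [Nat.iter nat_rect]. rewrite step_Query.
    destruct (Nat.ltb_spec n b'); [ | lia ].
    specialize (HL n (Nat.lt_succ_diag_r n)). destruct (memb n L) eqn:M.
    + apply memb_iff in M. destruct E as [[_ ->] | [N _]]; trivial. tauto.
    + destruct E as [[N _] | [_ ->]]; trivial.
      apply HL in N. apply memb_iff in N; congruence.
  - destruct E as (p & q & Ep & Eq & ->).
    destruct (IHc _ _ Ep) as (b1 & j1 & H1), (IHd _ _ Eq) as (b2 & j2 & H2).
    exists (max b1 b2), (1 + (j2 + (1 + (j1 + 1)))); intros b' L s Hb HL.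
    rewrite !Nat.iter_add.
    cbn [Nat.iter nat_rect]. rewrite step_Pair, H1, step_r0, H2, step_r1; trivial; try lia;
      intros m Hm; apply HL; lia.
  - destruct E as (p & Ep & Eq).
    destruct (IHd _ _ Ep) as (b1 & j1 & H1), (IHc _ _ Eq) as (b2 & j2 & H2).
    exists (max b1 b2), (j2 + (1 + (j1 + 1))); intros b' L s Hb HL.
    rewrite !Nat.iter_add.
    cbn [Nat.iter nat_rect]. rewrite step_Comp, H1, step_r2, H2; trivial; try lia;
      intros m Hm; apply HL; lia.
  - cbn [eval] in E.
    assert (K : forall i w, i <= pi2 n ->
      nat_rect (fun _ => nat -> Prop) (eval X c (pi1 n))
        (fun i h y => exists z, h z /\ eval X d (pair (pi1 n) (pair i z)) y) i w ->
      exists b j, forall b' L s, b <= b' -> agree_below b L X ->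
        Nat.iter j (step b' L) (ecfg (encode (Prec c d)) n s) =
        rcfg w ((3, (encode d, (n, i))) :: s)).
    { intros i; induction i as [ | i IHi]; intros w Hi Ew; cbn in Ew.
      - destruct (IHc _ _ Ew) as (b1 & j1 & H1). exists b1, (j1 + 1).
        intros b' L s Hb HL. rewrite Nat.iter_add. cbn [Nat.iter nat_rect].
        rewrite step_Prec. now apply H1.
      - destruct Ew as (z & Ez & Ew).
        destruct (IHi z) as (b1 & j1 & H1); [ lia | trivial | ].
        destruct (IHd _ _ Ew) as (b2 & j2 & H2).
        exists (max b1 b2), (j2 + (1 + j1)); intros b' L s Hb HL.
        rewrite !Nat.iter_add. cbn [Nat.iter nat_rect].
        rewrite H1, step_r3; try lia; [ | intros m Hm; apply HL; lia ].
        destruct (Nat.eqb_spec i (pi2 n)); [ lia | ].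
        apply H2; [ lia | intros m Hm; apply HL; lia ]. }
    destruct (K (pi2 n) v) as (b1 & j1 & H1); trivial.
    exists b1, (1 + j1); intros b' L s Hb HL.
    rewrite Nat.iter_add, H1; trivial. cbn [Nat.iter nat_rect].
    rewrite step_r3. now rewrite Nat.eqb_refl.
  - destruct E as [E0 E].
    assert (K : forall i, i <= v -> exists b j, forall b' L s, b <= b' -> agree_below b L X ->
        Nat.iter j (step b' L) (ecfg (encode (Mu c)) n s) =
        ecfg (encode c) (pair n i) ((4, (encode c, (n, i))) :: s)).
    { intros i; induction i as [ | i IHi]; intros Hi.
      - exists 0, 1. intros b' L s _ _. cbn [Nat.iter nat_rect]. apply step_Mu.
      - destruct IHi as (b1 & j1 & H1); [ lia | ].
        destruct (E i) as [w Ew]; [ lia | ].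
        destruct (IHc _ _ Ew) as (b2 & j2 & H2).
        exists (max b1 b2), (1 + (j2 + j1)); intros b' L s Hb HL.
        rewrite !Nat.iter_add, H1, H2; try lia; try (intros m Hm; apply HL; lia).
        cbn [Nat.iter nat_rect]. rewrite step_r4. reflexivity. }
    destruct (K v) as (b1 & j1 & H1); trivial.
    destruct (IHc _ _ E0) as (b2 & j2 & H2).
    exists (max b1 b2), (1 + (j2 + j1)); intros b' L s Hb HL.
    rewrite !Nat.iter_add, H1, H2; try lia; try (intros m Hm; apply HL; lia).
    cbn [Nat.iter nat_rect]. rewrite step_r4. reflexivity.
Qed.

(** A run that ends with a result has to return to the stack [s] on the way. The strict decrease of
    the number of remaining steps carries the inner inductions for [Prec] and [Mu]. *)
Lemma exec_bw b L c : agree_below b L X -> forall j n s y,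
  res (Nat.iter j (step b L) (ecfg (encode c) n s)) = Some y ->
  exists v j2, j2 < j /\ eval X c n v /\ res (Nat.iter j2 (step b L) (rcfg v s)) = Some y.
Proof.
  intros HL.
  induction c as [ | | | | | c IHc d IHd | c IHc d IHd | c IHc d IHd | c IHc];
    intros [ | j] n s y R; try (exfalso; cbn [Nat.iter nat_rect] in R; now rewrite res_ecfg in R);
    rewrite Nat.iter_succ_r in R.
  - rewrite step_Zero in R. exists 0, j; cbn; auto.
  - rewrite step_Succ in R. exists (S n), j; cbn; auto.
  - rewrite step_Left in R. exists (pi1 n), j; cbn; auto.
  - rewrite step_Right in R. exists (pi2 n), j; cbn; auto.
  - rewrite step_Query in R. destruct (Nat.ltb_spec n b) as [Lt | Ge].
    + exists (if memb n L then 1 else 0), j; repeat split; auto.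
      cbn. specialize (HL n Lt). rewrite <- memb_iff in HL.
      destruct (memb n L); [ left | right ]; split; trivial; [ now apply HL | ].
      intros Q; apply HL in Q; discriminate.
    + exfalso.
      assert (N : forall i, Nat.iter i (step b L) (ecfg (encode Query) n s) = ecfg (encode Query) n s).
      { intros i; induction i as [ | i IHi]; trivial. rewrite Nat.iter_succ, IHi, step_Query.
        destruct (Nat.ltb_spec n b); trivial; lia. }
      rewrite N, res_ecfg in R; discriminate.
  - rewrite step_Pair in R. apply IHc in R. destruct R as (p & [ | j1] & Lt & Ep & R);
      [ discriminate | ].
    rewrite Nat.iter_succ_r, step_r0 in R. apply IHd in R.
    destruct R as (q & [ | j2] & Lt' & Eq & R); [ discriminate | ].
    rewrite Nat.iter_succ_r, step_r1 in R.
    exists (pair p q), j2; repeat split; trivial; [ lia | ].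
    cbn; eauto.
  - rewrite step_Comp in R. apply IHd in R. destruct R as (p & [ | j1] & Lt & Ep & R);
      [ discriminate | ].
    rewrite Nat.iter_succ_r, step_r2 in R. apply IHc in R.
    destruct R as (q & j2 & Lt' & Eq & R).
    exists q, j2; repeat split; trivial; [ lia | ]. cbn; eauto.
  - rewrite step_Prec in R. apply IHc in R. destruct R as (p & j1 & Lt & Ep & R).
    assert (K : forall j1 i w, i <= pi2 n ->
      nat_rect (fun _ => nat -> Prop) (eval X c (pi1 n))
        (fun i h y => exists z, h z /\ eval X d (pair (pi1 n) (pair i z)) y) i w ->
      res (Nat.iter j1 (step b L) (rcfg w ((3, (encode d, (n, i))) :: s))) = Some y ->
      exists v j2, j2 < S j1 /\ eval X (Prec c d) n v /\
        res (Nat.iter j2 (step b L) (rcfg v s)) = Some y).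
    { clear - IHd. intros j1; induction j1 as [j1 IH] using lt_wf_ind; intros i w Hi Ew R.
      destruct j1 as [ | j1]; [ discriminate | ].
      rewrite Nat.iter_succ_r, step_r3 in R.
      destruct (Nat.eqb_spec i (pi2 n)) as [-> | Ne].
      - exists w, j1; repeat split; trivial; lia.
      - apply IHd in R. destruct R as (q & j2 & Lt & Eq & R).
        destruct (IH j2) with (i := S i) (w := q) as (v & j3 & Lt3 & Ev & R3); trivial; try lia.
        + cbn. eauto.
        + exists v, j3; repeat split; trivial; lia. }
    destruct (K j1 0 p) as (v & j2 & Lt2 & Ev & R2); trivial; [ lia | ].
    exists v, j2; repeat split; trivial; lia.
  - rewrite step_Mu in R.
    assert (K : forall j i, (forall i', i' < i -> exists k, eval X c (pair n i') (S k)) ->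
      res (Nat.iter j (step b L) (ecfg (encode c) (pair n i) ((4, (encode c, (n, i))) :: s))) = Some y ->
      exists v j2, j2 < j /\ eval X (Mu c) n v /\
        res (Nat.iter j2 (step b L) (rcfg v s)) = Some y).
    { clear - IHc. intros j; induction j as [j IH] using lt_wf_ind; intros i Hi R.
      apply IHc in R. destruct R as (w & [ | j1] & Lt & Ew & R); [ discriminate | ].
      rewrite Nat.iter_succ_r, step_r4 in R. destruct w as [ | w]; cbn [Nat.eqb] in R.
      - exists i, j1; split; [ lia | split; trivial; now split ].
      - destruct (IH j1) with (i := S i) as (v & j3 & Lt3 & Ev & R3); trivial; try lia.
        + intros i' Hi'. destruct (Nat.eq_dec i' i) as [-> | ]; [ eauto | apply Hi; lia ].
        + exists v, j3; split; [ lia | now split ]. }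
    destruct (K j 0) as (v & j2 & Lt2 & Ev & R2); trivial; [ lia | ].
    exists v, j2; split; [ lia | now split ].
Qed.

Lemma exec_complete c n v : eval X c n v ->
  exists k, forall k' L, k <= k' -> agree_below k L X -> exec k' L (encode c) n = Some v.
Proof.
  intros E. destruct (exec_fw c n v E) as (b & j & Hj).
  exists (max b j); intros k' L Hk HL. unfold exec.
  apply (iter_final_le _ _ j); [ lia | ]. rewrite Hj; trivial; [ lia | ].
  intros m Hm; apply HL; lia.
Qed.

Lemma exec_sound k L c n v : agree_below k L X -> exec k L (encode c) n = Some v -> eval X c n v.
Proof.
  intros HL R. apply exec_bw in R; trivial.
  destruct R as (w & j & _ & Ew & R).
  assert (N : forall i, Nat.iter i (step k L) (rcfg w nil) = rcfg w nil).
  { intros i; induction i as [ | i IHi]; trivial. now rewrite Nat.iter_succ, IHi. }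
  rewrite N in R. injection R as <-. exact Ew.
Qed.
End Correct.

(** * Decidability and enumerability relative to an oracle *)

Definition chi {T} (P : T -> Prop) (a : T) : bool :=
  if excluded_middle_informative (P a) then true else false.
Lemma chi_iff {T} (P : T -> Prop) a : chi P a = true <-> P a.
Proof. unfold chi; destruct excluded_middle_informative; split; trivial; easy. Qed.

(** Since [chi] is the classical characteristic function, this is a property of the predicate up to
    equivalence and not of a chosen test. *)
Definition dec (X : set) {T} `{Enc T} (P : T -> Prop) : Prop := cmp X (chi P).

Section Dec.
Variable X : set.

Section Dec1.
Context {T S : Type} `{Enc T} `{Enc S}.
Implicit Types P Q : T -> Prop.

Lemma dec_bool (f : T -> bool) P : cmp X f -> (forall a, f a = true <-> P a) -> dec X P.
Proof.
  intros Hf E. apply cmp_ext with (f := f); trivial.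
  intros a. apply eq_true_iff_eq. now rewrite chi_iff.
Qed.

Lemma dec_ext P Q : (forall a, P a <-> Q a) -> dec X P -> dec X Q.
Proof.
  intros E Hp. apply dec_bool with (f := chi P); trivial. intros a. now rewrite chi_iff.
Qed.

Lemma dec_istrue (f : T -> bool) : cmp X f -> dec X (fun a => f a = true).
Proof. intros Hf. apply dec_bool with (f := f); easy. Qed.

Lemma dec_const (p : Prop) : dec X (fun _ : T => p).
Proof.
  destruct (classic p).
  - apply dec_bool with (f := fun _ => true); [ apply cmp_const | easy ].
  - apply dec_bool with (f := fun _ => false); [ apply cmp_const | easy ].
Qed.

Lemma dec_and P Q : dec X P -> dec X Q -> dec X (fun a => P a /\ Q a).
Proof.
  intros HP HQ. apply dec_bool with (f := fun a => chi P a && chi Q a).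
  - now apply cmp_andb.
  - intros a. now rewrite andb_true_iff, !chi_iff.
Qed.

Lemma dec_or P Q : dec X P -> dec X Q -> dec X (fun a => P a \/ Q a).
Proof.
  intros HP HQ. apply dec_bool with (f := fun a => chi P a || chi Q a).
  - now apply cmp_orb.
  - intros a. now rewrite orb_true_iff, !chi_iff.
Qed.

Lemma dec_not P : dec X P -> dec X (fun a => ~ P a).
Proof.
  intros HP. apply dec_bool with (f := fun a => negb (chi P a)).
  - now apply cmp_negb.
  - intros a. rewrite negb_true_iff, <- not_true_iff_false. now rewrite chi_iff.
Qed.

Lemma dec_imp P Q : dec X P -> dec X Q -> dec X (fun a => P a -> Q a).
Proof.
  intros HP HQ. apply dec_ext with (P := fun a => ~ P a \/ Q a).
  - intros a. split; [ tauto | ]. intros K; destruct (classic (P a)); tauto.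
  - apply dec_or; trivial. now apply dec_not.
Qed.

Lemma dec_iff P Q : dec X P -> dec X Q -> dec X (fun a => P a <-> Q a).
Proof. intros HP HQ. apply dec_and; now apply dec_imp. Qed.

Lemma dec_comp (P : S -> Prop) (f : T -> S) :
  dec X P -> cmp X f -> dec X (fun a => P (f a)).
Proof. intros HP Hf. exact (cmp_comp X (chi P) f HP Hf). Qed.

Lemma dec_oracle (f : T -> nat) : cmp X f -> dec X (fun a => X (f a)).
Proof.
  intros [c Hc]. exists (Comp Query c); intros a; cbn. exists (f a); split; [ apply Hc | ].
  unfold chi; destruct excluded_middle_informative; auto.
Qed.

Lemma decn_le (f g : T -> nat) : cmp X f -> cmp X g -> dec X (fun a => f a <= g a).
Proof.
  intros. apply dec_bool with (f := fun a => f a <=? g a); [ now apply cmp_leb | ].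
  intros a; apply Nat.leb_le.
Qed.

Lemma decn_lt (f g : T -> nat) : cmp X f -> cmp X g -> dec X (fun a => f a < g a).
Proof.
  intros. apply dec_bool with (f := fun a => f a <? g a); [ now apply cmp_ltb | ].
  intros a; apply Nat.ltb_lt.
Qed.

Lemma decn_eq (f g : T -> nat) : cmp X f -> cmp X g -> dec X (fun a => f a = g a).
Proof.
  intros. apply dec_bool with (f := fun a => f a =? g a); [ now apply cmp_eqb | ].
  intros a; apply Nat.eqb_eq.
Qed.

Lemma dec_ex_in (P : T -> S -> Prop) (l : T -> list S) :
  dec X (fun q : T * S => P (fst q) (snd q)) -> cmp X l ->
  dec X (fun a => exists s, In s (l a) /\ P a s).
Proof.
  intros HP Hl.
  apply dec_bool with (f := fun a => existsb (fun s => chi (fun q => P (fst q) (snd q)) (a, s)) (l a)).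
  - apply (cmp_existsb X (fun a s => chi (fun q => P (fst q) (snd q)) (a, s))); trivial.
  - intros a. rewrite existsb_exists. split; intros (s & Hs & K); exists s; split; trivial.
    + exact (proj1 (chi_iff _ _) K).
    + exact (proj2 (chi_iff (fun q => P (fst q) (snd q)) (a, s)) K).
Qed.

End Dec1.

Section Dec1b.
Context {T : Type} `{Enc T}.

Lemma dec_ex_lt (P : T -> nat -> Prop) (n : T -> nat) :
  dec X (fun q : T * nat => P (fst q) (snd q)) -> cmp X n ->
  dec X (fun a => exists i, i < n a /\ P a i).
Proof.
  intros HP Hn.
  apply dec_ext with (P := fun a => exists i, In i (seq 0 (n a)) /\ P a i).
  - intros a; split; intros (i & Hi & K); exists i; split; trivial.
    + apply in_seq in Hi; lia.
    + apply in_seq; lia.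
  - apply dec_ex_in; trivial. apply cmp_seq; trivial. apply cmp_const.
Qed.
End Dec1b.

Section Dec2.
Context {T S : Type} `{Enc T} `{Enc S}.

Lemma dec_all_lt (P : T -> nat -> Prop) (n : T -> nat) :
  dec X (fun q : T * nat => P (fst q) (snd q)) -> cmp X n ->
  dec X (fun a => forall i, i < n a -> P a i).
Proof.
  intros HP Hn. apply dec_ext with (P := fun a => ~ exists i, i < n a /\ ~ P a i).
  - intros a; split.
    + intros K i Hi. apply NNPP. intros Q. apply K. eauto.
    + intros K (i & Hi & Q). auto.
  - apply dec_not, dec_ex_lt; trivial. apply (dec_not (fun q => P (fst q) (snd q)) HP).
Qed.

Lemma cmp_search (R : T -> nat -> Prop) :
  dec X (fun q : T * nat => R (fst q) (snd q)) -> (forall a, exists n, R a n) ->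
  exists f, cmp X f /\ forall a, R a (f a).
Proof.
  intros HR Tot.
  assert (L : forall a, exists n, R a n /\ forall i, i < n -> ~ R a i).
  { intros a. destruct (Tot a) as [n Hn]. revert Hn.
    induction n as [n IH] using lt_wf_ind; intros Hn.
    destruct (classic (exists i, i < n /\ R a i)) as [(i & Hi & K) | N]; eauto.
    exists n; split; trivial. intros i Hi K; apply N; eauto. }
  set (f := fun a => proj1_sig (constructive_indefinite_description _ (L a))).
  assert (Hf : forall a, R a (f a) /\ forall i, i < f a -> ~ R a i).
  { intros a. unfold f. apply proj2_sig. }
  clearbody f. exists f; split; [ | intros a; apply Hf ].
  destruct (cmp_if X _ (fun _ => 0) (fun _ => 1) HR (cmp_const X 0) (cmp_const X 1)) as [c Hc].
  exists (Mu c); intros a. destruct (Hf a) as [K1 K2]. cbn [eval]. split.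
  - specialize (Hc (a, f a)). cbv beta in Hc.
    rewrite (proj2 (chi_iff (fun q => R (fst q) (snd q)) (a, f a)) K1) in Hc. exact Hc.
  - intros i Hi. exists 0. specialize (Hc (a, i)). cbv beta in Hc.
    specialize (K2 i Hi). destruct (chi (fun q => R (fst q) (snd q)) (a, i)) eqn:E; [ | exact Hc ].
    destruct (K2 (proj1 (chi_iff _ _) E)).
Qed.

(** The pattern of the decision procedures from [limA]: [Q a n] says that stage [n] can be trusted
    about [a], and [D a n] is the answer read off there. *)
Lemma dec_witness (Q D : T -> nat -> Prop) (P : T -> Prop) :
  dec X (fun q : T * nat => Q (fst q) (snd q)) -> (forall a, exists n, Q a n) ->
  dec X (fun q : T * nat => D (fst q) (snd q)) ->
  (forall a n, Q a n -> (D a n <-> P a)) -> dec X P.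
Proof.
  intros HQ Tot HD K. destruct (cmp_search Q HQ Tot) as (f & Hf & Hf').
  apply dec_ext with (P := fun a => D a (f a)).
  - intros a. now apply K.
  - apply (dec_comp (fun q => D (fst q) (snd q)) (fun a => (a, f a)) HD).
    apply cmp_pair; trivial. apply cmp_id.
Qed.
End Dec2.

Definition re {T} `{Enc T} (P : T -> Prop) : Prop :=
  exists R : T -> nat -> Prop,
    dec X (fun q : T * nat => R (fst q) (snd q)) /\ forall a, P a <-> exists n, R a n.

Context {T S : Type} `{Enc T} `{Enc S}.

Lemma re_ext (P Q : T -> Prop) : (forall a, P a <-> Q a) -> re P -> re Q.
Proof. intros E (R & HR & K). exists R; split; trivial. intros a. now rewrite <- E. Qed.

Lemma re_dec (P : T -> Prop) : dec X P -> re P.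
Proof.
  intros HP. exists (fun a _ => P a); split.
  - apply (dec_comp P fst HP). cmp_auto.
  - intros a; split; [ intros; now exists 0 | now intros [_ ?] ].
Qed.

Lemma re_ex (R : T -> nat -> Prop) :
  dec X (fun q : T * nat => R (fst q) (snd q)) -> re (fun a => exists n, R a n).
Proof. intros HR. now exists R. Qed.

End Dec.

Section Dec3.
Variable X : set.
Context {T S : Type} `{Enc T} `{Enc S}.

Lemma re_or (P Q : T -> Prop) : re X P -> re X Q -> re X (fun a => P a \/ Q a).
Proof.
  intros (R & HR & K) (R' & HR' & K'). exists (fun a n => R a n \/ R' a n); split.
  - now apply (dec_or X (fun q => R (fst q) (snd q))).
  - intros a. rewrite K, K'. split.
    + intros [[n Hn] | [n Hn]]; eauto.
    + intros [n [Hn | Hn]]; eauto.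
Qed.

Lemma re_and (P Q : T -> Prop) : re X P -> re X Q -> re X (fun a => P a /\ Q a).
Proof.
  intros (R & HR & K) (R' & HR' & K').
  exists (fun a n => R a (pi1 n) /\ R' a (pi2 n)); split.
  - apply dec_and.
    + apply (dec_comp X (fun q => R (fst q) (snd q)) (fun q : T * nat => (fst q, pi1 (snd q))) HR).
      cmp_auto.
    + apply (dec_comp X (fun q => R' (fst q) (snd q)) (fun q : T * nat => (fst q, pi2 (snd q))) HR').
      cmp_auto.
  - intros a. rewrite K, K'. split.
    + intros [[n Hn] [m Hm]]. exists (pair n m). now rewrite pi1_pair, pi2_pair.
    + intros [n [Hn Hm]]; eauto.
Qed.

End Dec3.

(** * Changing the oracle *)

Fixpoint subst_query (q c : code) : code :=
  match c with
  | Query => q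
  | Pair c d => Pair (subst_query q c) (subst_query q d)
  | Comp c d => Comp (subst_query q c) (subst_query q d)
  | Prec c d => Prec (subst_query q c) (subst_query q d)
  | Mu c => Mu (subst_query q c)
  | c => c
  end.

Lemma eval_subst_query X Y q :
  (forall n, (X n -> eval Y q n 1) /\ (~ X n -> eval Y q n 0)) ->
  forall c n y, eval X c n y -> eval Y (subst_query q c) n y.
Proof.
  intros Hq c; induction c as [ | | | | | c IHc d IHd | c IHc d IHd | c IHc d IHd | c IHc];
    cbn [subst_query]; intros n y E; cbn [eval] in E |- *; trivial.
  - destruct E as [[E ->] | [E ->]]; now apply Hq.
  - destruct E as (a & b & Ea & Eb & ->). exists a, b. auto.
  - destruct E as (a & Ea & Eb). exists a. auto.
  - revert y E; induction (pi2 n) as [ | i IHi]; cbn; intros y E; auto.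
    destruct E as (z & Ez & E); eauto.
  - destruct E as [E0 E]; split; auto. intros i Hi. destruct (E i Hi) as [k Hk]; eauto.
Qed.

Lemma dec_chi_eval Y (X : set) : dec Y X <->
  exists q, forall n, (X n -> eval Y q n 1) /\ (~ X n -> eval Y q n 0).
Proof.
  split; intros [q Hq]; exists q; intros n; specialize (Hq n); unfold chi in *;
    destruct excluded_middle_informative; first [ tauto | split; intros; [ exact Hq | tauto ] | split; intros; [ tauto | exact Hq ] ].
Qed.

Lemma cmp_oracle (X Y : set) {S T} `{Enc S} `{Enc T} (f : S -> T) :
  dec Y X -> cmp X f -> cmp Y f.
Proof.
  intros HX [c Hc]. apply dec_chi_eval in HX. destruct HX as [q Hq].
  exists (subst_query q c); intros a. now apply (eval_subst_query X Y q Hq).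
Qed.

Lemma dec_oracle_trans (X Y : set) {T} `{Enc T} (P : T -> Prop) : dec Y X -> dec X P -> dec Y P.
Proof. apply cmp_oracle. Qed.

Lemma re_oracle (X Y : set) {T} `{Enc T} (P : T -> Prop) : dec Y X -> re X P -> re Y P.
Proof. intros HX (R & HR & K). exists R; split; trivial. now apply (dec_oracle_trans X). Qed.

Lemma dec_empty (Y : set) : dec Y empty.
Proof. apply dec_const. Qed.

Lemma cmp_any (Y : set) {S T} `{Enc S} `{Enc T} (f : S -> T) : cmp empty f -> cmp Y f.
Proof. apply cmp_oracle, dec_empty. Qed.

(** A witness [e] must be the code of a program, since it converges at 0, and by injectivity of
    [encode] the same program serves all inputs. *)
Lemma turing_le_dec A B : turing_le A B <-> dec B A.
Proof.
  rewrite dec_chi_eval. split.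
  - intros [e He].
    destruct (classic (exists c, encode c = e)) as [[c Ec] | N].
    + exists c; intros n. destruct (He n) as [H1 H0].
      split; intros K; [ destruct (H1 K) as (d & Ed & E) | destruct (H0 K) as (d & Ed & E) ];
        rewrite <- Ec in Ed; now apply encode_inj in Ed; subst d.
    + exfalso. destruct (He 0) as [H1 H0].
      destruct (classic (A 0)) as [K | K];
        [ destruct (H1 K) as (d & Ed & _) | destruct (H0 K) as (d & Ed & _) ]; eauto.
  - intros [q Hq]. exists (encode q). intros x; specialize (Hq x).
    split; intros K; exists q; split; trivial; now apply Hq.
Qed.

Lemma turing_le_trans A B C : turing_le A B -> turing_le B C -> turing_le A C.
Proof. rewrite !turing_le_dec. intros H1 H2. now apply (dec_oracle_trans B). Qed.

Lemma turing_equiv_trans A B C : turing_equiv A B -> turing_equiv B C -> turing_equiv A C.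
Proof. intros [? ?] [? ?]; split; eapply turing_le_trans; eauto. Qed.

Definition initial (X : set) (k : nat) : list nat := filter (chi X) (seq 0 k).

Lemma initial_agree X k : agree_below k (initial X k) X.
Proof.
  intros m Hm. unfold initial. rewrite filter_In, chi_iff, in_seq. split; [ tauto | ].
  intros; repeat split; trivial; lia.
Qed.

Lemma cmp_initial X {T} `{Enc T} (k : T -> nat) : cmp X k -> cmp X (fun x => initial X (k x)).
Proof.
  intros Hk. unfold initial. eapply (cmp_filter X (fun _ m => chi X m)).
  - apply (dec_oracle X (fun q => snd q)). cmp_auto.
  - cmp_auto.
Qed.

Lemma eval_iff_exec X c n y :
  eval X c n y <-> exists k, exec k (initial X k) (encode c) n = Some y.
Proof.
  split.
  - intros E. destruct (exec_complete X c n y E) as [k Hk]. exists k. apply Hk; trivial.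
    apply initial_agree.
  - intros [k Hk]. apply (exec_sound X k) in Hk; trivial. apply initial_agree.
Qed.

Definition halts_in (X : set) (k e n : nat) : Prop := exec k (initial X k) e n <> None.

Lemma cmp_option_isnone X {T S} `{Enc T} `{Enc S} (o : T -> option S) :
  cmp X o -> dec X (fun x => o x <> None).
Proof.
  intros Ho. apply dec_bool with (f := fun x => match o x with Some _ => true | None => false end).
  - cmp_auto.
  - intros a; destruct (o a); split; easy.
Qed.

Lemma dec_halts_in X {T} `{Enc T} (k e n : T -> nat) :
  cmp X k -> cmp X e -> cmp X n -> dec X (fun x => halts_in X (k x) (e x) (n x)).
Proof.
  intros. unfold halts_in. eapply cmp_option_isnone. apply cmp_exec; trivial. now apply cmp_initial.
Qed.

Lemma halts_iff X c n : (exists y, eval X c n y) <-> exists k, halts_in X k (encode c) n.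
Proof.
  split.
  - intros [y E]. apply eval_iff_exec in E. destruct E as [k Hk]. exists k. unfold halts_in.
    now rewrite Hk.
  - intros [k Hk]. unfold halts_in in Hk. destruct exec as [y | ] eqn:E; [ | easy ].
    exists y. apply eval_iff_exec. eauto.
Qed.

Lemma re_iff_code X (P : nat -> Prop) :
  re X P <-> exists c, forall x, P x <-> exists y, eval X c x y.
Proof.
  split.
  - intros (R & HR & K).
    destruct (cmp_if X _ (fun _ => 0) (fun _ => 1) HR (cmp_const X 0) (cmp_const X 1)) as [c Hc].
    exists (Mu c); intros x. rewrite K. split.
    + intros [n Hn]. revert Hn. induction n as [n IH] using lt_wf_ind; intros Hn.
      destruct (classic (exists i, i < n /\ R x i)) as [(i & Hi & Q) | N]; eauto.
      exists n; cbn [eval]; split.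
      * specialize (Hc (x, n)). cbv beta in Hc.
        rewrite (proj2 (chi_iff (fun q => R (fst q) (snd q)) (x, n)) Hn) in Hc. exact Hc.
      * intros i Hi. exists 0. specialize (Hc (x, i)). cbv beta in Hc.
        destruct (chi (fun q => R (fst q) (snd q)) (x, i)) eqn:E; [ | exact Hc ].
        exfalso; apply N; exists i; split; trivial. exact (proj1 (chi_iff _ _) E).
    + intros [n [E _]]. exists n. specialize (Hc (x, n)). cbv beta in Hc.
      destruct (chi (fun q => R (fst q) (snd q)) (x, n)) eqn:Q; [ exact (proj1 (chi_iff _ _) Q) | ].
      discriminate (eval_functional _ _ _ _ _ E Hc).
  - intros [c Hc]. apply re_ext with (P := fun x => exists k, halts_in X k (encode c) x).
    + intros x. now rewrite Hc, halts_iff.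
    + apply re_ex. apply dec_halts_in; cmp_auto.
Qed.

(** By simulation: a halting computation depends on a finite part of the oracle, which both sets
    share. *)
Lemma eval_ext X Y c n y : same_set X Y -> eval X c n y -> eval Y c n y.
Proof.
  intros E R. apply exec_complete in R. destruct R as [k Hk].
  apply (exec_sound Y k (initial Y k)); [ apply initial_agree | ].
  apply Hk; trivial. intros m Hm. rewrite (E m). now apply initial_agree.
Qed.

(** * The construction *)

(* A strategy: [rst] is the stage at which it started, [pos] the next number that it puts
   into the set, [live] the pairs (word, stage) to which it can return, newest first;
   [mode] is 0, 1 after an [Act2] and 2 after an [Act3]; [ret] is the stage of the [Act2]. *)
Record run := Run
  { rst : nat; pos : nat; word : list nat; live : list (list nat * nat);
    mode : nat; ret : nat }.

Definition run_tuple (p : run) :=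
  (rst p, (pos p, (word p, (live p, (mode p, ret p))))).
#[export] Instance enc_run : Enc run := fun p => enc (run_tuple p).

(* The last argument of [Letter] is [0], or [S t] when stage [t] is committed. *)
Inductive event :=
| Push | Enter (kap k : nat) | Letter (kap k i c : nat)
| Fwd (i : nat) | Act2 (i t : nat) | Act3 (i b : nat).

Definition ev_tuple (e : event) : nat * (nat * (nat * (nat * nat))) :=
  match e with
  | Push => (0, (0, (0, (0, 0))))
  | Enter kap k => (1, (kap, (k, (0, 0))))
  | Letter kap k i c => (2, (kap, (k, (i, c))))
  | Fwd i => (3, (i, (0, (0, 0))))
  | Act2 i t => (4, (i, (t, (0, 0))))
  | Act3 i b => (5, (i, (b, (0, 0))))
  end.
#[export] Instance enc_event : Enc event := fun e => enc (ev_tuple e).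

(* The current set, the recorded computations with their uses, and the strategies; the
   number [pair e y] stands for the computation of program [e] on [y]. *)
Notation state := (list nat * (list (nat * nat) * list run))%type.
Definition stA (s : state) := fst s.
Definition stI (s : state) := fst (snd s).
Definition stR (s : state) := snd (snd s).

Definition isprefix (p l : list nat) : bool := enc p =? enc (firstn (length p) l).

Definition hcomp (kap k : nat) (A : list nat) : bool :=
  match exec k A (pi1 kap) (pi2 kap) with Some _ => true | None => false end.

Definition J1 (eU sg : nat) : list nat :=
  map (fun u => pair 1 u)
    (filter (fun u => match exec sg [] eU u with Some _ => true | None => false end)
       (seq 0 sg)).

(** A snapshot of a 2-REA set with three independent clocks: [sg] for the first column, [g] for the
    computations of the second column from it, and [w], which becomes the use of the reduction of
    the constructed set to the 2-REA set. *)
Definition J2 (eU eV sg g w : nat) : list nat :=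
  J1 eU sg ++
  map (fun v => pair 2 v)
    (filter (fun v => match exec g (J1 eU sg) eV v with Some _ => true | None => false end)
       (seq 0 w)).

Definition eqon (o : option nat) (b : bool) : bool :=
  match o with Some y => y =? (if b then 1 else 0) | None => false end.

(** By the last clause the constructed set itself confirms, through [ePhi], the part of the first
    column that the computations of the second may query; elements with first component 2 are left
    out because there the 2-REA set is not its first column. The clocks are at least [last] so that
    later agreements use later snapshots. *)
Definition agree1 (ePhi ePsi eU eV last n : nat) (A : list nat) (sg g w : nat) : bool :=
  (last <=? sg) && (last <=? g) && (last <=? w) &&
  forallb (fun y => eqon (exec w (J2 eU eV sg g w) ePsi y) (memb y A)) (seq 0 (S last)) &&
  forallb (fun m => eqon (exec n A ePhi m) (memb m (J2 eU eV sg g w))) (seq 0 w) &&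
  forallb (fun m => (pi1 m =? 2) || eqon (exec n A ePhi m) (memb m (J1 eU sg))) (seq 0 g).

Definition agreeb (i last n : nat) (A : list nat) : bool :=
  existsb (fun z => agree1 (pi1 i) (pi1 (pi2 i)) (pi1 (pi2 (pi2 i))) (pi2 (pi2 (pi2 i)))
                      last n A (pi1 z) (pi1 (pi2 z)) (pi2 (pi2 z))) (seq 0 (S n)).

(** The next number of the strategy threatens the computation. The condition [kap <= rst p] makes
    the alphabet of a strategy finite. *)
Definition letters (kap k : nat) (R : list run) (i : nat) : bool :=
  match nth_error R i with
  | None => false
  | Some p => (mode p =? 0) && (kap <=? rst p) && (pos p <? k)
  end.

(** [live] is newest first, so the commitment is to the newest matching stage and gives up as few
    returns as possible; both [word_committed] and the termination argument depend on this
    choice. *)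
Definition ev_letter (kap k i : nat) (p : run) : event :=
  match find (fun q => isprefix (word p ++ [kap]) (fst q)) (live p) with
  | None => Letter kap k i 0
  | Some q => Letter kap k i (S (snd q))
  end.

Definition ev_enter1 (kap k : nat) (R : list run) : event :=
  match find (fun i => letters kap k R i) (seq 0 (length R)) with
  | None => Enter kap k
  | Some i =>
      match nth_error R i with None => Push | Some p => ev_letter kap k i p end
  end.

(** [Push] doubles as the idle event: a stage with nothing else to do starts a new strategy. *)
Definition ev_enter (n kap : nat) (s : state) : event :=
  if existsb (fun p => fst p =? kap) (stI s) then Push
  else match find (fun k => hcomp kap k (stA s)) (seq 0 (S n)) with
       | None => Push
       | Some k => ev_enter1 kap k (stR s)
       end.

Definition ev_run1 (i : nat) (p : run) : event :=
  if mode p =? 0 then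
    match find (fun q => enc (fst q) =? enc (word p)) (live p) with
    | None => Fwd i
    | Some q => Act2 i (snd q)
    end
  else if mode p =? 1 then Act3 i (ret p) else Push.

Definition ev_run (n i : nat) (s : state) : event :=
  match nth_error (stR s) i with
  | None => Push
  | Some p => if agreeb i (pos p) n (stA s) then ev_run1 i p else Push
  end.

(* Stage [n] looks at the computation or the strategy numbered [pi1 n], so that each of
   them gets infinitely many stages. *)
Definition ev (n : nat) (s : state) : event :=
  if pi1 (pi1 n) =? 0 then ev_enter n (pi2 (pi1 n)) s else ev_run n (pi2 (pi1 n)) s.

Definition new_run (n : nat) : run := Run n n [] [] 0 0.
Definition letter_run (kap c : nat) (p : run) : run :=
  Run (rst p) (pos p) (word p ++ [kap])
    (if c =? 0 then live p else filter (fun q => snd q <=? pred c) (live p)) (mode p) (ret p).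
(** The stage [n] is the new number, being larger than every number and every use recorded so far;
    it is also the stage under which the old word is stacked. *)
Definition fwd_run (n : nat) (p : run) : run :=
  Run (rst p) n [] ((word p, n) :: live p) (mode p) (ret p).
(** In mode 1 [pos] is no longer a number to be put in: it is the length of agreement to wait for.
    In modes 1 and 2 it is the stage of the last action. *)
Definition act2_run (n : nat) (p : run) : run :=
  Run (rst p) n (word p) (live p) 1 n.
Definition act3_run (n : nat) (p : run) : run :=
  Run (rst p) n (word p) (live p) 2 (ret p).

Definition trunc (i : nat) (R : list run) (p : run) : list run := firstn i R ++ [p].

Definition sameb (k : nat) (A B : list nat) : bool :=
  forallb (fun m => eqb (memb m A) (memb m B)) (seq 0 k).

(** A return brings back the records of stage [t], but a record found since then is kept if the
    older set still gives that computation. Otherwise returns could remove a computation that is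
    correct in the limit again and again. *)
Definition carry (t s : state) : list (nat * nat) :=
  stI t ++ filter (fun p => negb (existsb (fun q => fst q =? fst p) (stI t)) &&
                            sameb (snd p) (stA t) (stA s)) (stI s).

(** Works on the tuple of the event, to stay among functions whose computability is available. The
    history is newest first, so the state of stage [b] stands at position [n - b]. *)
Definition apply_ev (n : nat) (e : event) (hist : list state) (s : state) (p : run) : state :=
  let tag := fst (ev_tuple e) in
  let a := fst (snd (ev_tuple e)) in
  let b := fst (snd (snd (ev_tuple e))) in
  let c := fst (snd (snd (snd (ev_tuple e)))) in
  let d := snd (snd (snd (snd (ev_tuple e)))) in
  if tag =? 0 then (stA s, (stI s, stR s ++ [new_run n]))
  else if tag =? 1 then (stA s, ((a, b) :: stI s, stR s))
  else if tag =? 2 then (stA s, ((a, b) :: stI s, trunc c (stR s) (letter_run a d p)))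
  else if tag =? 3 then
    (pos p :: stA s, (filter (fun q => snd q <=? pos p) (stI s), trunc a (stR s) (fwd_run n p)))
  else let t := nth (n - b) hist ([], ([], [])) in
    (stA t, (carry t s, trunc a (stR s) (if tag =? 4 then act2_run n p else act3_run n p))).

Definition ev_index (e : event) : nat :=
  if fst (ev_tuple e) =? 2 then fst (snd (snd (snd (ev_tuple e)))) else fst (snd (ev_tuple e)).

Definition next (n : nat) (hist : list state) : state :=
  let s := nth 0 hist ([], ([], [])) in
  let e := ev n s in
  apply_ev n e hist s (nth (ev_index e) (stR s) (new_run n)).

(* Newest state first. *)
Fixpoint history (n : nat) : list state :=
  match n with
  | 0 => [([], ([], []))]
  | S n => next n (history n) :: history n
  end.

Definition St (n : nat) : state := nth 0 (history n) ([], ([], [])).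
Definition stage_event (n : nat) : event := ev n (St n).

(** * Computability of the construction *)

Section CmpStage.
Variable X : set.
Context {T : Type} `{Enc T}.

Lemma cmp_rst (p : T -> run) : cmp X p -> cmp X (fun x => rst (p x)).
Proof. exact (fun Hp => cmp_fst X (fun x => run_tuple (p x)) Hp). Qed.
Lemma cmp_pos (p : T -> run) : cmp X p -> cmp X (fun x => pos (p x)).
Proof. exact (fun Hp => cmp_fst X _ (cmp_snd X (fun x => run_tuple (p x)) Hp)). Qed.
Lemma cmp_word (p : T -> run) : cmp X p -> cmp X (fun x => word (p x)).
Proof. exact (fun Hp => cmp_fst X _ (cmp_snd X _ (cmp_snd X (fun x => run_tuple (p x)) Hp))). Qed.
Lemma cmp_live (p : T -> run) : cmp X p -> cmp X (fun x => live (p x)).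
Proof.
  exact (fun Hp => cmp_fst X _ (cmp_snd X _ (cmp_snd X _ (cmp_snd X (fun x => run_tuple (p x)) Hp)))).
Qed.
Lemma cmp_mode (p : T -> run) : cmp X p -> cmp X (fun x => mode (p x)).
Proof.
  exact (fun Hp => cmp_fst X _ (cmp_snd X _ (cmp_snd X _ (cmp_snd X _
           (cmp_snd X (fun x => run_tuple (p x)) Hp))))).
Qed.
Lemma cmp_ret (p : T -> run) : cmp X p -> cmp X (fun x => ret (p x)).
Proof.
  exact (fun Hp => cmp_snd X _ (cmp_snd X _ (cmp_snd X _ (cmp_snd X _
           (cmp_snd X (fun x => run_tuple (p x)) Hp))))).
Qed.
Lemma cmp_Run (a b : T -> nat) c d (e f : T -> nat) :
  cmp X a -> cmp X b -> cmp X c -> cmp X d -> cmp X e -> cmp X f ->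
  cmp X (fun x => Run (a x) (b x) (c x) (d x) (e x) (f x)).
Proof.
  intros. assert (K : cmp X (fun x => (a x, (b x, (c x, (d x, (e x, f x))))))) by cmp_auto.
  exact K.
Qed.
Lemma cmp_ev_tuple (e : T -> event) : cmp X e -> cmp X (fun x => ev_tuple (e x)).
Proof. exact (fun He => He). Qed.
Lemma cmp_Enter (a b : T -> nat) : cmp X a -> cmp X b -> cmp X (fun x => Enter (a x) (b x)).
Proof. intros. assert (K : cmp X (fun x => ev_tuple (Enter (a x) (b x)))) by (cbn; cmp_auto). exact K. Qed.
Lemma cmp_Letter (a b c d : T -> nat) : cmp X a -> cmp X b -> cmp X c -> cmp X d ->
  cmp X (fun x => Letter (a x) (b x) (c x) (d x)).
Proof.
  intros. assert (K : cmp X (fun x => ev_tuple (Letter (a x) (b x) (c x) (d x)))) by (cbn; cmp_auto).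
  exact K.
Qed.
Lemma cmp_Fwd (a : T -> nat) : cmp X a -> cmp X (fun x => Fwd (a x)).
Proof. intros. assert (K : cmp X (fun x => ev_tuple (Fwd (a x)))) by (cbn; cmp_auto). exact K. Qed.
Lemma cmp_Act2 (a b : T -> nat) : cmp X a -> cmp X b -> cmp X (fun x => Act2 (a x) (b x)).
Proof. intros. assert (K : cmp X (fun x => ev_tuple (Act2 (a x) (b x)))) by (cbn; cmp_auto). exact K. Qed.
Lemma cmp_Act3 (a b : T -> nat) : cmp X a -> cmp X b -> cmp X (fun x => Act3 (a x) (b x)).
Proof. intros. assert (K : cmp X (fun x => ev_tuple (Act3 (a x) (b x)))) by (cbn; cmp_auto). exact K. Qed.
End CmpStage.

Ltac cmp_user ::= first
  [ eapply cmp_memb | eapply cmp_exec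
  | match goal with
    | |- cmp _ (fun x => rst (@?a x)) => eapply cmp_rst
    | |- cmp _ (fun x => pos (@?a x)) => eapply cmp_pos
    | |- cmp _ (fun x => word (@?a x)) => eapply cmp_word
    | |- cmp _ (fun x => live (@?a x)) => eapply cmp_live
    | |- cmp _ (fun x => mode (@?a x)) => eapply cmp_mode
    | |- cmp _ (fun x => ret (@?a x)) => eapply cmp_ret
    | |- cmp _ (fun x => Run _ _ _ _ _ _) => eapply cmp_Run
    | |- cmp _ (fun x => Run (@?a x) (@?b x) (@?c x) (@?d x) (@?e x) (@?f x)) => eapply cmp_Run
    | |- cmp _ (fun x => ev_tuple (@?a x)) => eapply cmp_ev_tuple
    | |- cmp _ (fun x => Enter (@?a x) (@?b x)) => eapply cmp_Enter
    | |- cmp _ (fun x => Letter (@?a x) (@?b x) (@?c x) (@?d x)) => eapply cmp_Letter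
    | |- cmp _ (fun x => Fwd (@?a x)) => eapply cmp_Fwd
    | |- cmp _ (fun x => Act2 (@?a x) (@?b x)) => eapply cmp_Act2
    | |- cmp _ (fun x => Act3 (@?a x) (@?b x)) => eapply cmp_Act3
    end ].

Section CmpEv.
Variable X : set.
Context {T : Type} `{Enc T}.

Lemma cmp_J1 (e s : T -> nat) : cmp X e -> cmp X s -> cmp X (fun x => J1 (e x) (s x)).
Proof. intros; unfold J1; cmp_auto. Qed.

Lemma cmp_isprefix (p l : T -> list nat) :
  cmp X p -> cmp X l -> cmp X (fun x => isprefix (p x) (l x)).
Proof. intros; unfold isprefix; cmp_auto. Qed.

Lemma cmp_hcomp (a k : T -> nat) A :
  cmp X a -> cmp X k -> cmp X A -> cmp X (fun x => hcomp (a x) (k x) (A x)).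
Proof. intros; unfold hcomp; cmp_auto. Qed.

Lemma cmp_eqon (o : T -> option nat) (b : T -> bool) :
  cmp X o -> cmp X b -> cmp X (fun x => eqon (o x) (b x)).
Proof. intros; unfold eqon; cmp_auto. Qed.
End CmpEv.

Section CmpEv2.
Variable X : set.
Context {T : Type} `{Enc T}.

Lemma cmp_J2 (eU eV s g w : T -> nat) : cmp X eU -> cmp X eV -> cmp X s -> cmp X g -> cmp X w ->
  cmp X (fun x => J2 (eU x) (eV x) (s x) (g x) (w x)).
Proof.
  intros. apply (cmp_comp X
    (fun q : nat * (nat * (nat * (nat * nat))) =>
       J2 (fst q) (fst (snd q)) (fst (snd (snd q))) (fst (snd (snd (snd q)))) (snd (snd (snd (snd q)))))
    (fun x => (eU x, (eV x, (s x, (g x, w x)))))); [ | cmp_auto ].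
  unfold J2; repeat first [ cmp_step | eapply cmp_J1 ].
Qed.

Lemma cmp_letters (a k i : T -> nat) R : cmp X a -> cmp X k -> cmp X R -> cmp X i ->
  cmp X (fun x => letters (a x) (k x) (R x) (i x)).
Proof.
  intros. apply (cmp_comp X
    (fun q : nat * (nat * (list run * nat)) =>
       letters (fst q) (fst (snd q)) (fst (snd (snd q))) (snd (snd (snd q))))
    (fun x => (a x, (k x, (R x, i x))))); [ | cmp_auto ].
  unfold letters; cmp_auto.
Qed.

Lemma cmp_ev_letter (a k i : T -> nat) p : cmp X a -> cmp X k -> cmp X i -> cmp X p ->
  cmp X (fun x => ev_letter (a x) (k x) (i x) (p x)).
Proof.
  intros. apply (cmp_comp X
    (fun q : nat * (nat * (nat * run)) =>
       ev_letter (fst q) (fst (snd q)) (fst (snd (snd q))) (snd (snd (snd q))))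
    (fun x => (a x, (k x, (i x, p x))))); [ | cmp_auto ].
  unfold ev_letter; repeat first [ cmp_step | eapply cmp_isprefix ].
Qed.
End CmpEv2.

Section CmpEv3.
Variable X : set.
Context {T : Type} `{Enc T}.

Lemma cmp_ev_enter1 (a k : T -> nat) R : cmp X a -> cmp X k -> cmp X R ->
  cmp X (fun x => ev_enter1 (a x) (k x) (R x)).
Proof.
  intros. apply (cmp_comp X
    (fun q : nat * (nat * list run) => ev_enter1 (fst q) (fst (snd q)) (snd (snd q)))
    (fun x => (a x, (k x, R x)))); [ | cmp_auto ].
  unfold ev_enter1; repeat first [ cmp_step | eapply cmp_letters | eapply cmp_ev_letter ].
Qed.

Lemma cmp_stA (s : T -> state) : cmp X s -> cmp X (fun x => stA (s x)).
Proof. intros; unfold stA; cmp_auto. Qed.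
Lemma cmp_stI (s : T -> state) : cmp X s -> cmp X (fun x => stI (s x)).
Proof. intros; unfold stI; cmp_auto. Qed.
Lemma cmp_stR (s : T -> state) : cmp X s -> cmp X (fun x => stR (s x)).
Proof. intros; unfold stR; cmp_auto. Qed.

Lemma cmp_agree1 (ePhi ePsi eU eV last n : T -> nat) A (sg g w : T -> nat) :
  cmp X ePhi -> cmp X ePsi -> cmp X eU -> cmp X eV -> cmp X last -> cmp X n -> cmp X A ->
  cmp X sg -> cmp X g -> cmp X w ->
  cmp X (fun x => agree1 (ePhi x) (ePsi x) (eU x) (eV x) (last x) (n x) (A x) (sg x) (g x) (w x)).
Proof.
  intros. apply (cmp_comp X
    (fun q : (nat * (nat * (nat * nat))) * ((nat * (nat * list nat)) * (nat * (nat * nat))) =>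
      agree1 (fst (fst q)) (fst (snd (fst q))) (fst (snd (snd (fst q)))) (snd (snd (snd (fst q))))
        (fst (fst (snd q))) (fst (snd (fst (snd q)))) (snd (snd (fst (snd q))))
        (fst (snd (snd q))) (fst (snd (snd (snd q)))) (snd (snd (snd (snd q)))))
    (fun x => ((ePhi x, (ePsi x, (eU x, eV x))), ((last x, (n x, A x)), (sg x, (g x, w x)))))); [ | cmp_auto ].
  unfold agree1; repeat first [ cmp_step | eapply cmp_eqon | eapply cmp_J2 | eapply cmp_J1 ].
Qed.
End CmpEv3.

Section CmpEv4.
Variable X : set.
Context {T : Type} `{Enc T}.

Lemma cmp_agreeb (i last n : T -> nat) A : cmp X i -> cmp X last -> cmp X n -> cmp X A ->
  cmp X (fun x => agreeb (i x) (last x) (n x) (A x)).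
Proof.
  intros. apply (cmp_comp X
    (fun q : nat * (nat * (nat * list nat)) =>
      agreeb (fst q) (fst (snd q)) (fst (snd (snd q))) (snd (snd (snd q))))
    (fun x => (i x, (last x, (n x, A x))))); [ | cmp_auto ].
  unfold agreeb; repeat first [ cmp_step | eapply cmp_agree1 ].
Qed.

Lemma cmp_ev_run1 (i : T -> nat) p : cmp X i -> cmp X p -> cmp X (fun x => ev_run1 (i x) (p x)).
Proof.
  intros. apply (cmp_comp X (fun q : nat * run => ev_run1 (fst q) (snd q)) (fun x => (i x, p x)));
    [ | cmp_auto ].
  unfold ev_run1; cmp_auto.
Qed.

Lemma cmp_ev_enter (n a : T -> nat) s : cmp X n -> cmp X a -> cmp X s ->
  cmp X (fun x => ev_enter (n x) (a x) (s x)).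
Proof.
  intros. apply (cmp_comp X
    (fun q : nat * (nat * state) => ev_enter (fst q) (fst (snd q)) (snd (snd q)))
    (fun x => (n x, (a x, s x)))); [ | cmp_auto ].
  unfold ev_enter;
    repeat first [ cmp_step | eapply cmp_hcomp | eapply cmp_ev_enter1 | eapply cmp_stA
                 | eapply cmp_stI | eapply cmp_stR ].
Qed.
End CmpEv4.

Section CmpEv5.
Variable X : set.
Context {T : Type} `{Enc T}.

Lemma cmp_ev (n : T -> nat) s : cmp X n -> cmp X s -> cmp X (fun x => ev (n x) (s x)).
Proof.
  intros. apply (cmp_comp X (fun q : nat * state => ev (fst q) (snd q)) (fun x => (n x, s x)));
    [ | cmp_auto ].
  unfold ev, ev_run;
    repeat first [ cmp_step | eapply cmp_ev_enter | eapply cmp_ev_run1 | eapply cmp_agreeb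
                 | eapply cmp_stA | eapply cmp_stR ].
Qed.

Lemma cmp_apply_ev (n : T -> nat) e h s p : cmp X n -> cmp X e -> cmp X h -> cmp X s -> cmp X p ->
  cmp X (fun x => apply_ev (n x) (e x) (h x) (s x) (p x)).
Proof.
  intros. apply (cmp_comp X
    (fun q : nat * (event * (list state * (state * run))) => apply_ev (fst q) (fst (snd q))
        (fst (snd (snd q))) (fst (snd (snd (snd q)))) (snd (snd (snd (snd q)))))
    (fun x => (n x, (e x, (h x, (s x, p x)))))); [ | cmp_auto ].
  unfold apply_ev, carry, sameb, trunc, new_run, letter_run, fwd_run, act2_run, act3_run, stA, stI, stR.
  cmp_auto.
Qed.

End CmpEv5.

Section CmpEv6.
Variable X : set.
Context {T : Type} `{Enc T}.

Lemma cmp_next (n : T -> nat) h : cmp X n -> cmp X h -> cmp X (fun x => next (n x) (h x)).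
Proof.
  intros. apply (cmp_comp X (fun q : nat * list state => next (fst q) (snd q)) (fun x => (n x, h x)));
    [ | cmp_auto ].
  unfold next, ev_index, stR, new_run.
  repeat first [ eapply cmp_apply_ev | eapply cmp_ev | cmp_step ].
Qed.
End CmpEv6.

Lemma cmp_history X {T} `{Enc T} (n : T -> nat) : cmp X n -> cmp X (fun x => history (n x)).
Proof.
  intros Hn. apply (cmp_comp X history n); trivial.
  apply cmp_ext with
    (f := fun n => nat_rect (fun _ => list state) [([], ([], []))] (fun i z => next i z :: z) n).
  - intros a; induction a as [ | a IH]; cbn; trivial; now rewrite IH.
  - apply (cmp_natrec X (fun _ : nat => [([], ([], []))]) (fun _ i z => next i z :: z) (fun n => n)).
    + apply cmp_const.
    + repeat first [ cmp_step | eapply cmp_next ].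
    + cmp_auto.
Qed.

Lemma cmp_St X {T} `{Enc T} (n : T -> nat) : cmp X n -> cmp X (fun x => St (n x)).
Proof. intros; unfold St; repeat first [ cmp_step | eapply cmp_history ]. Qed.

Lemma cmp_stage_event X {T} `{Enc T} (n : T -> nat) :
  cmp X n -> cmp X (fun x => stage_event (n x)).
Proof. intros; unfold stage_event; repeat first [ cmp_step | eapply cmp_ev | eapply cmp_St ]. Qed.

(** * Specification of a single stage *)

Definition An (n : nat) : list nat := stA (St n).
Definition Cn (n : nat) : list (nat * nat) := stI (St n).
Definition Rn (n : nat) : list run := stR (St n).
Definition rn (n i : nat) : option run := nth_error (Rn n) i.
Definition ind (n kap : nat) : Prop := exists k, In (kap, k) (Cn n).
Definition agrees_at (n i : nat) (p : run) : Prop := agreeb i (pos p) n (An n) = true.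

Definition new_comp (n kap k : nat) : Prop :=
  ~ ind n kap /\ k <= n /\ hcomp kap k (An n) = true /\
  forall k', k' < k -> hcomp kap k' (An n) = false.

Definition prefix (p l : list nat) : Prop := exists s, l = p ++ s.

Lemma isprefix_iff p l : isprefix p l = true <-> prefix p l.
Proof.
  unfold isprefix, prefix. rewrite Nat.eqb_eq. split.
  - intros E. apply enc_list_inj in E. exists (skipn (length p) l).
    rewrite E at 1. symmetry; apply firstn_skipn.
  - intros [s ->]. now rewrite firstn_app, firstn_all, Nat.sub_diag, app_nil_r.
Qed.

(** Conditions and effects of each event, freed from the searches that select it. The double
    subtraction [n - (n - t)] comes from the lookup in the history and becomes [t] as soon as
    [t <= n] is known. *)
Definition stage_ok (n : nat) (e : event) : Prop :=
  match e with
  | Push => An (S n) = An n /\ Cn (S n) = Cn n /\ Rn (S n) = Rn n ++ [new_run n]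
  | Enter kap k =>
      An (S n) = An n /\ Cn (S n) = (kap, k) :: Cn n /\ Rn (S n) = Rn n /\
      new_comp n kap k /\
      forall j p, rn n j = Some p -> mode p = 0 -> kap <= rst p -> k <= pos p
  | Letter kap k i c => exists p,
      rn n i = Some p /\ mode p = 0 /\ kap <= rst p /\ pos p < k /\ new_comp n kap k /\
      (forall j p', j < i -> rn n j = Some p' -> mode p' = 0 -> kap <= rst p' -> k <= pos p') /\
      An (S n) = An n /\ Cn (S n) = (kap, k) :: Cn n /\
      Rn (S n) = trunc i (Rn n) (letter_run kap c p) /\
      match c with
      | 0 => forall q, In q (live p) -> ~ prefix (word p ++ [kap]) (fst q)
      | S t => exists w l1 l2, live p = l1 ++ (w, t) :: l2 /\ prefix (word p ++ [kap]) w /\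
          forall q, In q l1 -> ~ prefix (word p ++ [kap]) (fst q)
      end
  | Fwd i => exists p,
      rn n i = Some p /\ mode p = 0 /\ agrees_at n i p /\
      (forall q, In q (live p) -> fst q <> word p) /\
      An (S n) = pos p :: An n /\
      Cn (S n) = filter (fun q => snd q <=? pos p) (Cn n) /\
      Rn (S n) = trunc i (Rn n) (fwd_run n p)
  | Act2 i t => exists p,
      rn n i = Some p /\ mode p = 0 /\ agrees_at n i p /\ In (word p, t) (live p) /\
      let t' := n - (n - t) in
      An (S n) = An t' /\ Cn (S n) = carry (St t') (St n) /\
      Rn (S n) = trunc i (Rn n) (act2_run n p)
  | Act3 i b => exists p,
      rn n i = Some p /\ mode p = 1 /\ agrees_at n i p /\ b = ret p /\
      let b' := n - (n - b) in
      An (S n) = An b' /\ Cn (S n) = carry (St b') (St n) /\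
      Rn (S n) = trunc i (Rn n) (act3_run n p)
  end.

Lemma nth_history n m : m <= n -> nth m (history n) ([], ([], [])) = St (n - m).
Proof.
  unfold St. revert m; induction n as [ | n IH]; intros m Hm.
  - now replace m with 0 by lia.
  - destruct m as [ | m]; [ now rewrite Nat.sub_0_r | ].
    cbn [history nth]. rewrite IH by lia. now replace (S n - S m) with (n - m) by lia.
Qed.

Lemma St_succ n : St (S n) =
  apply_ev n (stage_event n) (history n) (St n)
    (nth (ev_index (stage_event n)) (Rn n) (new_run n)).
Proof. reflexivity. Qed.

Lemma find_split {T} (f : T -> bool) l x : find f l = Some x ->
  exists l1 l2, l = l1 ++ x :: l2 /\ f x = true /\ forall y, In y l1 -> f y = false.
Proof.
  induction l as [ | a l IH]; cbn; [ discriminate | ]. destruct (f a) eqn:E.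
  - intros [= <-]. exists nil, l; repeat split; trivial. easy.
  - intros K. destruct (IH K) as (l1 & l2 & -> & H1 & H2). exists (a :: l1), l2.
    repeat split; trivial. intros y [<- | Hy]; auto.
Qed.

Lemma find_seq f n i : find f (seq 0 n) = Some i ->
  i < n /\ f i = true /\ forall j, j < i -> f j = false.
Proof.
  intros K. destruct (find_split _ _ _ K) as (l1 & l2 & E & H1 & H2).
  assert (L : l1 = seq 0 i /\ i < n).
  { pose proof (f_equal (fun l => nth (length l1) l 0) E) as N. cbv beta in N.
    rewrite nth_middle in N.
    assert (Le : length l1 < n).
    { apply (f_equal (@length nat)) in E. rewrite length_seq, length_app in E. cbn in E. lia. }
    rewrite seq_nth in N by trivial. cbn in N. subst i. split; trivial.
    apply (f_equal (firstn (length l1))) in E.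
    rewrite firstn_app, firstn_all, Nat.sub_diag, app_nil_r in E. rewrite <- E at 1.
    replace n with (length l1 + (n - length l1)) by lia.
    rewrite seq_app, firstn_app, length_seq, Nat.sub_diag, app_nil_r.
    rewrite firstn_all2; trivial. now rewrite length_seq. }
  destruct L as [-> L]. repeat split; trivial. intros j Hj. apply H2, in_seq. lia.
Qed.

Lemma ind_false n kap :
  existsb (fun p => fst p =? kap) (stI (St n)) = false -> ~ ind n kap.
Proof.
  intros E [k Hk]. rewrite <- not_true_iff_false in E. apply E.
  apply existsb_exists. exists (kap, k); split; trivial. apply Nat.eqb_refl.
Qed.

Lemma letters_iff kap k n i : letters kap k (Rn n) i = true <->
  exists p, rn n i = Some p /\ mode p = 0 /\ kap <= rst p /\ pos p < k.
Proof.
  unfold letters, rn. destruct (nth_error (Rn n) i) as [p | ].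
  - rewrite !andb_true_iff, Nat.eqb_eq, Nat.leb_le, Nat.ltb_lt. split.
    + intros. exists p; tauto.
    + intros (q & [= <-] & K). tauto.
  - split; [ discriminate | intros (q & K & _); discriminate ].
Qed.

Lemma stage_ok_holds n : stage_ok n (stage_event n).
Proof.
  assert (EA : forall m, An m = stA (St m)) by reflexivity.
  assert (EC : forall m, Cn m = stI (St m)) by reflexivity.
  assert (ER : forall m, Rn m = stR (St m)) by reflexivity.
  pose proof (St_succ n) as HS.
  assert (EV : stage_event n = ev n (St n)) by reflexivity.
  unfold ev in EV. destruct (pi1 (pi1 n) =? 0).
  - unfold ev_enter in EV.
    destruct (existsb _ _) eqn:X1.
    { rewrite EV in *. cbn. rewrite EA, EC, ER, HS. repeat split. }
    apply ind_false in X1.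
    destruct (find _ _) as [k | ] eqn:X2;
      [ | rewrite EV in *; cbn; rewrite EA, EC, ER, HS; repeat split ].
    apply find_seq in X2. destruct X2 as (L2 & H2 & M2).
    assert (NC : new_comp n (pi2 (pi1 n)) k) by (repeat split; trivial; lia).
    set (kap := pi2 (pi1 n)) in *. clearbody kap.
    unfold ev_enter1 in EV.
    destruct (find _ (seq 0 (length _))) as [i | ] eqn:X3.
    + apply find_seq in X3. destruct X3 as (L3 & H3 & M3).
      change (stR (St n)) with (Rn n) in *.
      apply letters_iff in H3. destruct H3 as (p & Ep & Hm & Hr & Hp).
      assert (LL : forall j p', j < i -> rn n j = Some p' -> mode p' = 0 -> kap <= rst p' -> k <= pos p').
      { intros j p' Hj Ej Mj Kj. specialize (M3 j Hj). rewrite <- not_true_iff_false in M3.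
        apply Nat.nlt_ge; intros Q. apply M3, letters_iff. eauto. }
      unfold rn in Ep. rewrite Ep in EV. unfold ev_letter in EV.
      destruct (find _ (live p)) as [q | ] eqn:X4.
      * destruct (find_split _ _ _ X4) as (l1 & l2 & E1 & P1 & P2).
        rewrite EV in *. cbn -[prefix new_comp]. exists p.
        rewrite EA, EC, ER, HS; unfold apply_ev, ev_index. cbn [ev_tuple fst snd Nat.eqb stA stI stR].
        erewrite nth_error_nth by exact Ep.
        repeat (split; [ now trivial | ]).
        exists (fst q), l1, l2. split; [ now destruct q | ]. split; [ now apply isprefix_iff | ].
        intros q' Hq'. rewrite <- isprefix_iff. now rewrite P2.
      * rewrite EV in *. cbn -[prefix new_comp]. exists p.
        rewrite EA, EC, ER, HS; unfold apply_ev, ev_index. cbn [ev_tuple fst snd Nat.eqb stA stI stR].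
        erewrite nth_error_nth by exact Ep.
        repeat (split; [ now trivial | ]).
        intros q' Hq'. rewrite <- isprefix_iff. now rewrite (find_none _ _ X4 q' Hq').
    + rewrite EV in *. cbn -[new_comp]. rewrite EA, EC, ER, HS. repeat (split; [ now trivial | ]).
      intros j p Ej Mj Kj. apply Nat.nlt_ge; intros Q.
      assert (Lj : j < length (Rn n)) by (apply nth_error_Some; unfold rn in Ej; congruence).
      pose proof (find_none _ _ X3 j) as N. rewrite <- not_true_iff_false in N.
      apply N; [ apply in_seq; unfold Rn in Lj; lia | ]. apply letters_iff. eauto.
  - set (i := pi2 (pi1 n)) in *. clearbody i.
    assert (PP : stage_event n = Push -> stage_ok n (stage_event n)).
    { intros EP. rewrite EP in *. cbn. rewrite EA, EC, ER, HS. repeat split. }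
    unfold ev_run in EV.
    destruct (nth_error (stR (St n)) i) as [p | ] eqn:Ep; [ | auto ].
    destruct (agreeb _ _ _ _) eqn:Ag; [ | auto ].
    unfold ev_run1 in EV. destruct (Nat.eqb_spec (mode p) 0) as [M | M].
    + destruct (find _ _) as [q | ] eqn:X4.
      * destruct (find_split _ _ _ X4) as (l1 & l2 & E1 & P1 & P2).
        rewrite EV in *. cbn [stage_ok]. exists p.
        rewrite !EA, EC, ER, HS; unfold apply_ev, ev_index. cbn [ev_tuple fst snd Nat.eqb stA stI stR].
        rewrite nth_history by lia.
        erewrite nth_error_nth by exact Ep.
        repeat (split; [ now trivial | ]). split; [ | repeat split ].
        apply Nat.eqb_eq in P1. apply enc_list_inj in P1. rewrite <- P1, E1. destruct q.
        apply in_elt.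
      * rewrite EV in *. cbn [stage_ok]. exists p.
        rewrite !EA, EC, ER, HS; unfold apply_ev, ev_index. cbn [ev_tuple fst snd Nat.eqb stA stI stR].
        erewrite nth_error_nth by exact Ep.
        repeat (split; [ now trivial | ]). split; [ | repeat split ].
        intros q Hq Eq. pose proof (find_none _ _ X4 q Hq) as N. cbv beta in N.
        rewrite Eq, Nat.eqb_refl in N. discriminate.
    + destruct (Nat.eqb_spec (mode p) 1) as [M1 | ]; [ | auto ].
      rewrite EV in *. cbn [stage_ok]. exists p.
      rewrite !EA, EC, ER, HS; unfold apply_ev, ev_index. cbn [ev_tuple fst snd Nat.eqb stA stI stR].
      rewrite nth_history by lia.
      erewrite nth_error_nth by exact Ep.
      repeat (split; [ now trivial | ]). repeat split.
Qed.

(** * Strategies from one stage to the next *)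

Lemma rn_trunc n i p p' j : rn n i = Some p -> Rn (S n) = trunc i (Rn n) p' ->
  rn (S n) j = if j <? i then rn n j else if j =? i then Some p' else None.
Proof.
  unfold rn; intros Hi ->. unfold trunc.
  assert (L : i < length (Rn n)) by (apply nth_error_Some; congruence).
  assert (LF : length (firstn i (Rn n)) = i) by (rewrite length_firstn; lia).
  destruct (Nat.ltb_spec j i).
  - rewrite nth_error_app1 by lia. rewrite nth_error_firstn.
    destruct (Nat.ltb_spec j i); trivial; lia.
  - rewrite nth_error_app2, LF by lia. destruct (Nat.eqb_spec j i) as [-> | ].
    + now rewrite Nat.sub_diag.
    + apply nth_error_None. cbn. lia.
Qed.

Lemma rn_lt n i j p : i < j -> rn n j = Some p -> exists q, rn n i = Some q.
Proof.
  intros L E. destruct (rn n i) eqn:K; eauto. unfold rn in *.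
  apply nth_error_None in K. assert (nth_error (Rn n) j <> None) by congruence.
  apply nth_error_Some in H. lia.
Qed.

Definition keeps (n j : nat) : Prop :=
  match stage_event n with
  | Push | Enter _ _ => True
  | Letter _ _ i _ | Fwd i | Act2 i _ | Act3 i _ => j < i
  end.

Lemma keeps_lt n i j : j <= i -> keeps n i -> keeps n j.
Proof. unfold keeps; destruct (stage_event n); trivial; lia. Qed.

Lemma run_keep n j p : keeps n j -> rn n j = Some p -> rn (S n) j = Some p.
Proof.
  pose proof (stage_ok_holds n) as H. unfold keeps.
  destruct (stage_event n); cbn in H; intros K E.
  - destruct H as (_ & _ & H). unfold rn. rewrite H.
    rewrite nth_error_app1; trivial. apply nth_error_Some. unfold rn in E; congruence.
  - destruct H as (_ & _ & H & _). unfold rn. now rewrite H.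
  - destruct H as (q & Hi & H). destruct H as (_ & _ & _ & _ & _ & _ & _ & H & _).
    rewrite (rn_trunc _ _ _ _ _ Hi H). apply Nat.ltb_lt in K. now rewrite K.
  - destruct H as (q & Hi & _ & _ & _ & _ & _ & H).
    rewrite (rn_trunc _ _ _ _ _ Hi H). apply Nat.ltb_lt in K. now rewrite K.
  - destruct H as (q & Hi & _ & _ & _ & _ & _ & H).
    rewrite (rn_trunc _ _ _ _ _ Hi H). apply Nat.ltb_lt in K. now rewrite K.
  - destruct H as (q & Hi & _ & _ & _ & _ & _ & H).
    rewrite (rn_trunc _ _ _ _ _ Hi H). apply Nat.ltb_lt in K. now rewrite K.
Qed.

Inductive own (n j : nat) (p p' : run) : Prop :=
| own_letter kap k c : stage_event n = Letter kap k j c -> p' = letter_run kap c p -> own n j p p'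
| own_fwd : stage_event n = Fwd j -> p' = fwd_run n p -> own n j p p'
| own_act2 t : stage_event n = Act2 j t -> p' = act2_run n p -> own n j p p'
| own_act3 b : stage_event n = Act3 j b -> p' = act3_run n p -> own n j p p'.

Lemma run_step n j p' : rn (S n) j = Some p' ->
  (rn n j = Some p' /\ keeps n j) \/
  (stage_event n = Push /\ p' = new_run n /\ forall i, i < j <-> exists p, rn n i = Some p) \/
  exists p, rn n j = Some p /\ own n j p p'.
Proof.
  pose proof (stage_ok_holds n) as H. unfold keeps. intros E.
  destruct (stage_event n) eqn:EV; cbn in H.
  - destruct H as (_ & _ & H). unfold rn in *. rewrite H in E.
    destruct (nth_error (Rn n) j) as [q | ] eqn:Q.
    + rewrite nth_error_app1 in E by (apply nth_error_Some; congruence). left; split; trivial. congruence.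
    + right; left. apply nth_error_None in Q. rewrite nth_error_app2 in E by trivial.
      destruct (j - length (Rn n)) as [ | d] eqn:D; cbn in E; [ | destruct d; discriminate ].
      injection E as <-. repeat split; trivial.
      * intros L. destruct (nth_error (Rn n) i) eqn:N; eauto. apply nth_error_None in N. lia.
      * intros [p N]. assert (N' : nth_error (Rn n) i <> None) by congruence.
        apply nth_error_Some in N'. lia.
  - destruct H as (_ & _ & H & _). unfold rn in *. rewrite H in E. auto.
  - destruct H as (q & Hi & H). destruct H as (_ & _ & _ & _ & _ & _ & _ & H & _).
    rewrite (rn_trunc _ _ _ _ _ Hi H) in E. destruct (Nat.ltb_spec j i); [ auto | ].
    destruct (Nat.eqb_spec j i) as [-> | ]; [ | discriminate ]. injection E as <-.
    right; right. exists q; split; trivial. now apply own_letter with kap k c.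
  - destruct H as (q & Hi & _ & _ & _ & _ & _ & H).
    rewrite (rn_trunc _ _ _ _ _ Hi H) in E. destruct (Nat.ltb_spec j i); [ auto | ].
    destruct (Nat.eqb_spec j i) as [-> | ]; [ | discriminate ]. injection E as <-.
    right; right. exists q; split; trivial. now apply own_fwd.
  - destruct H as (q & Hi & _ & _ & _ & _ & _ & H).
    rewrite (rn_trunc _ _ _ _ _ Hi H) in E. destruct (Nat.ltb_spec j i); [ auto | ].
    destruct (Nat.eqb_spec j i) as [-> | ]; [ | discriminate ]. injection E as <-.
    right; right. exists q; split; trivial. now apply own_act2 with t.
  - destruct H as (q & Hi & _ & _ & _ & _ & _ & H).
    rewrite (rn_trunc _ _ _ _ _ Hi H) in E. destruct (Nat.ltb_spec j i); [ auto | ].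
    destruct (Nat.eqb_spec j i) as [-> | ]; [ | discriminate ]. injection E as <-.
    right; right. exists q; split; trivial. now apply own_act3 with b.
Qed.

Lemma run_gone n i j : stage_event n <> Push ->
  match stage_event n with
  | Push | Enter _ _ => False
  | Letter _ _ i' _ | Fwd i' | Act2 i' _ | Act3 i' _ => i' = i
  end -> i < j -> rn (S n) j = None.
Proof.
  pose proof (stage_ok_holds n) as H. destruct (stage_event n) eqn:EV; cbn in H; intros _ M L; try easy.
  - destruct H as (q & Hi & H). destruct H as (_ & _ & _ & _ & _ & _ & _ & H & _). subst i0.
    rewrite (rn_trunc _ _ _ _ _ Hi H).
    destruct (Nat.ltb_spec j i); [ lia | ]. destruct (Nat.eqb_spec j i); trivial; lia.
  - destruct H as (q & Hi & _ & _ & _ & _ & _ & H). subst i0. rewrite (rn_trunc _ _ _ _ _ Hi H).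
    destruct (Nat.ltb_spec j i); [ lia | ]. destruct (Nat.eqb_spec j i); trivial; lia.
  - destruct H as (q & Hi & _ & _ & _ & _ & _ & H). subst i0. rewrite (rn_trunc _ _ _ _ _ Hi H).
    destruct (Nat.ltb_spec j i); [ lia | ]. destruct (Nat.eqb_spec j i); trivial; lia.
  - destruct H as (q & Hi & _ & _ & _ & _ & _ & H). subst i0. rewrite (rn_trunc _ _ _ _ _ Hi H).
    destruct (Nat.ltb_spec j i); [ lia | ]. destruct (Nat.eqb_spec j i); trivial; lia.
Qed.

Record run_ok (n : nat) (p : run) : Prop := {
  ok_rst : rst p <= pos p;
  ok_pos : pos p < n;
  ok_mode : mode p <= 2;
  ok_ret : mode p = 1 -> ret p = pos p;
  ok_live : forall w t, In (w, t) (live p) -> rst p <= t <= pos p;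
  ok_sorted : StronglySorted (fun a b => snd b < snd a) (live p) }.

Lemma sorted_filter {T} (R : T -> T -> Prop) f l : StronglySorted R l -> StronglySorted R (filter f l).
Proof.
  induction 1 as [ | a l Hl IH HF]; cbn; [ constructor | ]. destruct (f a); trivial.
  constructor; trivial. rewrite Forall_forall in *. intros x Hx. apply filter_In in Hx. now apply HF.
Qed.

Lemma stage_mode0 n i p : rn n i = Some p -> (exists kap k c, stage_event n = Letter kap k i c) \/
  stage_event n = Fwd i \/ (exists t, stage_event n = Act2 i t) -> mode p = 0.
Proof.
  pose proof (stage_ok_holds n) as H. intros E [(kap & k & c & K) | [K | [t K]]]; rewrite K in H;
  destruct H as (q & Hi & H & _); congruence.
Qed.

(** The separation [pos p < rst q] keeps lower strategies away from the numbers of higher ones. It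
    survives an action of the higher strategy because that action cancels all lower ones, which
    restart at later stages. *)
Lemma runs_ok n : (forall i p, rn n i = Some p -> run_ok n p) /\
  (forall i j p q, i < j -> rn n i = Some p -> rn n j = Some q -> pos p < rst q).
Proof.
  induction n as [ | n [IH1 IH2]].
  - split; [ intros i p E | intros i j p q _ E ]; destruct i; discriminate.
  - split.
    + intros i p' E. apply run_step in E. destruct E as [[E _] | [(_ & -> & _) | (p & E & O)]].
      * destruct (IH1 _ _ E); constructor; auto with arith.
      * constructor; cbn; try lia; try easy. constructor.
      * destruct (IH1 _ _ E) as [a b c d e f].
        destruct O as [kap k o O -> | O -> | t O -> | t O ->]; constructor; cbn; auto; try lia.
        -- intros w t Hw. destruct (o =? 0); [ eauto | ]. apply filter_In in Hw. now apply (e w).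
        -- destruct (o =? 0); trivial. now apply sorted_filter.
        -- assert (mode p = 0) by (eapply stage_mode0; eauto). lia.
        -- intros w t [[= <- <-] | Hw]; [ lia | ]. apply e in Hw. lia.
        -- constructor; trivial. apply Forall_forall. intros [w t] Hw. apply e in Hw. cbn. lia.
        -- intros w t' Hw. apply e in Hw. lia.
        -- intros w t' Hw. apply e in Hw. lia.
    + intros i j p q L Ei Ej.
      apply run_step in Ej. destruct Ej as [[Ej Kj] | [(EV & -> & Ej) | (q0 & Ej & O)]].
      * destruct (rn_lt n i j q) as [p0 Ep0]; trivial.
        assert (K : keeps n i) by (apply keeps_lt with j; trivial; lia).
        rewrite (run_keep _ _ _ K Ep0) in Ei. injection Ei as <-. eauto.
      * destruct (proj1 (Ej i) L) as [p0 Ep0].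
        assert (K : keeps n i) by (unfold keeps; now rewrite EV).
        rewrite (run_keep _ _ _ K Ep0) in Ei. injection Ei as <-.
        cbn. now apply (ok_pos _ _ (IH1 _ _ Ep0)).
      * destruct (rn_lt n i j q0) as [p0 Ep0]; trivial.
        assert (K : keeps n i).
        { unfold keeps. destruct O as [kap k o O _ | O _ | t O _ | t O _]; now rewrite O. }
        rewrite (run_keep _ _ _ K Ep0) in Ei. injection Ei as <-.
        assert (R : rst q = rst q0).
        { now destruct O as [kap k o O -> | O -> | t O -> | t O ->]. }
        rewrite R. eauto.
Qed.

Lemma rn_ok n i p : rn n i = Some p -> run_ok n p.
Proof. apply runs_ok. Qed.

Lemma pos_lt_rst n i j p q : i < j -> rn n i = Some p -> rn n j = Some q -> pos p < rst q.
Proof. apply runs_ok. Qed.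

(** * Invariants of the set and of the recorded computations *)

Definition same_below (k : nat) (A B : list nat) : Prop := forall m, m < k -> In m A <-> In m B.

Lemma sameb_iff k A B : sameb k A B = true <-> same_below k A B.
Proof.
  unfold sameb, same_below. rewrite forallb_forall. split; intros K m Hm.
  - specialize (K m). rewrite in_seq in K. rewrite <- !memb_iff.
    apply eqb_prop in K; [ now rewrite K | lia ].
  - apply in_seq in Hm. apply eqb_true_iff, eq_true_iff_eq. rewrite !memb_iff. apply K; lia.
Qed.

Lemma carry_iff t n kap k : In (kap, k) (carry (St t) (St n)) <->
  In (kap, k) (Cn t) \/ (In (kap, k) (Cn n) /\ ~ ind t kap /\ same_below k (An t) (An n)).
Proof.
  unfold carry. rewrite in_app_iff, filter_In, andb_true_iff, negb_true_iff, sameb_iff.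
  cbn [fst snd]. change (stI (St t)) with (Cn t). change (stI (St n)) with (Cn n).
  assert (K : existsb (fun q => fst q =? kap) (Cn t) = false <-> ~ ind t kap).
  { rewrite <- not_true_iff_false, existsb_exists. apply not_iff_compat. split.
    - intros ([a b] & Hab & E). apply Nat.eqb_eq in E. cbn in E. subst. now exists b.
    - intros [b Hb]. exists (kap, b); split; trivial. apply Nat.eqb_refl. }
  rewrite K. tauto.
Qed.

(** The stage whose set is continued at [S n]. Iterating it gives the tree of approximations in
    which the final path has to be found. *)
Definition parent (n : nat) : nat :=
  match stage_event n with Act2 _ t => t | Act3 _ b => b | _ => n end.

Lemma act2_spec n i t : stage_event n = Act2 i t -> exists p,
  rn n i = Some p /\ mode p = 0 /\ agrees_at n i p /\ In (word p, t) (live p) /\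
  rst p <= t /\ t <= pos p /\ t < n /\ An (S n) = An t /\ Cn (S n) = carry (St t) (St n).
Proof.
  intros E. pose proof (stage_ok_holds n) as H. rewrite E in H. cbn in H.
  destruct H as (p & H1 & H2 & H3 & H4 & H5 & H6 & H7). exists p.
  pose proof (rn_ok _ _ _ H1) as [a b c d e f]. specialize (e _ _ H4).
  replace (n - (n - t)) with t in * by lia. repeat split; trivial; lia.
Qed.

Lemma act3_spec n i b : stage_event n = Act3 i b -> exists p,
  rn n i = Some p /\ mode p = 1 /\ agrees_at n i p /\ b = ret p /\ b = pos p /\
  b < n /\ An (S n) = An b /\ Cn (S n) = carry (St b) (St n).
Proof.
  intros E. pose proof (stage_ok_holds n) as H. rewrite E in H. cbn in H.
  destruct H as (p & H1 & H2 & H3 & H4 & H5 & H6 & H7). exists p.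
  pose proof (rn_ok _ _ _ H1) as [a b' c d e f]. specialize (d H2).
  replace (n - (n - b)) with b in * by lia. repeat split; trivial; lia.
Qed.

Lemma fwd_spec n i : stage_event n = Fwd i -> exists p,
  rn n i = Some p /\ mode p = 0 /\ agrees_at n i p /\
  (forall q, In q (live p) -> fst q <> word p) /\
  An (S n) = pos p :: An n /\ Cn (S n) = filter (fun q => snd q <=? pos p) (Cn n).
Proof.
  intros E. pose proof (stage_ok_holds n) as H. rewrite E in H. cbn in H.
  destruct H as (p & H1 & H2 & H3 & H4 & H5 & H6 & H7). exists p. tauto.
Qed.

Lemma parent_le n : parent n <= n.
Proof.
  unfold parent. destruct (stage_event n) eqn:E; trivial.
  - apply act2_spec in E. destruct E as (p & E). lia.
  - apply act3_spec in E. destruct E as (p & E). lia.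
Qed.

Inductive growth (n : nat) : Prop :=
| grow_same : parent n = n -> An (S n) = An n -> Cn (S n) = Cn n ->
    stage_event n = Push -> growth n
| grow_enter kap k : parent n = n -> An (S n) = An n -> Cn (S n) = (kap, k) :: Cn n ->
    new_comp n kap k -> (stage_event n = Enter kap k \/ exists i c, stage_event n = Letter kap k i c) ->
    growth n
| grow_fwd i p : parent n = n -> stage_event n = Fwd i -> rn n i = Some p -> mode p = 0 ->
    An (S n) = pos p :: An n -> Cn (S n) = filter (fun q => snd q <=? pos p) (Cn n) -> growth n
| grow_act t : parent n = t -> t < n -> An (S n) = An t -> Cn (S n) = carry (St t) (St n) ->
    growth n.

Lemma stage_growth n : growth n.
Proof.
  pose proof (stage_ok_holds n) as H. destruct (stage_event n) eqn:E; cbn in H.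
  - apply grow_same; try easy. unfold parent; now rewrite E.
  - destruct H as (H1 & H2 & H3 & H4 & _). apply grow_enter with kap k; auto.
    unfold parent; now rewrite E.
  - destruct H as (p & _ & _ & _ & _ & H1 & _ & H2 & H3 & _). apply grow_enter with kap k; eauto.
    unfold parent; now rewrite E.
  - apply fwd_spec in E as E'. destruct E' as (p & H1 & H2 & _ & _ & H3 & H4).
    apply grow_fwd with i p; trivial. unfold parent; now rewrite E.
  - apply act2_spec in E as E'. destruct E' as (p & H1 & H2 & _ & _ & _ & _ & H3 & H4 & H5).
    apply grow_act with t; trivial. unfold parent; now rewrite E.
  - apply act3_spec in E as E'. destruct E' as (p & H1 & H2 & _ & _ & _ & H3 & H4 & H5).
    apply grow_act with b; trivial. unfold parent; now rewrite E.
Qed.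

Lemma hcomp_same kap k A B : same_below k A B -> hcomp kap k A = true -> hcomp kap k B = true.
Proof.
  unfold hcomp. intros HS. destruct (exec k A _ _) as [y | ] eqn:E; [ | discriminate ]. intros _.
  now rewrite (exec_mono k A k B _ _ y (le_n k) HS E).
Qed.

Record state_ok (n : nat) : Prop := {
  so_A : forall y, In y (An n) -> y < n;
  so_C : forall kap k, In (kap, k) (Cn n) -> k < n;
  so_uniq : forall kap k k', In (kap, k) (Cn n) -> In (kap, k') (Cn n) -> k = k';
  so_sound : forall kap k, In (kap, k) (Cn n) -> hcomp kap k (An n) = true;
  so_fresh : forall j p, rn n j = Some p -> mode p = 0 -> forall m, m <= n -> ~ In (pos p) (An m) }.

(** Strong induction, because a return copies the set of an arbitrary earlier stage. For the same
    reason [so_fresh] refers to all stages up to [n] and not only to the current set. *)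
Lemma state_ok_holds n : state_ok n.
Proof.
  induction n as [n IH] using lt_wf_ind. destruct n as [ | n].
  - constructor; try easy. intros [ | j] p; discriminate.
  - assert (IHn := IH n (le_n _)). assert (NA : forall m, m <= n -> ~ In n (An m)).
    { intros m Hm K. apply (so_A _ (IH m (le_n_S _ _ Hm))) in K. lia. }
    assert (FR : (forall y, In y (An (S n)) -> (exists m, m <= n /\ In y (An m)) \/
                  exists i p, stage_event n = Fwd i /\ rn n i = Some p /\ y = pos p) ->
       forall j p, rn (S n) j = Some p -> mode p = 0 -> forall m, m <= S n -> ~ In (pos p) (An m)).
    { intros HA j p' E M m Hm.
      assert (Hp : (forall m, m <= n -> ~ In (pos p') (An m)) /\
                   forall i p, stage_event n = Fwd i -> rn n i = Some p -> pos p' <> pos p).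
      { apply run_step in E. destruct E as [[E K] | [(_ & -> & _) | (p & E & O)]].
        - split.
          + intros m' Hm'. apply (so_fresh _ IHn j p'); auto.
          + intros i p Ei Ep. unfold keeps in K. rewrite Ei in K.
            pose proof (pos_lt_rst _ _ _ _ _ K E Ep). apply rn_ok in Ep. destruct Ep. lia.
        - cbn. split; trivial. intros i p _ Ep. apply rn_ok in Ep. destruct Ep. lia.
        - destruct O as [kap k c O -> | O -> | t O -> | b O ->]; cbn in *; try lia.
          + split.
            * apply (so_fresh _ IHn j p); auto.
            * intros i q Ei. congruence.
          + split; trivial. intros i q Ei Eq. apply rn_ok in Eq. destruct Eq. lia. }
      destruct Hp as [Hp1 Hp2]. destruct (Nat.eq_dec m (S n)) as [-> | ]; [ | apply Hp1; lia ].
      intros K. apply HA in K. destruct K as [(m' & Hm' & K) | (i & p & Ei & Ep & K)].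
      - now apply (Hp1 m').
      - now apply (Hp2 i p). }
    destruct (stage_growth n) as [_ EA EC _ | kap k _ EA EC NC _ | i p _ EE Ep M EA EC | t _ Lt EA EC].
    + destruct IHn as [a b c d e]. constructor; rewrite ?EA, ?EC; auto with arith.
      * intros kap k K. specialize (b _ _ K). lia.
      * apply FR. rewrite EA. eauto.
    + destruct IHn as [a b c d e]. destruct NC as (N1 & N2 & N3 & N4). constructor; rewrite ?EA, ?EC; auto with arith.
      * intros kap' k' [[= <- <-] | K]; [ lia | ]. specialize (b _ _ K). lia.
      * intros kap' k1 k2 [[= <- <-] | K1] [[= E] | K2]; trivial; try subst.
        -- exfalso; apply N1; now exists k2.
        -- exfalso; apply N1; now exists k1.
        -- eauto.
      * intros kap' k' [[= <- <-] | K]; auto.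
      * apply FR. rewrite EA. eauto.
    + pose proof (rn_ok _ _ _ Ep) as RO. destruct IHn as [a b c d e].
      constructor; rewrite ?EA, ?EC; auto with arith.
      * intros y [<- | K]; [ destruct RO; lia | apply a in K; lia ].
      * intros kap k K. apply filter_In in K. destruct K as [K _]. apply b in K. lia.
      * intros kap k k' K K'. apply filter_In in K, K'. destruct K as [K _], K' as [K' _]. eauto.
      * intros kap k K. apply filter_In in K. cbn in K. rewrite Nat.leb_le in K.
        apply hcomp_same with (A := An n); [ | now apply d ].
        intros m Hm. cbn. intuition lia.
      * apply FR. rewrite EA. intros y [<- | K]; eauto. right; eauto.
    + destruct IHn as [a b c d e]. destruct (IH t) as [a' b' c' d' e']; [ lia | ].
      constructor; rewrite ?EA, ?EC; auto.
      * intros y K. apply a' in K. lia.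
      * intros kap k K. apply carry_iff in K. destruct K as [K | [K _]]; [ apply b' in K | apply b in K ]; lia.
      * intros kap k k' K K'. apply carry_iff in K, K'.
        destruct K as [K | (K & N & _)], K' as [K' | (K' & N' & _)]; eauto.
        -- exfalso; apply N'; now exists k.
        -- exfalso; apply N; now exists k'.
      * intros kap k K. apply carry_iff in K. destruct K as [K | (K & N & HS)]; auto.
        apply hcomp_same with (A := An n); auto. intros m Hm. symmetry. now apply HS.
      * apply FR. rewrite EA. intros y K. left. exists t. split; [ lia | trivial ].
Qed.

Lemma fresh_fwd z i p : stage_event z = Fwd i -> rn z i = Some p ->
  forall m, m <= z -> ~ In (pos p) (An m).
Proof.
  intros E Ep. apply (so_fresh _ (state_ok_holds z) i); trivial.
  apply (stage_mode0 z i); auto.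
Qed.

Lemma C_lt n kap k : In (kap, k) (Cn n) -> k < n.
Proof. apply (so_C _ (state_ok_holds n)). Qed.
Lemma C_uniq n kap k k' : In (kap, k) (Cn n) -> In (kap, k') (Cn n) -> k = k'.
Proof. apply (so_uniq _ (state_ok_holds n)). Qed.

(** * Ancestors *)

Inductive anc (s : nat) : nat -> Prop :=
| anc_refl : anc s s
| anc_step n : anc s (parent n) -> anc s (S n).

Lemma anc_le s u : anc s u -> s <= u.
Proof. induction 1 as [ | n _ IH]; trivial. pose proof (parent_le n). lia. Qed.

Lemma anc_trans s v u : anc s v -> anc v u -> anc s u.
Proof. intros Hs Hu; induction Hu as [ | n _ IH]; trivial. now constructor. Qed.

Lemma anc_inv s n : anc s (S n) -> s <> S n -> anc s (parent n).
Proof. intros H Ne. now inversion H; subst. Qed.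

(** Every stage has a single parent, so the ancestors of [u] form a chain. *)
Lemma anc_linear s v u : anc s u -> anc v u -> s <= v -> anc s v.
Proof.
  intros Hs Hv; induction Hv as [ | n Hv IH]; intros L; trivial.
  apply IH; trivial. apply anc_inv; trivial. intros ->.
  apply anc_le in Hv. pose proof (parent_le n). lia.
Qed.

Lemma anc_0 u : anc 0 u.
Proof.
  induction u as [u IH] using lt_wf_ind. destruct u as [ | n]; constructor.
  apply IH. pose proof (parent_le n). lia.
Qed.

(** Along a path only [Fwd] changes the set; a return leads to a set equal to that of its target,
    which is the parent. *)
Lemma anc_mono s u : anc s u -> incl (An s) (An u).
Proof.
  induction 1 as [ | n H IH]; [ apply incl_refl | ]. eapply incl_tran; [ exact IH | ].
  destruct (stage_growth n) as [E EA _ _ | kap k E EA _ _ _ | i p E _ _ _ EA _ | t E _ EA _];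
    rewrite EA, E; try apply incl_refl. apply incl_tl, incl_refl.
Qed.

Definition agr (s u : nat) : Prop := same_below s (An s) (An u).

Lemma agr_sandwich s v u : anc s v -> anc v u -> agr s u -> agr s v.
Proof.
  intros H1 H2 H m Hm. split.
  - apply (anc_mono _ _ H1).
  - intros K. apply H; trivial. now apply (anc_mono _ _ H2).
Qed.

Lemma agr_trans s v u : s <= v -> agr s v -> agr v u -> agr s u.
Proof. intros L H1 H2 m Hm. rewrite (H1 m Hm). apply H2. lia. Qed.

(** On the path a record is lost only by a [Fwd] with a number below its use; that number is fresh
    and would still be visible in [An u]. *)
Lemma entry_persist v u kap k : anc v u -> In (kap, k) (Cn v) -> same_below k (An v) (An u) ->
  In (kap, k) (Cn u).
Proof.
  intros H K; induction H as [ | n H IH]; intros HS; trivial.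
  assert (M : incl (An (parent n)) (An (S n))) by (apply anc_mono; constructor; constructor).
  assert (K' : In (kap, k) (Cn (parent n))).
  { apply IH. intros m Hm; split.
    - apply (anc_mono _ _ H).
    - intros Q. apply HS; auto. }
  destruct (stage_growth n) as [E _ EC _ | kap' k' E _ EC _ _ | i p E EE Ep _ EA EC | t E _ _ EC];
    rewrite EC; rewrite E in *; auto.
  - now right.
  - apply filter_In. split; trivial. cbn. apply Nat.leb_le.
    apply Nat.nlt_ge. intros Q.
    apply (fresh_fwd n i p EE Ep v); [ now apply anc_le | ].
    apply HS; trivial. rewrite EA. now left.
  - apply carry_iff. now left.
Qed.

Lemma add_origin v u x : anc v u -> In x (An u) -> ~ In x (An v) ->
  exists z i p, stage_event z = Fwd i /\ rn z i = Some p /\ x = pos p /\ anc v z /\ anc (S z) u.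
Proof.
  intros H Hu Hv; induction H as [ | n H IH]; [ easy | ].
  destruct (classic (In x (An (parent n)))) as [K | K].
  - destruct (IH K) as (z & i & p & E1 & E2 & E3 & E4 & E5). exists z, i, p. repeat split; trivial.
    now constructor.
  - destruct (stage_growth n) as [E EA _ _ | kap' k' E EA _ _ _ | i p E EE Ep _ EA _ | t E _ EA _];
      rewrite EA in Hu; rewrite E in *; try contradiction.
    destruct Hu as [<- | Hu]; [ | contradiction ].
    exists n, i, p. repeat split; trivial. constructor.
Qed.

(** * Tracing an action back to the stage that prepared it *)

(** The strategies above [i] are frozen in the meantime, so facts about them at stage [t] can be
    used again after a return to [t]. *)
Definition since (i t n : nat) (Q : run -> Prop) : Prop :=
  forall v, t < v <= n ->
    (exists p, rn v i = Some p /\ Q p) /\ (forall j, j < i -> rn v j = rn t j) /\ anc (S t) v.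

Lemma own_keeps n i j p p' : own n i p p' -> j < i -> keeps n j.
Proof. intros O L; unfold keeps; destruct O as [kap k c O _ | O _ | t O _ | b O _]; now rewrite O. Qed.

Lemma run_below n i j p p' : rn n i = Some p -> rn (S n) i = Some p' -> j < i ->
  rn (S n) j = rn n j.
Proof.
  intros E E' L. destruct (rn_lt n j i p L E) as [q Q]. rewrite Q.
  apply run_keep; trivial. apply run_step in E'.
  destruct E' as [[_ K] | [(EV & _) | (r & _ & O)]].
  - apply keeps_lt with i; trivial; lia.
  - unfold keeps; now rewrite EV.
  - eapply own_keeps; eauto.
Qed.

Lemma parent_gt n i p : rn n i = Some p -> keeps n i -> pos p < parent n.
Proof.
  intros E. pose proof (rn_ok _ _ _ E) as RO. unfold keeps, parent.
  destruct (stage_event n) as [ | | | j | j t | j b] eqn:EV; intros K; try apply RO.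
  - apply act2_spec in EV. destruct EV as (q & Eq & _ & _ & _ & L & _).
    pose proof (pos_lt_rst _ _ _ _ _ K E Eq). lia.
  - apply act3_spec in EV. destruct EV as (q & Eq & _ & _ & _ & L & _).
    pose proof (pos_lt_rst _ _ _ _ _ K E Eq). pose proof (rn_ok _ _ _ Eq) as []. lia.
Qed.

Lemma since_refl i n Q p p' : rn n i = Some p -> parent n = n ->
  rn (S n) i = Some p' -> Q p' -> since i n (S n) Q.
Proof.
  intros E P E' HQ v Hv. replace v with (S n) by lia.
  split; [ eauto | ]. split; [ | constructor ]. intros j L. now apply (run_below n i j p p').
Qed.

Lemma since_step i t n Q p p' : since i t n Q -> rn n i = Some p -> t < n ->
  t < parent n -> rn (S n) i = Some p' -> Q p' -> since i t (S n) Q.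
Proof.
  intros H E Lt P E' HQ v Hv. destruct (Nat.eq_dec v (S n)) as [-> | Ne]; [ | apply H; lia ].
  split; [ eauto | ]. split.
  - intros j L. rewrite (run_below n i j p p') by trivial. now apply H.
  - constructor. apply H. pose proof (parent_le n). lia.
Qed.

Section Mark.
Variable m : nat -> run -> Prop.
Hypothesis m_letter : forall t kap c p, m t (letter_run kap c p) -> m t p.
Hypothesis m_fwd : forall t n p, m t (fwd_run n p) -> t = n \/ m t p.
Hypothesis m_new : forall t n, ~ m t (new_run n).
Hypothesis m_pos : forall t n p, run_ok n p -> m t p -> t <= pos p.

(** A mark is a feature of a strategy tied to a stage [t]: an entry of [live], or the current
    number. Only the [Fwd] at [t] creates it, so the induction backwards from [n] ends there. *)
Lemma mark_origin n i p t : rn n i = Some p -> mode p = 0 -> m t p ->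
  exists pt, stage_event t = Fwd i /\ rn t i = Some pt /\ mode pt = 0 /\ m t (fwd_run t pt) /\
    since i t n (fun q => mode q = 0 /\ rst q = rst pt /\ m t q).
Proof.
  revert p; induction n as [ | n IH]; intros p' E' M' Ht; [ destruct i; discriminate | ].
  pose proof E' as E. apply run_step in E. destruct E as [[E K] | [(_ & -> & _) | (p & E & O)]].
  - destruct (IH _ E M' Ht) as (pt & H1 & H2 & H3 & H4 & H5). exists pt. do 4 (split; [ now trivial | ]).
    pose proof (rn_ok _ _ _ E) as RO. pose proof (m_pos _ _ _ RO Ht). destruct RO.
    pose proof (parent_gt _ _ _ E K).
    apply since_step with p' p'; trivial; try lia. repeat split; trivial.
    destruct (H5 n) as [(q & Hq & _ & K2 & _) _]; [ lia | congruence ].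
  - destruct (m_new _ _ Ht).
  - destruct O as [kap k c O -> | O -> | s O -> | b O ->]; cbn in M'; try lia.
    + pose proof (m_letter _ _ _ _ Ht) as Ht'.
      destruct (IH _ E M' Ht') as (pt & H1 & H2 & H3 & H4 & H5). exists pt. do 4 (split; [ now trivial | ]).
      pose proof (rn_ok _ _ _ E) as RO. pose proof (m_pos _ _ _ RO Ht'). destruct RO.
      apply since_step with p (letter_run kap c p); trivial; try lia.
      { unfold parent. rewrite O. lia. }
      repeat split; trivial.
      destruct (H5 n) as [(q & Hq & _ & K2 & _) _]; [ lia | ]. cbn. congruence.
    + destruct (Nat.eq_dec t n) as [-> | Ne].
      * exists p. do 4 (split; [ now trivial | ]). apply since_refl with p (fwd_run n p); trivial.
        -- unfold parent. now rewrite O.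
        -- auto.
      * destruct (m_fwd _ _ _ Ht) as [ | Ht']; [ easy | ].
        destruct (IH _ E M' Ht') as (pt & H1 & H2 & H3 & H4 & H5). exists pt. do 4 (split; [ now trivial | ]).
        pose proof (rn_ok _ _ _ E) as RO. pose proof (m_pos _ _ _ RO Ht'). destruct RO.
        apply since_step with p (fwd_run n p); trivial; try lia.
        { unfold parent. rewrite O. lia. }
        repeat split; trivial.
        destruct (H5 n) as [(q & Hq & _ & K2 & _) _]; [ lia | ]. cbn. congruence.
Qed.
End Mark.

Lemma live_origin n i p w t : rn n i = Some p -> mode p = 0 -> In (w, t) (live p) ->
  exists pt, stage_event t = Fwd i /\ rn t i = Some pt /\ mode pt = 0 /\ word pt = w /\
    since i t n (fun q => mode q = 0 /\ rst q = rst pt /\ In (w, t) (live q)).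
Proof.
  intros E M Hw.
  destruct (mark_origin (fun t q => In (w, t) (live q))) with (n := n) (i := i) (p := p) (t := t)
    as (pt & H1 & H2 & H3 & H4 & H5); trivial.
  - clear. cbn. intros t kap c p. destruct (c =? 0); trivial. rewrite filter_In. tauto.
  - clear. cbn. intros t n p [[= _ ->] | K]; auto.
  - clear. cbn. auto.
  - clear. intros t n p RO K. now apply (ok_live _ _ RO) in K.
  - exists pt. do 3 (split; [ now trivial | ]). split; trivial. cbn in H4. destruct H4 as [[= <-] | H4]; trivial.
    apply rn_ok in H2. apply (ok_live _ _ H2) in H4. destruct H2. lia.
Qed.

Lemma pos_origin n i p : rn n i = Some p -> mode p = 0 -> pos p <> rst p ->
  exists pt, stage_event (pos p) = Fwd i /\ rn (pos p) i = Some pt /\ mode pt = 0 /\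
    since i (pos p) n (fun q => mode q = 0 /\ rst q = rst pt /\ pos q = pos p).
Proof.
  intros E M Ne.
  destruct (mark_origin (fun t q => pos q = t /\ pos q <> rst q)) with (n := n) (i := i) (p := p) (t := pos p)
    as (pt & H1 & H2 & H3 & H4 & H5); trivial.
  - clear. cbn. intros t n p [K _]. auto.
  - clear. cbn. intros t n [_ K]. auto.
  - clear. intros t n p RO [K _]. lia.
  - split; trivial.
  - exists pt. do 3 (split; [ now trivial | ]). intros v Hv. split; [ | split ].
    + destruct (H5 v) as [(q & K1 & K2 & K3 & K4 & _) _]; trivial. exists q. auto.
    + now destruct (H5 v) as (_ & K & _).
    + now destruct (H5 v) as (_ & _ & K).
Qed.

Lemma agr_keep s n i p : rn n i = Some p -> keeps n i -> s <= S (pos p) -> s < n ->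
  (forall v, s <= v <= n -> agr s v) -> agr s (S n).
Proof.
  intros E K L Ln H. destruct (stage_growth n) as [_ EA _ _ | kap k _ EA _ _ _ | j q _ EE Eq _ EA _ | t Et _ EA _];
    intros m Hm; rewrite EA; try (apply H; trivial; lia).
  - assert (Hn : agr s n) by (apply H; lia). specialize (Hn m Hm). cbn. unfold keeps in K. rewrite EE in K.
    pose proof (pos_lt_rst _ _ _ _ _ K E Eq). pose proof (rn_ok _ _ _ Eq) as []. intuition lia.
  - pose proof (parent_gt _ _ _ E K). apply H; trivial. pose proof (parent_le n). lia.
Qed.

Lemma since_agr_step i b n Q p : (b < n -> since i b n Q /\ forall v, S b <= v <= n -> agr (S b) v) ->
  rn n i = Some p -> keeps n i -> b = pos p -> Q p ->
  since i b (S n) Q /\ forall v, S b <= v <= S n -> agr (S b) v.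
Proof.
  intros H E K -> HQ. assert (L : pos p < n) by apply (ok_pos _ _ (rn_ok _ _ _ E)).
  destruct (H L) as [H1 H2]. split.
  - apply since_step with p p; trivial.
    + now apply parent_gt with i.
    + now apply run_keep.
  - intros v Hv. destruct (Nat.eq_dec v (S n)) as [-> | Ne]; [ | apply H2; lia ].
    destruct (Nat.eq_dec (S (pos p)) n) as [En | Ne].
    + assert (H2' : agr (S (pos p)) (S (pos p))) by (intros m Hm; easy).
      destruct (stage_growth n) as [_ EA _ _ | kap k _ EA _ _ _ | j q _ EE Eq _ EA _ | t Et Lt EA _];
        intros m Hm; rewrite EA, ?En; try easy.
      * cbn. unfold keeps in K. rewrite EE in K.
        pose proof (pos_lt_rst _ _ _ _ _ K E Eq). pose proof (rn_ok _ _ _ Eq) as []. intuition lia.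
      * pose proof (parent_gt _ _ _ E K). lia.
    + apply agr_keep with i p; trivial; lia.
Qed.

(** In mode 1 a strategy gets no letters and its only action is the [Act3]. Hence it stays as the
    [Act2] left it, while the lower strategies, started later, use only larger numbers. *)
Lemma mode1_origin n i p : rn n i = Some p -> mode p = 1 ->
  exists t pb, stage_event (pos p) = Act2 i t /\ rn (pos p) i = Some pb /\ mode pb = 0 /\
    In (word pb, t) (live pb) /\ p = act2_run (pos p) pb /\
    since i (pos p) n (fun q => q = p) /\ (forall v, S (pos p) <= v <= n -> agr (S (pos p)) v).
Proof.
  revert p; induction n as [ | n IH]; intros p' E' M'; [ destruct i; discriminate | ].
  pose proof E' as E. apply run_step in E. destruct E as [[E K] | [(_ & -> & _) | (p & E & O)]].
  - destruct (IH _ E M') as (t & pb & H1 & H2 & H3 & H4 & H5 & H6 & H7).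
    exists t, pb. repeat (split; [ now trivial | ]).
    apply since_agr_step with p'; trivial. auto.
  - discriminate.
  - assert (M0 : stage_event n <> Act3 i (ret p) -> mode p = 0).
    { intros Ne. apply (stage_mode0 n i p E). destruct O; eauto 6.
      exfalso. pose proof (act3_spec _ _ _ H) as (q & Eq & _ & _ & Eb & _). congruence. }
    destruct O as [kap k c O -> | O -> | s O -> | b O ->]; cbn in M'; try (rewrite M0 in M'; congruence).
    + clear M0. pose proof (act2_spec _ _ _ O) as (q & Eq & M & _ & Hq & _).
      assert (q = p) by congruence. subst q. exists s, p. cbn [pos act2_run].
      repeat (split; [ now trivial | ]). split.
      * intros v Hv. replace v with (S n) by lia. split; [ eauto | ]. split; [ | constructor ].
        intros j L. now apply (run_below n i j p (act2_run n p)).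
      * intros v Hv. replace v with (S n) by lia. intros m Hm; easy.
    + discriminate.
Qed.

Lemma mode2_origin n i p : rn n i = Some p -> mode p = 2 ->
  exists b p1, stage_event (pos p) = Act3 i b /\ rn (pos p) i = Some p1 /\ mode p1 = 1 /\
    p = act3_run (pos p) p1 /\
    since i (pos p) n (fun q => q = p) /\ (forall v, S (pos p) <= v <= n -> agr (S (pos p)) v).
Proof.
  revert p; induction n as [ | n IH]; intros p' E' M'; [ destruct i; discriminate | ].
  pose proof E' as E. apply run_step in E. destruct E as [[E K] | [(_ & -> & _) | (p & E & O)]].
  - destruct (IH _ E M') as (t & pb & H1 & H2 & H3 & H4 & H5 & H6).
    exists t, pb. repeat (split; [ now trivial | ]).
    apply since_agr_step with p'; trivial. auto.
  - discriminate.
  - assert (M0 : (exists kap k c, stage_event n = Letter kap k i c) \/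
              stage_event n = Fwd i \/ (exists t, stage_event n = Act2 i t) -> mode p = 0)
      by (apply stage_mode0, E).
    destruct O as [kap k c O -> | O -> | s O -> | b O ->]; cbn in M';
      try (rewrite M0 in M'; [ discriminate | eauto 6 ]).
    + discriminate.
    + clear M0. pose proof (act3_spec _ _ _ O) as (q & Eq & M & _).
      assert (q = p) by congruence. subst q. exists b, p. cbn [pos act3_run].
      repeat (split; [ now trivial | ]). split.
      * intros v Hv. replace v with (S n) by lia. split; [ eauto | ]. split; [ | constructor ].
        intros j L. now apply (run_below n i j p (act3_run n p)).
      * intros v Hv. replace v with (S n) by lia. intros m Hm; easy.
Qed.

Lemma event_ge n i p p' : rn n i = Some p -> rn (S n) i = Some p' ->
  match stage_event n with
  | Push | Enter _ _ => True
  | Letter _ _ j _ | Fwd j | Act2 j _ | Act3 j _ => i <= j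
  end.
Proof.
  intros E E'. apply run_step in E'.
  destruct E' as [[_ K] | [(EV & _) | (r & _ & O)]].
  - unfold keeps in K. destruct (stage_event n); trivial; lia.
  - now rewrite EV.
  - destruct O as [kap k c O _ | O _ | t O _ | b O _]; now rewrite O.
Qed.

Lemma since_in i t n Q v : since i t n Q -> t < v <= n -> exists p, rn v i = Some p /\ Q p.
Proof. intros H Hv. now destruct (H v Hv). Qed.
Lemma since_anc i t n Q v : since i t n Q -> t < v <= n -> anc (S t) v.
Proof. intros H Hv. now destruct (H v Hv) as (_ & _ & K). Qed.

Lemma since_event i t n Q w : since i t n Q -> t < w < n ->
  match stage_event w with
  | Push | Enter _ _ => True
  | Letter _ _ j _ | Fwd j | Act2 j _ | Act3 j _ => i <= j
  end.
Proof.
  intros H Hw. destruct (since_in _ _ _ _ w H) as (p & Ep & _); [ lia | ].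
  destruct (since_in _ _ _ _ (S w) H) as (p' & Ep' & _); [ lia | ].
  eapply event_ge; eauto.
Qed.

Lemma act2_origin n i t : stage_event n = Act2 i t -> exists p pt,
  rn n i = Some p /\ mode p = 0 /\ In (word p, t) (live p) /\ rst p <= t < n /\
  stage_event t = Fwd i /\ rn t i = Some pt /\ mode pt = 0 /\ word pt = word p /\ rst pt = rst p /\
  since i t n (fun q => mode q = 0 /\ rst q = rst p /\ In (word p, t) (live q)).
Proof.
  intros E. apply act2_spec in E. destruct E as (p & H1 & H2 & H3 & H4 & H5 & H6 & H7 & _).
  destruct (live_origin n i p _ t H1 H2 H4) as (pt & G1 & G2 & G3 & G4 & G5).
  assert (ER : rst p = rst pt).
  { destruct (since_in _ _ _ _ n G5) as (q & Eq & _ & K & _); [ lia | ]. congruence. }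
  exists p, pt. do 3 (split; [ now trivial | ]). split; [ lia | ].
  do 5 (split; [ now auto | ]). rewrite ER. exact G5.
Qed.

Lemma act3_origin n i b : stage_event n = Act3 i b -> exists p t pb,
  rn n i = Some p /\ mode p = 1 /\ b < n /\ stage_event b = Act2 i t /\ t < b /\ rn b i = Some pb /\
  mode pb = 0 /\ In (word pb, t) (live pb) /\ rst pb = rst p /\ word pb = word p /\
  since i b n (fun q => q = p) /\ (forall v, S b <= v <= n -> agr (S b) v).
Proof.
  intros E. apply act3_spec in E. destruct E as (p & H1 & H2 & _ & H3 & H4 & H5 & _).
  destruct (mode1_origin n i p H1 H2) as (t & pb & G1 & G2 & G3 & G4 & G5 & G6 & G7).
  rewrite <- H4 in *. exists p, t, pb. repeat (split; [ now trivial | ]).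
  apply act2_spec in G1 as G8. destruct G8 as (q & _ & _ & _ & _ & _ & _ & L & _).
  repeat (split; [ now trivial | ]). split; [ now rewrite G5 | ]. split; [ now rewrite G5 | ]. now split.
Qed.

(** The number of a strategy in mode 0 is the stage that chose it, so one below [v] was chosen
    before [v]. At a return the remaining higher strategies are as they were at its target. *)
Lemma pos_back v u : anc v u -> forall j p, rn u j = Some p -> mode p = 0 -> pos p < v ->
  exists q, rn v j = Some q /\ mode q = 0 /\ rst q = rst p /\ pos q = pos p.
Proof.
  induction 1 as [ | n H IH]; intros j p' E' M' L; [ eauto | ].
  pose proof (anc_le _ _ H) as Lv. pose proof (parent_le n) as Lp.
  pose proof (run_step _ _ _ E') as D. destruct D as [[E K] | [(_ & -> & _) | (p & E & O)]].
  - unfold keeps, parent in *. destruct (stage_event n) as [ | | | i | i t | i b] eqn:EV; eauto.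
    + destruct (act2_origin _ _ _ EV) as (p & pt & _ & _ & _ & [_ Lt] & _ & _ & _ & _ & _ & S0).
      apply IH; trivial. destruct (S0 n) as (_ & K' & _); [ lia | ]. now rewrite <- K'.
    + destruct (act3_origin _ _ _ EV) as (p & t & pb & _ & _ & Lb & _ & _ & _ & _ & _ & _ & _ & S0 & _).
      apply IH; trivial. destruct (S0 n) as (_ & K' & _); [ lia | ]. now rewrite <- K'.
  - cbn in L. lia.
  - destruct O as [kap k c O -> | O -> | s O -> | b O ->]; cbn in M', L; try lia.
    unfold parent in *. rewrite O in *. destruct (IH j p E M' L) as (q & K). exists q. exact K.
Qed.

(** * Agreement determines ancestry *)

(** A jumped stage betrays itself by the number of the [Fwd] at the target of the [Act2]: it is in
    every stage jumped over, but neither in the target nor in the restored set. For an [Act3] the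
    roles are exchanged: the stages jumped over lack it, the restored set has it. This number is
    smaller than the target, hence within the range of the agreement. *)
Lemma agr_anc s u : s <= u -> agr s u -> anc s u.
Proof.
  revert s; induction u as [u IH] using lt_wf_ind; intros s L H.
  destruct u as [ | n]; [ replace s with 0 by lia; constructor | ].
  destruct (Nat.eq_dec s (S n)) as [-> | Ne]; constructor.
  unfold parent. destruct (stage_growth n) as [E EA _ EV | kap k E EA _ _ EV | i p E EV Ep M EA _ | t _ _ EA _].
  - rewrite EV. apply IH; try lia. unfold agr in *. now rewrite <- EA.
  - unfold parent in E. rewrite E. apply IH; try lia. unfold agr in *. now rewrite <- EA.
  - rewrite EV. apply IH; try lia. intros m Hm. rewrite (H m Hm), EA. cbn. split; [ | now right ].
    intros [<- | K]; trivial. exfalso. apply (fresh_fwd n i p EV Ep s); [ lia | ].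
    apply H; trivial. rewrite EA. now left.
  - assert (KEY : forall t i p, stage_event t = Fwd i -> rn t i = Some p -> t < n -> s <= n ->
      (forall v, t < v <= n -> In (pos p) (An v)) -> (t < s -> same_below t (An t) (An s)) -> s <= t).
    { intros t' i p EV Ep Lt Ls HI HS. apply Nat.nlt_ge; intros Q.
      pose proof (rn_ok _ _ _ Ep) as []. apply (fresh_fwd t' i p EV Ep t'); trivial.
      apply HS; trivial. apply HI; lia. }
    destruct (stage_event n) as [ | | | i | i t' | i b] eqn:EV.
    + pose proof (stage_ok_holds n) as SO. rewrite EV in SO. cbn in SO. destruct SO as [EA' _].
      apply IH; try lia. unfold agr in *. now rewrite <- EA'.
    + pose proof (stage_ok_holds n) as SO. rewrite EV in SO. cbn in SO. destruct SO as [EA' _].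
      apply IH; try lia. unfold agr in *. now rewrite <- EA'.
    + pose proof (stage_ok_holds n) as SO. rewrite EV in SO. cbn in SO.
      destruct SO as (p & _ & _ & _ & _ & _ & _ & EA' & _).
      apply IH; try lia. unfold agr in *. now rewrite <- EA'.
    + apply fwd_spec in EV as SO. destruct SO as (p & Ep & _ & _ & _ & EA' & _).
      apply IH; try lia. intros m Hm. rewrite (H m Hm), EA'. cbn. split; [ | now right ].
      intros [<- | K]; trivial. exfalso. apply (fresh_fwd n i p EV Ep s); [ lia | ].
      apply H; trivial. rewrite EA'. now left.
    + apply act2_spec in EV as SO. destruct SO as (p0 & _ & _ & _ & _ & _ & _ & L' & EA' & _).
      destruct (act2_origin _ _ _ EV) as (p & pt & G1 & G2 & G3 & G4 & G5 & G6 & G7 & G8 & G9 & G10).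
      assert (Ls : s <= t').
      { apply (KEY t' i pt); trivial; try lia.
        - intros v Hv. apply (anc_mono (S t')); [ apply (since_anc _ _ _ _ v G10); lia | ].
          apply fwd_spec in G5. destruct G5 as (q & Eq & _ & _ & _ & EAq & _).
          rewrite EAq. left. congruence.
        - intros Q m Hm. specialize (H m ltac:(lia)). rewrite EA' in H. tauto. }
      apply IH; try lia. unfold agr in *. now rewrite <- EA'.
    + apply act3_spec in EV as SO. destruct SO as (p0 & _ & _ & _ & _ & _ & L' & EA' & _).
      destruct (act3_origin _ _ _ EV) as (p & t' & pb & G1 & G2 & G3 & G4 & G5 & G6 & G7 & G8 & G9 & G10 & G11 & G12).
      assert (Ls : s <= b).
      { apply Nat.nlt_ge; intros Q.
        destruct (act2_origin _ _ _ G4) as (p' & pt & F1 & F2 & F3 & F4 & F5 & F6 & F7 & F8 & F9 & F10).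
        apply act2_spec in G4. destruct G4 as (p1 & _ & _ & _ & _ & _ & _ & _ & EA2 & _).
        pose proof (rn_ok _ _ _ F6) as [].
        apply (fresh_fwd t' i pt F5 F6 t'); trivial. rewrite <- EA2.
        apply (G12 s); [ lia | lia | ]. apply H; [ lia | ]. rewrite EA'.
        apply (anc_mono (S t')); [ apply (since_anc _ _ _ _ b F10); lia | ].
        apply fwd_spec in F5. destruct F5 as (q & Eq & _ & _ & _ & EAq & _).
        rewrite EAq. left. congruence. }
      apply IH; try lia. unfold agr in *. now rewrite <- EA'.
Qed.

(** If [pos p >= b], this number was chosen by a [Fwd] at stage [pos p], on the path after [b],
    which put the previous number into the set. By induction the previous one is below [b], so a
    fresh number below [b] has entered after [b], against [agr b v]. *)
Lemma rst_pos_lt v : forall b i p, anc b v -> agr b v -> rn v i = Some p -> mode p = 0 ->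
  rst p < b -> pos p < b.
Proof.
  induction v as [v IH] using lt_wf_ind; intros b i p Hb Ha E M L.
  destruct (Nat.lt_ge_cases (pos p) b) as [ | G]; trivial. exfalso.
  assert (Ne : pos p <> rst p) by lia.
  destruct (pos_origin v i p E M Ne) as (pt & H1 & H2 & H3 & H4).
  pose proof (rn_ok _ _ _ E) as [_ Lv _ _ _ _].
  pose proof (since_anc _ _ _ _ v H4 ltac:(lia)) as Hx.
  assert (Hbx : anc b (pos p)).
  { pose proof (anc_linear _ _ _ Hb Hx ltac:(lia)) as Q.
    apply anc_inv in Q; [ | lia ]. unfold parent in Q. now rewrite H1 in Q. }
  assert (R : rst pt = rst p).
  { destruct (since_in _ _ _ _ v H4) as (q & Eq & _ & K & _); [ lia | congruence ]. }
  apply fwd_spec in H1 as H1'. destruct H1' as (q & Eq & _ & _ & _ & EA & _).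
  assert (q = pt) by congruence. subst q.
  assert (Hin : In (pos pt) (An v)).
  { apply (anc_mono _ _ Hx). rewrite EA. now left. }
  assert (Hxv : anc (pos p) v).
  { apply anc_trans with (S (pos p)); trivial. constructor. unfold parent. rewrite H1. constructor. }
  assert (K : pos pt < b).
  { apply (IH (pos p) Lv b i pt); trivial; [ | lia ]. now apply agr_sandwich with v. }
  apply (fresh_fwd _ _ _ H1 H2 b); [ lia | ]. now apply Ha.
Qed.

(** * Commitments *)

Lemma commit_spec n kap k i t : stage_event n = Letter kap k i (S t) -> exists p w,
  rn n i = Some p /\ In (w, t) (live p) /\ rst p <= t /\ prefix (word p ++ [kap]) w.
Proof.
  intros E. pose proof (stage_ok_holds n) as H. rewrite E in H.
  destruct H as (p & H1 & _ & _ & _ & _ & _ & _ & _ & _ & w & l1 & l2 & H2 & H3 & _).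
  assert (K : In (w, t) (live p)) by (rewrite H2; apply in_elt).
  exists p, w. repeat (split; trivial). pose proof (rn_ok _ _ _ H1) as RO.
  now apply (ok_live _ _ RO) in K.
Qed.

Lemma letter_next n kap k i c : stage_event n = Letter kap k i c -> exists p,
  rn n i = Some p /\ mode p = 0 /\ kap <= rst p /\ pos p < k /\ new_comp n kap k /\
  Cn (S n) = (kap, k) :: Cn n /\ rn (S n) i = Some (letter_run kap c p).
Proof.
  intros E. pose proof (stage_ok_holds n) as H. rewrite E in H.
  destruct H as (p & H1 & H2 & H3 & H4 & H5 & _ & _ & H6 & H7 & _).
  exists p. repeat (split; [ now trivial | ]).
  rewrite (rn_trunc _ _ _ _ _ H1 H7), Nat.ltb_irrefl, Nat.eqb_refl. trivial.
Qed.

(** A commitment of strategy [i] to a stage before [t] would have removed [(w, t)] from its list,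
    and the live stages of a lower strategy come after [t], because they are not before its
    start. *)
Lemma commit_ge n i w t p : rn n i = Some p -> mode p = 0 -> In (w, t) (live p) ->
  forall m kap k j c, t <= m < n -> stage_event m = Letter kap k j (S c) -> t <= c.
Proof.
  intros E M Hw m kap k j c Hm EV.
  destruct (live_origin n i p w t E M Hw) as (pt & H1 & H2 & H3 & H4 & H5).
  assert (Lm : t < m) by (destruct (Nat.eq_dec m t); [ congruence | lia ]).
  pose proof (since_event _ _ _ _ m H5) as Ge. rewrite EV in Ge. specialize (Ge ltac:(lia)).
  destruct (commit_spec _ _ _ _ _ EV) as (q & w' & F1 & F2 & F3 & _).
  destruct (Nat.eq_dec j i) as [-> | Ne].
  - destruct (letter_next _ _ _ _ _ EV) as (q' & G1 & _ & _ & _ & _ & _ & G2).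
    destruct (since_in _ _ _ _ (S m) H5) as (q2 & G3 & _ & _ & G4); [ lia | ].
    rewrite G2 in G3. injection G3 as <-. cbn in G4. apply filter_In in G4. destruct G4 as [_ G4].
    now apply Nat.leb_le in G4.
  - destruct (since_in _ _ _ _ m H5) as (q2 & G3 & _ & _ & G4); [ lia | ].
    pose proof (pos_lt_rst m i j q2 q ltac:(lia) G3 F1).
    pose proof (rn_ok _ _ _ G3) as RO. apply (ok_live _ _ RO) in G4. lia.
Qed.

(** Since its [Act2] the strategy gets no letters, and the live stages of the lower strategies are
    later than that action. *)
Lemma commit_gt n i p : rn n i = Some p -> mode p = 1 ->
  forall m kap k j c, pos p <= m < n -> stage_event m = Letter kap k j (S c) -> pos p < c.
Proof.
  intros E M m kap k j c Hm EV.
  destruct (mode1_origin n i p E M) as (t & pb & H1 & H2 & H3 & H4 & H5 & H6 & _).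
  assert (Lm : pos p < m) by (destruct (Nat.eq_dec m (pos p)); [ congruence | lia ]).
  pose proof (since_event _ _ _ _ m H6) as Ge. rewrite EV in Ge. specialize (Ge ltac:(lia)).
  destruct (commit_spec _ _ _ _ _ EV) as (q & w' & F1 & F2 & F3 & _).
  destruct (since_in _ _ _ _ m H6) as (q2 & G3 & ->); [ lia | ].
  destruct (Nat.eq_dec j i) as [-> | Ne].
  - destruct (letter_next _ _ _ _ _ EV) as (q' & G1 & G2 & _). congruence.
  - pose proof (pos_lt_rst m i j p q ltac:(lia) G3 F1). lia.
Qed.

(** Going down the path from [u], one step has to pass over [S d], and only the steps of returns
    skip stages. *)
Lemma cover u : forall d, d < u -> ~ anc (S d) u -> exists n, anc (S n) u /\ n < u /\
  ((exists i t, stage_event n = Act2 i t /\ t <= d <= n) \/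
   (exists i b, stage_event n = Act3 i b /\ b <= d <= n)).
Proof.
  induction u as [u IH] using lt_wf_ind; intros d L N. destruct u as [ | n]; [ lia | ].
  assert (Ne : d <> n) by (intros ->; apply N; constructor).
  assert (REC : d < parent n -> exists m, anc (S m) (S n) /\ m < S n /\
    ((exists i t, stage_event m = Act2 i t /\ t <= d <= m) \/
     (exists i b, stage_event m = Act3 i b /\ b <= d <= m))).
  { intros Lp. pose proof (parent_le n). destruct (IH (parent n) ltac:(lia) d Lp) as (m & K1 & K2 & K3).
    - intros Q. apply N. now constructor.
    - exists m. split; [ now constructor | ]. split; [ lia | trivial ]. }
  unfold parent in REC. destruct (stage_event n) as [ | | | i | i t | i b] eqn:EV; try (apply REC; lia).
  - destruct (Nat.lt_ge_cases d t); [ apply REC; lia | ]. exists n. split; [ constructor | ].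
    split; [ lia | ]. left. exists i, t. split; [ trivial | lia ].
  - destruct (Nat.lt_ge_cases d b); [ apply REC; lia | ]. exists n. split; [ constructor | ].
    split; [ lia | ]. right. exists i, b. split; [ trivial | lia ].
Qed.

(** * Destroyed computations *)

(** After the destruction at [d], [kap] was entered again as a letter that leaves open a return to a
    stage at or before [d]. From then on the destruction at [d] is no evidence that [kap] is
    lost. *)
Definition commit_before (u kap d : nat) : Prop :=
  exists w k i c, w < u /\ d < w /\ stage_event w = Letter kap k i (S c) /\ c <= d.

(** Only strategies that have [kap] in their alphabet count; those with [rst p < kap] are dealt with
    by the parameter [be] of [kicked_before]. *)
Definition kick (kap d : nat) : Prop :=
  exists i p k, stage_event d = Fwd i /\ rn d i = Some p /\ In (kap, k) (Cn d) /\
    pos p < k /\ kap <= rst p.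

(** [be] is a guess of a length below which the set is final. If it is right, a strategy started
    before [be >= kap] cannot be responsible for the loss of [kap] on the path. *)
Definition kicked_before (u kap be s0 : nat) : Prop :=
  kap <= be <= s0 /\ agr be s0 /\ ind s0 kap /\
  exists d, s0 <= d < u /\ kick kap d /\ agr be d /\ anc s0 d /\ ~ commit_before u kap d.

Lemma commit_before_mono u v kap d : u <= v -> commit_before u kap d -> commit_before v kap d.
Proof. intros L (w & k & i & c & H1 & H); exists w, k, i, c; split; [ lia | trivial ]. Qed.

(** A commitment off the path is jumped over by a return on it. Such a return jumps only over
    commitments to stages at or after its target, and the target is at or after [v], hence beyond
    [d]. *)
Lemma commit_path v u kap d : anc v u -> d < v -> commit_before u kap d ->
  commit_before v kap d \/
  exists w k i c, v <= w /\ anc (S w) u /\ stage_event w = Letter kap k i (S c) /\ c <= d.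
Proof.
  intros Hv Ld (w & k & i & c & H1 & H2 & H3 & H4).
  destruct (Nat.lt_ge_cases w v) as [Lw | Lw]; [ left; exists w, k, i, c; auto | ].
  destruct (classic (anc (S w) u)) as [A | N]; [ right; exists w, k, i, c; auto | exfalso ].
  destruct (cover u w H1 N) as (n & K1 & K2 & [(j & t & E & L) | (j & b & E & L)]).
  - assert (w <> n) by congruence.
    pose proof (anc_linear _ _ _ Hv K1 ltac:(lia)) as Q. apply anc_inv in Q; [ | lia ].
    unfold parent in Q. rewrite E in Q. apply anc_le in Q.
    apply act2_spec in E. destruct E as (p & E1 & E2 & _ & E3 & _).
    pose proof (commit_ge n j _ t p E1 E2 E3 w _ _ _ _ ltac:(lia) H3). lia.
  - assert (w <> n) by congruence.
    pose proof (anc_linear _ _ _ Hv K1 ltac:(lia)) as Q. apply anc_inv in Q; [ | lia ].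
    unfold parent in Q. rewrite E in Q. apply anc_le in Q.
    apply act3_spec in E. destruct E as (p & E1 & E2 & _ & _ & E3 & _).
    pose proof (commit_gt n j p E1 E2 w _ _ _ _ ltac:(lia) H3). lia.
Qed.

Lemma agr_incl s v u : agr s u -> anc s v -> anc v u -> forall x, In x (An u) -> ~ In x (An v) -> s <= x.
Proof.
  intros H Hs Hv x Hx N. apply Nat.nlt_ge; intros L. apply N, (anc_mono _ _ Hs). now apply H.
Qed.

Lemma persist_agr s v kap k : agr s v -> anc s v -> In (kap, k) (Cn s) -> In (kap, k) (Cn v).
Proof.
  intros H A K. apply entry_persist with s; trivial. apply C_lt in K.
  intros m Hm. apply H. lia.
Qed.

(** A commitment made after [s], necessarily on the path, enters [kap] in a strategy started at or
    before [d < s], whose number is below [s] by [rst_pos_lt]. Nothing on the way to [u] can destroy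
    this record, so [kap] would be recorded at [u] but not at [s]. *)
Lemma commit_stable s u kap : s <= u -> agr s u -> (ind s kap <-> ind u kap) ->
  forall d, d < s -> commit_before u kap d -> commit_before s kap d.
Proof.
  intros L H HV d Ld HT. pose proof (agr_anc _ _ L H) as A.
  destruct (commit_path s u kap d A Ld HT) as [ | (w & k & i & c & Lw & Aw & E & Lc)]; trivial.
  exfalso. destruct (letter_next _ _ _ _ _ E) as (p & Ep & M & Kr & Kp & NC & EC & EpS).
  destruct (commit_spec _ _ _ _ _ E) as (p' & w' & Ep' & _ & Lr & _).
  assert (p' = p) by congruence. subst p'.
  assert (Asw : anc s w).
  { pose proof (anc_linear _ _ _ A Aw ltac:(lia)) as Q. apply anc_inv in Q; [ | lia ].
    unfold parent in Q. now rewrite E in Q. }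
  assert (Awu : anc w u).
  { apply anc_trans with (S w); trivial. constructor. unfold parent. rewrite E. constructor. }
  pose proof (agr_sandwich _ _ _ Asw Awu H) as Hsw.
  destruct NC as (NI & _).
  assert (NS : ~ ind s kap).
  { intros [k' Hk']. apply NI. exists k'. now apply (persist_agr s). }
  assert (NU : ~ ind u kap) by tauto.
  destruct (classic (same_below k (An (S w)) (An u))) as [SB | SB].
  { apply NU. exists k. apply entry_persist with (S w); trivial. rewrite EC. now left. }
  assert (EX : exists x, x < k /\ In x (An u) /\ ~ In x (An (S w))).
  { apply NNPP. intros N. apply SB. intros m Hm. split; [ apply (anc_mono _ _ Aw) | ].
    intros Q. apply NNPP. intros Q'. apply N. eauto. }
  destruct EX as (x & Lx & X1 & X2).
  assert (Ls : s <= x).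
  { apply (agr_incl s (S w) u); trivial. apply anc_trans with w; trivial.
    constructor. unfold parent. rewrite E. constructor. }
  destruct (add_origin _ _ _ Aw X1 X2) as (z & j & q & Ez & Eq & -> & Az1 & Az2).
  pose proof (C_lt (S w) kap k ltac:(rewrite EC; now left)) as Lk.
  assert (Mq : mode q = 0) by (apply (stage_mode0 z j); auto).
  destruct (pos_back _ _ Az1 j q Eq Mq ltac:(lia)) as (q' & Eq' & Mq' & _ & Pq').
  assert (Pw : pos p < s).
  { apply (rst_pos_lt w s i p); trivial. lia. }
  (* The destroying number was already pending at [S w]. In a higher strategy or in [i] itself it is
     below [s]; the lower strategies have been cancelled by the letter. *)
  destruct (Nat.lt_trichotomy j i) as [Lj | [-> | Lj]].
  - pose proof (pos_lt_rst (S w) j i q' _ Lj Eq' EpS) as Q. cbn in Q. lia.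
  - rewrite EpS in Eq'. injection Eq' as <-. cbn in Pq'. lia.
  - assert (N : rn (S w) j = None).
    { apply (run_gone w i j); trivial; rewrite E; easy. }
    congruence.
Qed.

Lemma succ_anc z u : parent z = z -> anc (S z) u -> anc z u.
Proof. intros P A. apply anc_trans with (S z); trivial. constructor. rewrite P. constructor. Qed.

Lemma anc_below s u v : anc s u -> anc (S v) u -> s <= v -> anc s (parent v).
Proof.
  intros A B L. pose proof (anc_linear _ _ _ A B ltac:(lia)) as Q. apply anc_inv in Q; trivial; lia.
Qed.

Lemma parent_fwd n i : stage_event n = Fwd i -> parent n = n.
Proof. unfold parent; now intros ->. Qed.
Lemma parent_act2 n i t : stage_event n = Act2 i t -> parent n = t.
Proof. unfold parent; now intros ->. Qed.
Lemma parent_act3 n i b : stage_event n = Act3 i b -> parent n = b.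
Proof. unfold parent; now intros ->. Qed.

(** Take the last loss of the record on the path. A strategy started before [kap <= be] would have a
    number below [be], and putting it in would contradict [agr be v]. A later commitment would mean
    a later entry of [kap] on the path, and so a later loss. *)
Lemma last_kick s0 v : anc s0 v -> forall kap be, kap <= be <= s0 -> agr be v -> ind s0 kap -> ~ ind v kap ->
  exists d, s0 <= d < v /\ anc s0 d /\ anc (S d) v /\ kick kap d /\ ~ commit_before v kap d.
Proof.
  induction 1 as [ | n A IH]; intros kap be Hk Ha Hs Hv; [ easy | ].
  pose proof (anc_le _ _ A) as Ls. pose proof (parent_le n) as Lp.
  assert (Abe : anc be (S n)) by (apply agr_anc; trivial; lia).
  assert (As : anc s0 (S n)) by now constructor.
  assert (Abp : anc be (parent n)) by (apply anc_inv; trivial; lia).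
  assert (Ap : anc (parent n) (S n)) by (constructor; constructor).
  assert (Hap : agr be (parent n)) by now apply agr_sandwich with (S n).
  destruct (classic (ind (parent n) kap)) as [[k Hk'] | N].
  - clear IH. destruct (stage_growth n) as [E _ EC _ | kap' k' E _ EC _ _ | i p E EE Ep M EA EC | t E _ _ EC].
    + exfalso. apply Hv. exists k. rewrite EC. now rewrite E in Hk'.
    + exfalso. apply Hv. exists k. rewrite EC. rewrite E in Hk'. now right.
    + rewrite E in *. exists n. split; [ lia | ]. split; trivial. split; [ constructor | ]. split.
      * exists i, p, k. repeat (split; [ now trivial | ]). split.
        -- apply Nat.nle_gt; intros Q. apply Hv. exists k. rewrite EC. apply filter_In.
           split; trivial. now apply Nat.leb_le.
        -- apply Nat.nlt_ge; intros Q.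
           pose proof (rst_pos_lt n be i p Abp Hap Ep M ltac:(lia)) as Q'.
           apply (fresh_fwd n i p EE Ep be); [ now apply anc_le | ].
           apply Ha; trivial. rewrite EA. now left.
      * intros (w & k1 & i1 & c & L1 & L2 & _). lia.
    + exfalso. apply Hv. exists k. rewrite EC. apply carry_iff. left. now rewrite E in Hk'.
  - destruct (IH kap be) as (d & H1 & H2 & H3 & H4 & H5); trivial.
    exists d. split; [ lia | ]. split; trivial. split; [ now constructor | ]. split; trivial.
    intros Q. apply (commit_path (parent n)) in Q; trivial; [ | lia ].
    destruct Q as [ | (w & k & i & c & Lw & Aw & E & _)]; [ easy | ].
    destruct (Nat.eq_dec w n) as [-> | Ne].
    + apply Hv. destruct (letter_next _ _ _ _ _ E) as (p & _ & _ & _ & _ & _ & EC & _).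
      exists k. rewrite EC. now left.
    + apply anc_inv in Aw; [ | lia ]. apply anc_le in Aw. lia.
Qed.

(** A new record becomes a letter of the first strategy that threatens it, and the lower ones are
    cancelled; a [Fwd] moves the number beyond all recorded uses. The records restored by a return
    belong to a stage at which the strategies above the acting one were as they are now. *)
Lemma hurt_in_word n : forall i p kap k, rn n i = Some p -> mode p = 0 -> In (kap, k) (Cn n) ->
  pos p < k -> kap <= rst p -> In kap (word p).
Proof.
  induction n as [n IHs] using lt_wf_ind; intros i p' kap k E' M' K L1 L2.
  destruct n as [ | n]; [ destruct i; discriminate | ].
  assert (IH := IHs n (le_n _)).
  pose proof E' as D. apply run_step in D. destruct D as [[E Kp] | [(_ & -> & _) | (p & E & O)]].
  - pose proof (stage_ok_holds n) as SO. unfold keeps in Kp.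
    destruct (stage_event n) as [ | kap1 k1 | kap1 k1 j c | j | j t | j b] eqn:EV; cbn in SO.
    + destruct SO as (_ & EC & _). rewrite EC in K. eauto.
    + destruct SO as (_ & EC & _ & _ & SO). rewrite EC in K. destruct K as [[= <- <-] | K]; eauto.
      specialize (SO _ _ E M' L2). lia.
    + destruct SO as (q & _ & _ & _ & _ & _ & SO & _ & EC & _). rewrite EC in K.
      destruct K as [[= <- <-] | K]; eauto. specialize (SO _ _ Kp E M' L2). lia.
    + destruct SO as (q & _ & _ & _ & _ & _ & EC & _). rewrite EC in K. apply filter_In in K.
      destruct K; eauto.
    + clear SO. destruct (act2_origin _ _ _ EV) as (q & qt & _ & _ & _ & [_ Lt] & _ & _ & _ & _ & _ & S0).
      destruct (S0 n) as (_ & K' & _); [ lia | ].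
      apply act2_spec in EV. destruct EV as (_ & _ & _ & _ & _ & _ & _ & _ & _ & EC).
      rewrite EC in K. apply carry_iff in K. destruct K as [K | (K & _)]; eauto.
      apply (IHs t ltac:(lia) i p' kap k); trivial. now rewrite <- K'.
    + clear SO. destruct (act3_origin _ _ _ EV) as (q & t & pb & _ & _ & Lb & _ & _ & _ & _ & _ & _ & _ & S0 & _).
      destruct (S0 n) as (_ & K' & _); [ lia | ].
      apply act3_spec in EV. destruct EV as (_ & _ & _ & _ & _ & _ & _ & _ & EC).
      rewrite EC in K. apply carry_iff in K. destruct K as [K | (K & _)]; eauto.
      apply (IHs b ltac:(lia) i p' kap k); trivial. now rewrite <- K'.
  - cbn in L1. apply C_lt in K. lia.
  - destruct O as [kap1 k1 c O -> | O -> | t O -> | b O ->]; cbn in M', L1, L2 |- *; try lia.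
    + destruct (letter_next _ _ _ _ _ O) as (p2 & Ep2 & _ & _ & _ & _ & EC & _). rewrite EC in K.
      apply in_app_iff. destruct K as [[= <- <-] | K]; [ right; now left | left; eauto ].
    + apply C_lt in K. lia.
Qed.

(** Entering the letter cancels the strategies below [j]; those started afterwards begin beyond its
    use and cannot destroy it. This bound is what carries the presence of the letter through the
    induction. *)
Lemma word_ind n : forall j p kap, rn n j = Some p -> mode p = 0 -> In kap (word p) ->
  exists k, In (kap, k) (Cn n) /\ forall i q, j < i -> rn n i = Some q -> k <= rst q.
Proof.
  induction n as [n IHs] using lt_wf_ind; intros j p' kap E' M' K.
  destruct n as [ | n]; [ destruct j; discriminate | ].
  assert (IH := IHs n (le_n _)).
  pose proof E' as D. apply run_step in D. destruct D as [[E Kp] | [(_ & -> & _) | (p & E & O)]].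
  - unfold keeps in Kp. pose proof (IH j p' kap E M' K) as (k & Hk & Lk).
    assert (GEN : (forall i q, j < i -> rn (S n) i = Some q -> k <= rst q)).
    { intros i q Li Eq. apply run_step in Eq. destruct Eq as [[Eq _] | [(_ & -> & _) | (q0 & Eq & Oq)]].
      - eauto.
      - cbn. apply C_lt in Hk. lia.
      - specialize (Lk i q0 Li Eq). destruct Oq as [? ? ? _ -> | _ -> | ? _ -> | ? _ ->]; exact Lk. }
    pose proof (stage_ok_holds n) as SO.
    destruct (stage_event n) as [ | kap1 k1 | kap1 k1 i c | i | i t | i b] eqn:EV; cbn in SO.
    + destruct SO as (_ & EC & _). exists k. rewrite EC. auto.
    + destruct SO as (_ & EC & _). exists k. rewrite EC. cbn. auto.
    + destruct SO as (q & _ & _ & _ & _ & _ & _ & _ & EC & _). exists k. rewrite EC. cbn. auto.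
    + destruct SO as (q & Eq & _ & _ & _ & _ & EC & _). exists k. rewrite EC. split; trivial.
      apply filter_In. split; trivial. apply Nat.leb_le. cbn. specialize (Lk _ _ Kp Eq).
      apply rn_ok in Eq. destruct Eq. lia.
    + clear SO. destruct (act2_origin _ _ _ EV) as (q & qt & Eq & _ & _ & [_ Lt] & _ & Eqt & _ & _ & ER & S0).
      destruct (S0 n) as (_ & K' & _); [ lia | ].
      apply act2_spec in EV as EV'. destruct EV' as (_ & _ & _ & _ & _ & _ & _ & _ & _ & EC).
      destruct (IHs t ltac:(lia) j p' kap) as (k' & Hk' & Lk'); trivial.
      { now rewrite <- K'. }
      exists k'. split; [ rewrite EC; apply carry_iff; now left | ].
      intros i' q' Li' Eq'. destruct (Nat.lt_trichotomy i' i) as [Li | [-> | Li]].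
      * apply (Lk' i'); trivial. rewrite <- K' by trivial.
        rewrite <- (run_below n i i' q (act2_run n q)); trivial.
        pose proof (stage_ok_holds n) as SO. rewrite EV in SO. destruct SO as (q2 & Eq2 & _ & _ & _ & _ & _ & SO).
        rewrite (rn_trunc _ _ _ _ _ Eq2 SO), Nat.ltb_irrefl, Nat.eqb_refl. congruence.
      * specialize (Lk' i qt Li' Eqt). apply run_step in Eq'.
        destruct Eq' as [[_ Q] | [(Q & _) | (q0 & Eq0 & Oq)]].
        -- unfold keeps in Q. rewrite EV in Q. lia.
        -- congruence.
        -- assert (q0 = q) by congruence. subst.
           destruct Oq as [? ? ? _ -> | _ -> | ? _ -> | ? _ ->]; cbn; lia.
      * assert (N : rn (S n) i' = None) by (apply (run_gone n i i'); trivial; rewrite EV; easy).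
        congruence.
    + clear SO. destruct (act3_origin _ _ _ EV) as (q & t & pb & Eq & _ & Lb & _ & _ & Epb & _ & _ & ER & _ & S0 & _).
      destruct (S0 n) as (_ & K' & _); [ lia | ].
      apply act3_spec in EV as EV'. destruct EV' as (_ & _ & _ & _ & _ & _ & _ & _ & EC).
      destruct (IHs b ltac:(lia) j p' kap) as (k' & Hk' & Lk'); trivial.
      { now rewrite <- K'. }
      exists k'. split; [ rewrite EC; apply carry_iff; now left | ].
      intros i' q' Li' Eq'. destruct (Nat.lt_trichotomy i' i) as [Li | [-> | Li]].
      * apply (Lk' i'); trivial. rewrite <- K' by trivial.
        rewrite <- (run_below n i i' q (act3_run n q)); trivial.
        pose proof (stage_ok_holds n) as SO. rewrite EV in SO. destruct SO as (q2 & Eq2 & _ & _ & _ & _ & _ & SO).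
        rewrite (rn_trunc _ _ _ _ _ Eq2 SO), Nat.ltb_irrefl, Nat.eqb_refl. congruence.
      * specialize (Lk' i pb Li' Epb). apply run_step in Eq'.
        destruct Eq' as [[_ Q] | [(Q & _) | (q0 & Eq0 & Oq)]].
        -- unfold keeps in Q. rewrite EV in Q. lia.
        -- congruence.
        -- assert (q0 = q) by congruence. subst.
           destruct Oq as [? ? ? _ -> | _ -> | ? _ -> | ? _ ->]; cbn; lia.
      * assert (N : rn (S n) i' = None) by (apply (run_gone n i i'); trivial; rewrite EV; easy).
        congruence.
  - destruct K.
  - destruct O as [kap1 k1 c O -> | O -> | t O -> | b O ->]; cbn in M', K; try lia; try easy.
    destruct (letter_next _ _ _ _ _ O) as (p2 & Ep2 & _ & _ & _ & NC & EC & _).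
    assert (G : forall i q, j < i -> rn (S n) i = Some q -> False).
    { intros i q Li Eq. assert (N : rn (S n) i = None) by (apply (run_gone n j i); trivial; rewrite O; easy).
      congruence. }
    apply in_app_iff in K. rewrite EC. destruct K as [K | [<- | []]].
    + destruct (IH j p kap E M' K) as (k & Hk & _). exists k. split; [ now right | ].
      intros i q Li Eq. destruct (G i q Li Eq).
    + exists k1. split; [ now left | ]. intros i q Li Eq. destruct (G i q Li Eq).
Qed.

Definition committed (n kap t u : nat) : Prop :=
  forall d, t <= d < u -> kick kap d -> commit_before n kap d.

(** The first clause is what an [Act2] needs. The second concerns stacked words alone: it supplies,
    when a letter is added, the kicks that lie before the stage to which that letter commits, and it
    is preserved by a [Fwd] through the first clause. *)
Lemma word_committed n : forall i p, rn n i = Some p -> mode p = 0 ->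
  (forall w1 kap, prefix (w1 ++ [kap]) (word p) -> forall w t, In (w, t) (live p) ->
     prefix (w1 ++ [kap]) w -> committed n kap t n) /\
  (forall w t w' t', In (w, t) (live p) -> In (w', t') (live p) -> t <= t' ->
     forall w1 kap, prefix (w1 ++ [kap]) w -> prefix (w1 ++ [kap]) w' -> committed n kap t t').
Proof.
  induction n as [ | n IH]; intros i p' E' M'; [ destruct i; discriminate | ].
  assert (MONO : forall kap t u, committed n kap t u -> committed (S n) kap t u).
  { intros kap t u H d Hd K. apply commit_before_mono with n; auto. }
  assert (ONE : forall kap t, committed n kap t n -> ~ kick kap n -> committed (S n) kap t (S n)).
  { intros kap t H N d Hd K. destruct (Nat.eq_dec d n) as [-> | ]; [ easy | ].
    apply (MONO kap t n H); trivial. lia. }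
  assert (NK : forall kap, (forall j, stage_event n <> Fwd j) -> ~ kick kap n).
  { intros kap N (j & _ & _ & Q & _). now apply (N j). }
  pose proof E' as D. apply run_step in D. destruct D as [[E Kp] | [(_ & -> & _) | (p & E & O)]].
  - destruct (IH i p' E M') as [IH1 IH2]. split; [ | intros; eapply MONO; eauto ].
    intros w1 kap Pw w t Hw Pw'. apply ONE; [ eauto | ]. intros (j & q & k & EV & Eq & Hk & L1 & L2).
    unfold keeps in Kp. rewrite EV in Kp.
    destruct Pw as [w2 Ew]. destruct (word_ind n i p' kap E M') as (k' & Hk' & Lk').
    { rewrite Ew, <- app_assoc. apply in_elt. }
    assert (k' = k) by (eapply C_uniq; eauto). subst k'.
    specialize (Lk' j q Kp Eq). apply rn_ok in Eq. destruct Eq. lia.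
  - split; intros; easy.
  - destruct O as [kap1 k1 c O -> | O -> | t O -> | b O ->]; cbn in M'; try lia.
    + destruct (IH i p E M') as [IH1 IH2].
      assert (SUB : forall q, In q (live (letter_run kap1 c p)) -> In q (live p)).
      { cbn. intros q. destruct (c =? 0); trivial. rewrite filter_In. tauto. }
      split.
      * intros w1 kap [w2 Pw] w t Hw Pw'. cbn [word letter_run] in Pw.
        destruct w2 as [ | a w2 _] using rev_ind.
        -- rewrite app_nil_r in Pw. apply app_inj_tail in Pw. destruct Pw as [<- <-].
           pose proof (stage_ok_holds n) as SO. rewrite O in SO.
           destruct SO as (p2 & Ep2 & _ & _ & _ & _ & _ & _ & _ & _ & SO).
           assert (p2 = p) by congruence. subst p2.
           destruct c as [ | c].
           ++ exfalso. apply (SO _ (SUB _ Hw)). exact Pw'.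
           ++ destruct SO as (w' & l1 & l2 & El & Pl & _).
              cbn in Hw. apply filter_In in Hw. destruct Hw as [Hw Lw]. apply Nat.leb_le in Lw. cbn in Lw.
              assert (Hl : In (w', c) (live p)) by (rewrite El; apply in_elt).
              (* Kicks before [c] are committed because [t] and [c] are both stacked with the common
                 prefix; those from [c] on are committed by the present letter. *)
              intros d Hd Kd. destruct (Nat.lt_ge_cases d c) as [Lc | Lc].
              ** apply (MONO _ _ _ (IH2 w t w' c Hw Hl Lw (word p) kap1 Pw' Pl)); trivial. lia.
              ** assert (d <> n) by (intros ->; apply (NK kap1); [ congruence | trivial ]).
                 exists n, k1, i, c. split; [ lia | ]. split; [ lia | ]. now split.
        -- apply ONE; [ | apply NK; congruence ].
           rewrite app_assoc in Pw. apply app_inj_tail in Pw. destruct Pw as [Pw _].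
           apply (IH1 w1 kap) with w; auto. now exists w2.
      * intros; eapply MONO; eauto.
    + destruct (IH i p E M') as [IH1 IH2]. split.
      * intros w1 kap [w2 Pw]. cbn in Pw. destruct w1; discriminate.
      * intros w t w' t' [Q | Hw] [Q' | Hw'] Lt w1 kap P1 P2; apply MONO.
        -- injection Q as <- <-. injection Q' as <- <-. intros d Hd. lia.
        -- injection Q as <- <-. pose proof (ok_live _ _ (rn_ok _ _ _ E) _ _ Hw').
           pose proof (ok_pos _ _ (rn_ok _ _ _ E)). lia.
        -- injection Q' as <- <-. now apply (IH1 w1 kap) with w.
        -- now apply (IH2 w t w' t') with w1.
Qed.

(** A record of stage [s] has its use below [s], so a kick on the path to [u] would change the set
    below [s]. *)
Lemma no_kick_of_settled_entry d kap k p i : stage_event d = Fwd i -> rn d i = Some p ->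
  In (kap, k) (Cn d) -> pos p < k -> forall s u, anc s d -> anc (S d) u -> agr s u -> s <= d ->
  forall k', In (kap, k') (Cn s) -> False.
Proof.
  intros E Ep Hk Lp s u A Au H L k' Hk'.
  assert (Ad : anc d u) by (apply succ_anc; trivial; now apply parent_fwd with i).
  assert (Hd : agr s d) by now apply agr_sandwich with u.
  pose proof (persist_agr _ _ _ _ Hd A Hk') as K. assert (k' = k) by (eapply C_uniq; eauto). subst k'.
  apply C_lt in Hk'.
  apply (fresh_fwd d i p E Ep s L). apply H; [ lia | ]. apply (anc_mono _ _ Au).
  apply fwd_spec in E. destruct E as (q & Eq & _ & _ & _ & EA & _). rewrite EA. left. congruence.
Qed.

(** A kick at [d >= s] is replaced by one before [s]. If the path to [d] passes through [s] and
    [kap] is not recorded there, [last_kick] supplies it. If [S d] is on the path to [u], a record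
    at [s] would contradict the agreement. If [d] was jumped over by an [Act2], a record at [s]
    would make [kap] a letter of the repeated word, and the kick would be committed. An [Act3] is
    traced back to the [Act2] that it undoes. *)
Lemma kicked_stable s u kap : s <= u -> agr s u -> (ind s kap <-> ind u kap) ->
  forall be s0, s0 <= s -> (kicked_before u kap be s0 <-> kicked_before s kap be s0).
Proof.
  intros L H HV be s0 Ls0. pose proof (agr_anc _ _ L H) as A. split.
  2:{ intros (H1 & H2 & H3 & d & H4 & H5 & H6 & H7 & H8).
      split; [ trivial | ]. split; [ trivial | ]. split; trivial.
      exists d. split; [ lia | ]. do 3 (split; [ trivial | ]). intros Q. apply H8.
      apply (commit_stable s u kap); trivial. lia. }
  intros (H1 & H2 & H3 & d & H4 & H5 & H6 & H7 & H8).
  split; [ trivial | ]. split; [ trivial | ]. split; trivial.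
  destruct (Nat.lt_ge_cases d s) as [Ld | Ld].
  { exists d. split; [ lia | ]. do 3 (split; [ trivial | ]). intros Q. apply H8.
    now apply commit_before_mono with s. }
  assert (Lbd : be <= d) by lia. pose proof (agr_anc _ _ Lbd H6) as Abd.
  assert (AP : anc s d -> ~ ind s kap -> exists d0, s0 <= d0 < s /\ kick kap d0 /\ agr be d0 /\ anc s0 d0 /\ ~ commit_before s kap d0).
  { intros Asd N. assert (As0 : anc s0 s) by (apply anc_linear with d; trivial).
    assert (Abs : anc be s) by (apply anc_linear with d; trivial; lia).
    assert (Hbs : agr be s) by now apply agr_sandwich with d.
    destruct (last_kick s0 s As0 kap be H1 Hbs H3 N) as (d0 & K1 & K2 & K3 & K4 & K5).
    exists d0. do 2 (split; [ trivial | ]). split; [ | now split ].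
    assert (Ad0 : anc d0 s).
    { apply succ_anc; trivial. destruct K4 as (j & _ & _ & E & _). now apply parent_fwd with j. }
    apply agr_sandwich with s; trivial. apply anc_linear with s; trivial. lia. }
  destruct H5 as (j & q & k & EV & Eq & Hk & Lq & Lr).
  destruct (classic (anc (S d) u)) as [Ad | Nd].
  - assert (Asd : anc s d).
    { pose proof (anc_below s u d A Ad ltac:(lia)) as Q. now rewrite (parent_fwd _ _ EV) in Q. }
    apply AP; trivial. intros [k' Hk'].
    eapply (no_kick_of_settled_entry d kap k q j) with (s := s) (u := u); eauto.
  - destruct (cover u d ltac:(lia) Nd) as (n & K1 & K2 & [(i & t & E & Lt) | (i & b & E & Lb)]).
    + assert (d <> n) by congruence.
      assert (Ast : anc s t).
      { pose proof (anc_below s u n A K1 ltac:(lia)) as Q. now rewrite (parent_act2 _ _ _ E) in Q. }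
      pose proof (anc_le _ _ Ast) as Lst.
      destruct (act2_origin _ _ _ E) as (p & pt & F1 & F2 & F3 & F4 & F5 & F6 & F7 & F8 & F9 & F10).
      assert (Atd : anc t d).
      { destruct (Nat.eq_dec t d) as [<- | Ne]; [ constructor | ].
        apply succ_anc; [ now apply parent_fwd with i | ]. apply (since_anc _ _ _ _ d F10). lia. }
      apply AP; [ now apply anc_trans with t | ]. intros [k' Hk'].
      assert (Hst : agr s t).
      { apply agr_sandwich with u; trivial. apply anc_trans with (S n); trivial.
        constructor. rewrite (parent_act2 _ _ _ E). constructor. }
      pose proof (persist_agr _ _ _ _ Hst Ast Hk') as Ht.
      pose proof (C_lt _ _ _ Hk') as Lk'.
      apply fwd_spec in F5 as G. destruct G as (pt' & Ept' & _ & _ & _ & EA & _).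
      assert (pt' = pt) by congruence. subst pt'.
      (* The record of stage [t] must already be threatened by the [Fwd] at [t]. Any other number
         below [k'] put in before [S d] would have been pending at [S t], where strategy [i] has the
         number [t] and the lower strategies are gone. *)
      assert (LPOS : pos pt < k').
      { destruct (Nat.eq_dec t d) as [Etd | Ne].
        { subst t. assert (k' = k) by (eapply C_uniq; eauto). assert (j = i) by congruence. subst. congruence. }
        destruct (classic (same_below k' (An t) (An (S d)))) as [SB | SB].
        - exfalso. assert (Atd' : anc t (S d)) by (constructor; now rewrite (parent_fwd _ _ EV)).
          assert (Hd : In (kap, k') (Cn d)).
          { apply entry_persist with t; trivial. intros m Hm. split; [ now apply anc_mono | ].
            intros Q. apply SB; trivial. apply fwd_spec in EV. destruct EV as (? & _ & _ & _ & _ & EA' & _).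
            rewrite EA'. now right. }
          assert (k' = k) by (eapply C_uniq; eauto). subst k'.
          apply (fresh_fwd d j q EV Eq t); [ lia | ]. apply SB; trivial.
          apply fwd_spec in EV. destruct EV as (q' & Eq' & _ & _ & _ & EA' & _). rewrite EA'. left. congruence.
        - assert (EX : exists x, x < k' /\ In x (An (S d)) /\ ~ In x (An t)).
          { apply NNPP. intros N. apply SB. intros m Hm. split.
            + apply anc_mono. constructor. now rewrite (parent_fwd _ _ EV).
            + intros Q. apply NNPP. intros Q'. apply N. eauto. }
          destruct EX as (x & Lx & X1 & X2).
          assert (Atd' : anc t (S d)) by (constructor; now rewrite (parent_fwd _ _ EV)).
          destruct (classic (In x (An (S t)))) as [X3 | X3].
          { rewrite EA in X3. destruct X3 as [<- | X3]; trivial. contradiction. }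
          exfalso.
          assert (ASt : anc (S t) (S d)) by (apply (since_anc _ _ _ _ (S d) F10); lia).
          destruct (add_origin _ _ _ ASt X1 X3) as (z & i' & r & Ez & Er & -> & Az1 & Az2).
          assert (Mr : mode r = 0) by (apply (stage_mode0 z i'); auto).
          destruct (pos_back _ _ Az1 i' r Er Mr ltac:(lia)) as (r' & Er' & _ & _ & Pr').
          pose proof (anc_le _ _ Az1). pose proof (anc_le _ _ Az2).
          pose proof (since_event _ _ _ _ z F10 ltac:(lia)) as Ge. rewrite Ez in Ge.
          destruct (Nat.eq_dec i' i) as [-> | Nei].
          + pose proof (stage_ok_holds t) as SO. rewrite F5 in SO.
            destruct SO as (p2 & Ep2 & _ & _ & _ & _ & _ & SO).
            rewrite (rn_trunc _ _ _ _ _ Ep2 SO), Nat.ltb_irrefl, Nat.eqb_refl in Er'.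
            injection Er' as <-. cbn in Pr'. lia.
          + assert (N : rn (S t) i' = None) by (apply (run_gone t i i'); [ rewrite F5; easy | now rewrite F5 | lia ]).
            congruence. }
      assert (LR : kap <= rst pt).
      { destruct (Nat.eq_dec t d) as [Etd | Ne].
        { subst t. assert (j = i) by congruence. subst. congruence. }
        apply Nat.nlt_ge; intros Q.
        destruct (since_in _ _ _ _ d F10) as (pd & Epd & Md & Rd & Id); [ lia | ].
        pose proof (rst_pos_lt d be i pd Abd H6 Epd Md ltac:(lia)).
        pose proof (ok_live _ _ (rn_ok _ _ _ Epd) _ _ Id). lia. }
      (* So [kap] is in the word at [t], which the return requires to be the current word.
         [word_committed], applied to the entry [(word p, t)] itself, shows that the kick was
         committed before the return. *)
      pose proof (hurt_in_word t i pt kap k' F6 F7 Ht LPOS LR) as HW. rewrite F8 in HW.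
      apply in_split in HW. destruct HW as (w1 & w2 & HW).
      destruct (word_committed n i p F1 F2) as [WC _].
      apply H8. apply commit_before_mono with n; [ lia | ].
      assert (PW : prefix (w1 ++ [kap]) (word p)).
      { exists w2. rewrite HW. now rewrite <- app_assoc. }
      apply (WC w1 kap PW _ t F3 PW d); [ lia | ].
      exists j, q, k. auto.
    + assert (d <> n) by congruence.
      assert (Asb : anc s b).
      { pose proof (anc_below s u n A K1 ltac:(lia)) as Q. now rewrite (parent_act3 _ _ _ E) in Q. }
      pose proof (anc_le _ _ Asb) as Lsb.
      destruct (act3_origin _ _ _ E) as (p & t & pb & F1 & F2 & F3 & F4 & F5 & F6 & F7 & F8 & F9 & F9' & F10 & F11).
      assert (d <> b) by congruence.
      destruct (act2_origin _ _ _ F4) as (p' & pt & G1 & G2 & G3 & G4 & G5 & G6 & G7 & G8 & G9 & G10).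
      assert (ASb : anc (S b) d) by (apply (since_anc _ _ _ _ d F10); lia).
      assert (Atb : anc t (S b)) by (constructor; rewrite (parent_act2 _ _ _ F4); constructor).
      assert (Atd : anc t d) by now apply anc_trans with (S b).
      assert (Lst : s0 <= t).
      { assert (Q : anc s0 (S b)) by (apply anc_linear with d; trivial; lia).
        apply anc_inv in Q; [ | lia ]. rewrite (parent_act2 _ _ _ F4) in Q. now apply anc_le. }
      assert (As0t : anc s0 t) by now apply anc_linear with d.
      (* Numbers put in between the [Act2] at [b] and the kick are at least [b], so a record of
         stage [t] would survive until [d] with a use too small to be kicked. *)
      assert (Nt : ~ ind t kap).
      { intros [k' Hk']. pose proof (C_lt _ _ _ Hk') as Lk'.
        assert (NEW : forall x, In x (An (S d)) -> ~ In x (An (S b)) -> b <= x).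
        { intros x X1 X2. apply Nat.nlt_ge; intros Lx.
          assert (ASb' : anc (S b) (S d)) by (constructor; now rewrite (parent_fwd _ _ EV)).
          destruct (add_origin _ _ _ ASb' X1 X2) as (z & i' & r & Ez & Er & -> & Az1 & Az2).
          assert (Mr : mode r = 0) by (apply (stage_mode0 z i'); auto).
          destruct (pos_back _ _ Az1 i' r Er Mr ltac:(lia)) as (r' & Er' & Mr' & _ & Pr').
          pose proof (anc_le _ _ Az1). pose proof (anc_le _ _ Az2).
          pose proof (since_event _ _ _ _ z F10 ltac:(lia)) as Ge. rewrite Ez in Ge.
          destruct (since_in _ _ _ _ (S b) F10) as (p2 & Ep2 & ->); [ lia | ].
          destruct (Nat.eq_dec i' i) as [-> | Nei].
          - rewrite Er' in Ep2. injection Ep2 as ->. congruence.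
          - assert (N : rn (S b) i' = None) by (apply (run_gone b i i'); [ rewrite F4; easy | now rewrite F4 | lia ]).
            congruence. }
        assert (HSb : In (kap, k') (Cn (S b))).
        { apply act2_spec in F4. destruct F4 as (_ & _ & _ & _ & _ & _ & _ & _ & _ & EC).
          rewrite EC. apply carry_iff. now left. }
        assert (Hd : In (kap, k') (Cn d)).
        { apply entry_persist with (S b); trivial. intros m Hm. split; [ now apply anc_mono | ].
          intros Q. apply NNPP. intros Q'. assert (b <= m); [ | lia ]. apply NEW; trivial.
          apply fwd_spec in EV. destruct EV as (? & _ & _ & _ & _ & EA' & _). rewrite EA'. now right. }
        assert (k' = k) by (eapply C_uniq; eauto). subst k'.
        assert (b <= pos q); [ | lia ]. apply NEW.
        - apply fwd_spec in EV. destruct EV as (q' & Eq' & _ & _ & _ & EA' & _). rewrite EA'. left. congruence.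
        - apply (fresh_fwd d j q EV Eq). lia. }
      assert (Abt : anc be t) by (apply anc_linear with d; trivial; lia).
      assert (Hbt : agr be t) by now apply agr_sandwich with d.
      assert (ASt : anc (S t) b) by (apply (since_anc _ _ _ _ b G10); lia).
      assert (At : anc t b) by (apply succ_anc; trivial; now apply parent_fwd with i).
      (* If [t < s], the last kick before [t] serves: it stays uncommitted up to [s <= b], because
         [t] is still stacked at [b] and commitments made in between go to stages not before [t]. *)
      destruct (Nat.lt_ge_cases t s) as [Lts | Lts].
      * destruct (last_kick s0 t As0t kap be H1 Hbt H3 Nt) as (d0 & P1 & P2 & P3 & P4 & P5).
        exists d0. split; [ lia | ]. split; trivial. split.
        { assert (Ad0 : anc d0 t).
          { apply succ_anc; trivial. destruct P4 as (j' & _ & _ & E' & _). now apply parent_fwd with j'. }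
          apply agr_sandwich with t; trivial. apply anc_linear with t; trivial. lia. }
        split; trivial. intros Q.
        assert (ASts : anc (S t) s) by (apply anc_linear with b; trivial).
        assert (Ats : anc t s) by (apply succ_anc; trivial; now apply parent_fwd with i).
        apply (commit_path t) in Q; trivial; [ | lia ].
        destruct Q as [Q | (w & k1 & i1 & c & Lw & Aw & EW & Lc)]; [ easy | ].
        apply anc_le in Aw.
        pose proof (commit_ge b i _ t pb F6 F7 F8 w _ _ _ _ ltac:(lia) EW). lia.
      * assert (Ast : anc s t) by now apply anc_linear with b.
        apply AP; [ now apply anc_trans with t | ]. intros [k' Hk']. apply Nt. exists k'.
        apply (persist_agr s); trivial. apply agr_sandwich with u; trivial.
        apply anc_trans with b; trivial. apply anc_trans with (S n); trivial.
        constructor. rewrite (parent_act3 _ _ _ E). constructor.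
Qed.

(** * Good stages and the limit set *)

(** Suppose a later return of a strategy [j] ends inside the interval. A [j] below [i] would have
    been cancelled by the [Act3], and [i] itself is finished; a [j] above [i] would have cancelled
    [i] by acting inside the interval, during which [i] was only waiting. *)
Lemma act3_avoid n3 i b : stage_event n3 = Act3 i b ->
  forall u v, n3 < u -> b < v <= n3 -> ~ anc v u.
Proof.
  intros E u. induction u as [u IH] using lt_wf_ind; intros v Lu Lv A.
  destruct u as [ | m]; [ lia | ].
  destruct (act3_origin _ _ _ E) as (p & t0 & pb & F1 & F2 & F3 & F4 & F5 & F6 & F7 & F8 & F9 & F9' & F10 & F11).
  apply anc_inv in A; [ | lia ]. pose proof (anc_le _ _ A) as La. pose proof (parent_le m) as Lp.
  destruct (Nat.eq_dec m n3) as [-> | Ne].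
  { rewrite (parent_act3 _ _ _ E) in La. lia. }
  destruct (Nat.lt_ge_cases n3 (parent m)) as [G | G].
  { apply (IH (parent m) ltac:(lia) v); trivial. }
  unfold parent in *. destruct (stage_event m) as [ | | | j | j t' | j b'] eqn:EV; try lia.
  - destruct (act2_origin _ _ _ EV) as (q & qt & G1 & G2 & G3 & G4 & G5 & G6 & G7 & G8 & G9 & G10).
    assert (Ln : t' < n3) by (destruct (Nat.eq_dec t' n3); [ congruence | lia ]).
    pose proof (since_event _ _ _ _ n3 G10 ltac:(lia)) as Ge. rewrite E in Ge.
    destruct (since_in _ _ _ _ n3 G10) as (q' & Q1 & Q2 & _); [ lia | ].
    assert (j <> i) by (intros ->; congruence).
    pose proof (since_event _ _ _ _ t' F10 ltac:(lia)) as Ge2. rewrite G5 in Ge2. lia.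
  - destruct (act3_origin _ _ _ EV) as (q & t2 & qb & G1 & G2 & G3 & G4 & G5 & G6 & G7 & G8 & G9 & G9' & G10 & G11).
    assert (Ln : b' < n3) by (destruct (Nat.eq_dec b' n3); [ congruence | lia ]).
    pose proof (since_event _ _ _ _ n3 G10 ltac:(lia)) as Ge. rewrite E in Ge.
    assert (j <> i).
    { intros ->. destruct (since_in _ _ _ _ (S n3) G10) as (q' & Q1 & ->); [ lia | ].
      pose proof (stage_ok_holds n3) as SO. rewrite E in SO.
      destruct SO as (p2 & Ep2 & _ & _ & _ & _ & _ & SO).
      rewrite (rn_trunc _ _ _ _ _ Ep2 SO), Nat.ltb_irrefl, Nat.eqb_refl in Q1.
      injection Q1 as <-. discriminate. }
    pose proof (since_event _ _ _ _ b' F10 ltac:(lia)) as Ge2. rewrite G4 in Ge2. lia.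
Qed.

(** As for [act3_avoid], except that strategy [i] has one action left, the [Act3] that undoes this
    return. *)
Lemma act2_avoid n i t : stage_event n = Act2 i t ->
  forall u v, n < u -> t < v <= n -> anc v u -> exists n3 j, n3 < u /\ stage_event n3 = Act3 j n.
Proof.
  intros E u. induction u as [u IH] using lt_wf_ind; intros v Lu Lv A.
  destruct u as [ | m]; [ lia | ].
  destruct (act2_origin _ _ _ E) as (p & pt & F1 & F2 & F3 & F4 & F5 & F6 & F7 & F8 & F9 & F10).
  apply anc_inv in A; [ | lia ]. pose proof (anc_le _ _ A) as La. pose proof (parent_le m) as Lp.
  destruct (Nat.eq_dec m n) as [-> | Ne].
  { rewrite (parent_act2 _ _ _ E) in La. lia. }
  destruct (Nat.lt_ge_cases n (parent m)) as [G | G].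
  { destruct (IH (parent m) ltac:(lia) v G Lv A) as (n3 & j & K1 & K2). exists n3, j. split; [ lia | trivial ]. }
  unfold parent in *. destruct (stage_event m) as [ | | | j | j t' | j b'] eqn:EV; try lia.
  - destruct (act2_origin _ _ _ EV) as (q & qt & G1 & G2 & G3 & G4 & G5 & G6 & G7 & G8 & G9 & G10).
    assert (Ln : t' < n) by (destruct (Nat.eq_dec t' n); [ congruence | lia ]).
    pose proof (since_event _ _ _ _ n G10 ltac:(lia)) as Ge. rewrite E in Ge.
    assert (j <> i).
    { intros ->. destruct (since_in _ _ _ _ (S n) G10) as (q' & Q1 & Q2 & _); [ lia | ].
      pose proof (stage_ok_holds n) as SO. rewrite E in SO.
      destruct SO as (p2 & Ep2 & _ & _ & _ & SO1 & SO2 & SO).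
      rewrite (rn_trunc _ _ _ _ _ Ep2 SO), Nat.ltb_irrefl, Nat.eqb_refl in Q1.
      injection Q1 as <-. discriminate. }
    pose proof (since_event _ _ _ _ t' F10 ltac:(lia)) as Ge2. rewrite G5 in Ge2. lia.
  - destruct (act3_origin _ _ _ EV) as (q & t2 & qb & G1 & G2 & G3 & G4 & G5 & G6 & G7 & G8 & G9 & G9' & G10 & G11).
    destruct (Nat.eq_dec b' n) as [-> | Nb]; [ exists m, j; auto | ].
    pose proof (since_event _ _ _ _ n G10 ltac:(lia)) as Ge. rewrite E in Ge.
    assert (j <> i).
    { intros ->. destruct (since_in _ _ _ _ n G10) as (q' & Q1 & ->); [ lia | ]. congruence. }
    pose proof (since_event _ _ _ _ b' F10 ltac:(lia)) as Ge2. rewrite G4 in Ge2. lia.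
Qed.

Definition skip3 (s : nat) : Prop := exists n i b, stage_event n = Act3 i b /\ b < s <= n.
(** An [Act3] that undoes the return at [n] jumps over [S n], so [~ skip3 (S n)] guarantees that the
    return is never undone. *)
Definition skip2 (s : nat) : Prop :=
  exists n i t, stage_event n = Act2 i t /\ t < s <= n /\ ~ skip3 (S n).
Definition good (s : nat) : Prop := ~ skip3 s /\ ~ skip2 s.

Definition strong (u : nat) : Prop := forall n, u <= n -> agr u n.

Lemma strong_anc u n : strong u -> u <= n -> anc u n.
Proof. intros H L. apply agr_anc; auto. Qed.

(** If [s] is off the path, [cover] gives a return on the path that jumps over it, and a return on
    the path to a strong stage is not undone. Conversely, the two avoidance lemmas show that an
    ancestor of all late stages is not jumped over for good. *)
Lemma good_iff u s : strong u -> s <= u -> (good s <-> anc s u).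
Proof.
  intros Hu L. split.
  - intros [N3 N2]. destruct s as [ | d]; [ apply anc_0 | ].
    apply NNPP; intros N.
    destruct (cover u d L N) as (n & K1 & K2 & [(i & t & E & Lt) | (i & b & E & Lb)]).
    + assert (d <> n) by congruence. apply N2. exists n, i, t. split; trivial. split; [ lia | ].
      intros (n' & j & b' & E' & L').
      (* The stage chosen is later than both [u] and the supposed [Act3], so that [act3_avoid]
         applies. *)
      assert (A : anc (S n) (S (max n' u))).
      { apply anc_trans with u; trivial. apply strong_anc; trivial. lia. }
      revert A. apply (act3_avoid n' j b' E'); lia.
    + assert (d <> n) by congruence. apply N3. exists n, i, b. split; trivial. lia.
  - intros A. assert (AA : forall n, u <= n -> anc s n).
    { intros n Ln. apply anc_trans with u; trivial. now apply strong_anc. }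
    split.
    + intros (n & i & b & E & Lb). apply (act3_avoid n i b E (S (max n u)) s); try lia.
      apply AA; lia.
    + intros (n & i & t & E & Lt & N). destruct (act2_avoid n i t E (S (max n u)) s) as (n3 & j & K1 & K2); try lia.
      { apply AA; lia. }
      apply N. exists n3, j, n. split; trivial.
      apply act3_spec in K2. destruct K2 as (_ & _ & _ & _ & _ & _ & K2 & _). lia.
Qed.

Lemma strong_good u : strong u -> good u.
Proof. intros H. apply (good_iff u u); trivial. constructor. Qed.

Definition limA (y : nat) : Prop := exists N, forall n, N <= n -> In y (An n).

Lemma limA_strong u y : strong u -> y < u -> (limA y <-> In y (An u)).
Proof.
  intros H L. split.
  - intros [N HN]. apply (H (max N u)); try lia. apply HN; lia.
  - intros K. exists u. intros n Ln. now apply (H n Ln).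
Qed.

Section Inf.
Hypothesis inf : forall N, exists u, N <= u /\ strong u.

(** This form shows that [limA] is r.e. in the two sorts of jumped stages. *)
Lemma limA_good y : limA y <-> exists s, good s /\ In y (An s).
Proof.
  split.
  - intros H. destruct (inf (S y)) as (u & L & Hu). exists u. split; [ now apply strong_good | ].
    now apply (limA_strong u).
  - intros (s & G & K). destruct (inf (max s (S y))) as (u & L & Hu).
    apply (limA_strong u); trivial; [ lia | ].
    apply (good_iff u) in G; trivial; [ | lia ]. now apply (anc_mono s).
Qed.

(** Weaker than [strong], which quantifies over all later stages, but decidable with oracle
    [limA]. *)
Definition true_at (u : nat) : Prop := forall y, y < u -> (In y (An u) <-> limA y).

Lemma strong_true u : strong u -> true_at u.
Proof. intros H y L. symmetry. now apply limA_strong. Qed.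

Lemma true_agr s u : true_at s -> true_at u -> s <= u -> agr s u.
Proof. intros Hs Hu L m Hm. rewrite (Hs m Hm). symmetry. apply Hu. lia. Qed.

Lemma good_true u s : true_at u -> s <= u -> (good s <-> anc s u).
Proof.
  intros Hu L. destruct (inf u) as (v & Lv & Hv).
  assert (A : agr u v) by (apply true_agr; trivial; now apply strong_true).
  pose proof (agr_anc _ _ Lv A) as A'.
  rewrite (good_iff v); trivial; [ | lia ]. split; intros K.
  - now apply anc_linear with v.
  - now apply anc_trans with u.
Qed.
End Inf.

(** * Extremal numbers, prefixes and finite sets of words *)

Lemma least (P : nat -> Prop) n : P n -> exists m, P m /\ m <= n /\ forall k, k < m -> ~ P k.
Proof.
  induction n as [n IH] using lt_wf_ind; intros H.
  destruct (classic (exists k, k < n /\ P k)) as [(k & L & K) | N].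
  - destruct (IH k L K) as (m & M1 & M2 & M3). exists m. repeat split; trivial. lia.
  - exists n. repeat split; trivial. intros k L K. eauto.
Qed.

Lemma greatest (P : nat -> Prop) b n : P n -> (forall k, P k -> k <= b) ->
  exists m, P m /\ forall k, P k -> k <= m.
Proof.
  intros H B. assert (Hd : exists d, P (b - d)) by (exists (b - n); specialize (B n H);
    now replace (b - (b - n)) with n by lia).
  destruct Hd as [d Hd]. destruct (least (fun d => P (b - d)) d Hd) as (m & M1 & _ & M3).
  exists (b - m). split; trivial. intros k K. specialize (B k K).
  apply Nat.nlt_ge; intros L. apply (M3 (b - k)); [ lia | ].
  now replace (b - (b - k)) with k by lia.
Qed.

Lemma prefix_trans p q l : prefix p q -> prefix q l -> prefix p l.
Proof. intros [s ->] [t ->]. exists (s ++ t). now rewrite app_assoc. Qed.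

Lemma prefix_compare p q l : prefix p l -> prefix q l -> length p <= length q -> prefix p q.
Proof.
  intros [s ->] [t E] L. exists (firstn (length q - length p) s).
  apply (f_equal (firstn (length q))) in E.
  rewrite (firstn_app (length q) q), firstn_all, Nat.sub_diag, app_nil_r in E.
  rewrite firstn_app, (firstn_all2 p) in E by lia. now symmetry.
Qed.

Fixpoint words (r n : nat) : list (list nat) :=
  match n with
  | 0 => [[]]
  | S n => [] :: flat_map (fun a => map (cons a) (words r n)) (seq 0 (S r))
  end.

Lemma words_in r n w : length w <= n -> (forall a, In a w -> a <= r) -> In w (words r n).
Proof.
  revert w; induction n as [ | n IH]; intros [ | a w] L H.
  - cbn; auto.
  - cbn in L; lia.
  - cbn; auto.
  - right. apply in_flat_map. exists a. split.
    + apply in_seq. specialize (H a (or_introl eq_refl)). lia.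
    + apply in_map, IH; [ cbn in L; lia | ]. intros b Hb. apply H. now right.
Qed.

Lemma nodup_bounded_length w r : NoDup w -> (forall a, In a w -> a <= r) -> length w <= S r.
Proof.
  intros N H. rewrite <- (length_seq (S r) 0). apply NoDup_incl_length; trivial.
  intros a Ha. apply in_seq. specialize (H a Ha). lia.
Qed.

(** * Termination of a single strategy *)

Section Stack.
Variables (wd : nat -> list nat) (st : nat -> list (list nat)) (r : nat).

Definition idle n := wd (S n) = wd n /\ st (S n) = st n.
Definition pushes n := wd (S n) = [] /\ st (S n) = wd n :: st n /\ ~ In (wd n) (st n).
Definition appends n := exists kap, wd (S n) = wd n ++ [kap].
(** The effect of a committing letter. The clause on [l1] expresses the choice of the newest match
    and yields the contradiction in [no_high]. *)
Definition pops n := exists w l1 l2, st n = l1 ++ w :: l2 /\ st (S n) = w :: l2 /\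
    prefix (wd (S n)) w /\ forall q, In q l1 -> ~ prefix (wd (S n)) q.

Hypothesis wd_ok : forall n, NoDup (wd n) /\ forall a, In a (wd n) -> a <= r.
Hypothesis st_ok : forall n, NoDup (st n) /\ forall w, In w (st n) -> NoDup w /\ forall a, In a w -> a <= r.
Hypothesis step_ok : forall n,
  idle n \/ pushes n \/ (appends n /\ (st (S n) = st n \/ pops n)).

Let height n := length (st n).

Lemma height_bound : exists B, forall n, height n <= B.
Proof.
  exists (length (words r (S r))). intros n. destruct (st_ok n) as [N H].
  apply NoDup_incl_length; trivial. intros w Hw. destruct (H w Hw) as [Nm Bm].
  apply words_in; trivial. now apply nodup_bounded_length.
Qed.

Lemma wd_length n : length (wd n) <= S r.
Proof. destruct (wd_ok n). now apply nodup_bounded_length. Qed.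

Definition bottom (h n : nat) : list (list nat) := skipn (height n - h) (st n).

Lemma bottom_step h n : h <= height n -> h <= height (S n) -> bottom h (S n) = bottom h n.
Proof.
  unfold bottom, height. intros L L'.
  destruct (step_ok n) as [[_ E] | [(_ & E & _) | (_ & [E | (w & l1 & l2 & E1 & E2 & _)])]].
  - now rewrite E.
  - rewrite E in *. cbn [length]. now replace (S (length (st n)) - h) with (S (length (st n) - h)) by lia.
  - now rewrite E.
  - rewrite E1, E2 in *. rewrite length_app. cbn [length] in *.
    replace (length l1 + S (length l2) - h) with (length l1 + (S (length l2) - h)) by lia.
    rewrite skipn_app. rewrite (skipn_all2 l1) by lia. cbn [app]. f_equal. lia.
Qed.

Lemma bottom_const h a b : a <= b -> (forall n, a <= n <= b -> h <= height n) -> bottom h b = bottom h a.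
Proof.
  intros L. induction b as [ | b IH]; intros H; [ now replace a with 0 by lia | ].
  destruct (Nat.eq_dec a (S b)) as [-> | Ne]; trivial.
  rewrite bottom_step by (apply H; lia). apply IH; [ lia | ]. intros n Hn. apply H; lia.
Qed.

Lemma bottom_full n : bottom (height n) n = st n.
Proof. unfold bottom. now rewrite Nat.sub_diag. Qed.

Lemma height_drop n : height (S n) < height n -> appends n /\ pops n.
Proof.
  unfold height. destruct (step_ok n) as [[_ E] | [(_ & E & _) | (A & [E | P])]]; auto;
    rewrite E; cbn; lia.
Qed.

Hypothesis inf_push : forall N, exists n, N <= n /\ pushes n.

(** Downward induction on [h]. If the height stays at least [h], it equals [h] infinitely often,
    always with the same stack, and each drop to [h] leaves as current word a prefix of the top word
    [w]. Choose a drop with the longest such prefix. The next word pushed extends it, and the next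
    drop to [h] discards that word, although the new current word, being no longer than the chosen
    one, is a prefix of it. *)
Lemma no_high h : forall m, ~ forall n, m <= n -> h <= height n.
Proof.
  destruct height_bound as [B HB].
  assert (K : forall d h m, B < h + d -> ~ forall n, m <= n -> h <= height n).
  { clear h. intros d; induction d as [ | d IH]; intros h m L H.
    - specialize (H m (le_n m)). specialize (HB m). lia.
    - assert (RET : forall N, m <= N -> exists n, N <= n /\ height n = h).
      { intros N LN. apply NNPP. intros Q. apply (IH (S h) N); [ lia | ].
        intros n Ln. specialize (H n ltac:(lia)).
        destruct (Nat.eq_dec (height n) h); [ exfalso; apply Q; eauto | lia ]. }
      set (tr := fun n => m <= n /\ height (S n) = h /\ appends n /\ pops n).
      assert (NEXT : forall a, m <= a -> height a = S h -> exists n, a <= n /\ tr n /\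
                 forall k, a <= k <= n -> S h <= height k).
      { intros a La Ha. destruct (RET a La) as (b & Lb & Eb).
        destruct (least (fun k => a <= k /\ height k = h) b (conj Lb Eb)) as (c & [C1 C2] & _ & C3).
        destruct c as [ | c]; [ assert (a = 0) by lia; subst; lia | ].
        assert (a <= c) by (destruct (Nat.eq_dec a (S c)); [ subst; lia | lia ]).
        assert (HI : forall k, a <= k <= c -> S h <= height k).
        { intros k Hk. specialize (H k ltac:(lia)).
          destruct (Nat.eq_dec (height k) h); [ | lia ]. exfalso. apply (C3 k); [ lia | ]. split; [ lia | trivial ]. }
        exists c. split; trivial. split; trivial. split; [ lia | ]. split; trivial.
        apply height_drop. specialize (HI c ltac:(lia)). lia. }
      assert (TR : exists n, tr n).
      { destruct (RET m (le_n m)) as (a & La & Ea). destruct (inf_push a) as (b & Lb & Pb).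
        destruct (RET b ltac:(lia)) as (c & Lc & Ec).
        destruct (classic (exists k, a <= k /\ tr k)) as [(k & _ & K) | NT]; [ eauto | exfalso ].
        assert (GE : forall k, S b <= k -> S h <= height k).
        { intros k Lk. induction Lk as [ | k Lk IHk].
          - destruct Pb as (_ & E & _). unfold height. rewrite E. cbn.
            specialize (H b ltac:(lia)). unfold height in H. lia.
          - specialize (H (S k) ltac:(lia)).
            destruct (Nat.eq_dec (height (S k)) h) as [Q | Q]; [ | lia ]. exfalso. apply NT.
            exists k. split; [ lia | ]. split; [ lia | ]. split; trivial. apply height_drop. lia. }
        destruct (RET (S b) ltac:(lia)) as (c' & Lc' & Ec'). specialize (GE c' Lc'). lia. }
      assert (MAX : exists t, tr t /\ forall t', tr t' -> length (wd (S t')) <= length (wd (S t))).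
      { destruct TR as [n0 T0].
        destruct (greatest (fun l => exists n, tr n /\ length (wd (S n)) = l) (S r) (length (wd (S n0))))
          as (l & (t & T1 & T2) & T3).
        - eauto.
        - intros k (n & _ & <-). apply wd_length.
        - exists t. split; trivial. intros t' T'. rewrite T2. apply T3. eauto. }
      destruct MAX as (t & (T1 & T2 & T3 & (w & l1 & l2 & T4 & T5 & T6 & T7)) & TM).
      destruct (inf_push (S t)) as (p0 & Lp0 & P0).
      destruct (least (fun k => S t <= k /\ pushes k) p0 (conj Lp0 P0)) as (p & [Lp P] & _ & Pmin).
      assert (UP : forall k, S t <= k <= p -> prefix (wd (S t)) (wd k) /\ height k = h).
      { intros k. induction k as [ | k IHk]; intros Hk; [ lia | ].
        destruct (Nat.eq_dec k t) as [-> | Ne].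
        - split; trivial. exists []. now rewrite app_nil_r.
        - destruct (IHk ltac:(lia)) as [K1 K2]. specialize (H (S k) ltac:(lia)).
          destruct (step_ok k) as [[E1 E2] | [PK | ([kap E1] & [E2 | (w' & m1 & m2 & E2 & E3 & _)])]].
          + unfold height. rewrite E1, E2. now split.
          + exfalso. apply (Pmin k); [ lia | ]. split; [ lia | trivial ].
          + unfold height. rewrite E1, E2. split; trivial. apply prefix_trans with (wd k); trivial.
            now exists [kap].
          + rewrite E1. split.
            * apply prefix_trans with (wd k); trivial. now exists [kap].
            * unfold height in *. rewrite E2, length_app in K2. rewrite E3 in *. cbn in *. lia. }
      destruct (UP p ltac:(lia)) as [UP1 UP2].
      destruct P as (P1 & P2 & P3).
      assert (HP : height (S p) = S h) by (unfold height in *; rewrite P2; cbn; lia).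
      destruct (NEXT (S p) ltac:(lia) HP) as (q & Lq & TQ & HQ).
      pose proof (TM q TQ) as TMq.
      destruct TQ as (Q1 & Q2 & Q3 & (w' & m1 & m2 & Q4 & Q5 & Q6 & Q7)).
      assert (B1 : bottom (S h) q = wd p :: st p).
      { rewrite (bottom_const (S h) (S p) q) by trivial. rewrite <- HP, bottom_full. exact P2. }
      assert (B2 : bottom h (S q) = bottom h (S t)).
      { apply bottom_const; [ lia | ]. intros n Hn. apply H. lia. }
      assert (EW : w' :: m2 = w :: l2).
      { rewrite <- Q5, <- T5. rewrite <- (bottom_full (S q)), <- (bottom_full (S t)). now rewrite Q2, T2. }
      injection EW as -> ->.
      assert (B3 : bottom h p = w :: l2).
      { rewrite (bottom_const h (S t) p) by (trivial; intros n Hn; apply H; lia).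
        rewrite <- T2, bottom_full. exact T5. }
      assert (B4 : st p = w :: l2) by (rewrite <- UP2, bottom_full in B3; exact B3).
      (* The word pushed at [p] lies directly above the lowest [h] entries, so the drop at [q] to
         height [h] discards it. *)
      assert (IN : In (wd p) m1).
      { unfold bottom in B1. unfold height in B1, Q2. rewrite Q4 in B1. rewrite Q5 in Q2. cbn in Q2.
        rewrite B4 in B1. rewrite length_app in B1. cbn [length] in B1.
        replace (length m1 + S (length l2) - S h) with (length m1 - 1) in B1 by lia.
        rewrite skipn_app in B1. replace (length m1 - 1 - length m1) with 0 in B1 by lia.
        cbn [skipn] in B1. change (wd p :: w :: l2) with ([wd p] ++ w :: l2) in B1.
        apply app_inv_tail in B1. rewrite <- (firstn_skipn (length m1 - 1) m1). apply in_app_iff.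
        right. rewrite B1. now left. }
      (* [wd (S q)] and [wd (S t)] are prefixes of the same [w], and by the choice of [t] the former
         is not longer. *)
      apply (Q7 _ IN). apply prefix_trans with (wd (S t)); trivial.
      apply prefix_compare with w; trivial. }
  intros m. apply (K (S B) h m). lia.
Qed.
End Stack.

(** [no_high] at height 0 excludes infinitely many pushes. After the last push every step that is
    not idle lengthens the current word, whose length is bounded. *)
Lemma stack_terminates wd st r :
  (forall n, NoDup (wd n) /\ forall a, In a (wd n) -> a <= r) ->
  (forall n, NoDup (st n) /\ forall w, In w (st n) -> NoDup w /\ forall a, In a w -> a <= r) ->
  (forall n, idle wd st n \/ pushes wd st n \/ (appends wd n /\ (st (S n) = st n \/ pops wd st n))) ->
  exists N, forall n, N <= n -> idle wd st n.
Proof.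
  intros H1 H2 H3.
  assert (FP : exists N, forall n, N <= n -> ~ pushes wd st n).
  { apply NNPP. intros Q. apply (no_high wd st r H1 H2 H3) with (h := 0) (m := 0); [ | lia ].
    intros N. apply NNPP. intros Q'. apply Q. exists N. intros n L P. apply Q'. eauto. }
  destruct FP as [N HN].
  assert (MON : forall n, N <= n -> length (wd n) <= length (wd (S n)) /\
             (idle wd st n \/ length (wd n) < length (wd (S n)))).
  { intros n L. destruct (H3 n) as [I | [P | ([kap E] & _)]].
    - destruct I as [E1 E2]. rewrite E1. split; trivial. left. now split.
    - now apply HN in P.
    - rewrite E, length_app. cbn. split; [ lia | right; lia ]. }
  assert (MON2 : forall a b, N <= a -> a <= b -> length (wd a) <= length (wd b)).
  { intros a b La L. induction L as [ | b L IH]; trivial.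
    destruct (MON b ltac:(lia)). lia. }
  destruct (greatest (fun l => exists n, N <= n /\ length (wd n) = l) (S r) (length (wd N)))
    as (l & (t & T1 & T2) & T3).
  - eauto.
  - intros k (n & _ & <-). destruct (H1 n). now apply nodup_bounded_length.
  - exists t. intros n L. destruct (MON n ltac:(lia)) as [_ [I | Lt]]; trivial. exfalso.
    specialize (MON2 t n T1 L). specialize (T3 _ (ex_intro _ (S n) (conj (le_S _ _ (Nat.le_trans _ _ _ T1 L)) eq_refl))).
    lia.
Qed.

(** No letter is repeated, because by [word_ind] the letters of a word are recorded, while a new
    letter is not recorded when it arrives. *)
Lemma word_ok n : forall i p, rn n i = Some p -> mode p = 0 ->
  NoDup (word p) /\ forall a, In a (word p) -> a <= rst p.
Proof.
  induction n as [ | n IH]; intros i p' E' M'; [ destruct i; discriminate | ].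
  apply run_step in E'. destruct E' as [[E K] | [(_ & -> & _) | (p & E & O)]].
  - eauto.
  - split; [ constructor | easy ].
  - destruct O as [kap k c O -> | O -> | t O -> | b O ->]; cbn in M' |- *; try lia.
    + destruct (letter_next _ _ _ _ _ O) as (q & Eq & _ & Kr & _ & NC & _).
      assert (q = p) by congruence. subst q. destruct (IH i p E M') as [N B]. split.
      * apply NoDup_app; trivial; [ constructor; [ easy | constructor ] | ].
        intros a Ha [<- | []]. destruct NC as [NC _]. apply NC.
        destruct (word_ind n i p kap E M' Ha) as (k' & Hk & _). now exists k'.
      * intros a Ha. apply in_app_iff in Ha. destruct Ha as [Ha | [<- | []]]; auto.
    + split; [ constructor | easy ].
Qed.

Lemma map_filter_nodup {S T} (f : S -> T) g l : NoDup (map f l) -> NoDup (map f (filter g l)).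
Proof.
  induction l as [ | a l IH]; cbn; trivial. intros H. inversion H as [ | ? ? N1 N2]; subst.
  destruct (g a); auto. cbn. constructor; auto. intros K. apply N1.
  apply in_map_iff in K. destruct K as (b & <- & Hb). apply filter_In in Hb. now apply in_map.
Qed.

Lemma live_nodup n : forall i p, rn n i = Some p -> NoDup (map fst (live p)).
Proof.
  induction n as [ | n IH]; intros i p' E'; [ destruct i; discriminate | ].
  apply run_step in E'. destruct E' as [[E K] | [(_ & -> & _) | (p & E & O)]].
  - eauto.
  - constructor.
  - destruct O as [kap k c O -> | O -> | t O -> | b O ->]; cbn; eauto.
    + destruct (c =? 0); eauto. apply map_filter_nodup; eauto.
    + constructor; eauto. apply fwd_spec in O. destruct O as (q & Eq & _ & _ & N & _).
      intros K. apply in_map_iff in K. destruct K as (x & Ex & Hx). apply (N x); congruence.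
Qed.

Lemma filter_sorted_live (l1 l2 : list (list nat * nat)) w t :
  StronglySorted (fun a b => snd b < snd a) (l1 ++ (w, t) :: l2) ->
  filter (fun q => snd q <=? t) (l1 ++ (w, t) :: l2) = (w, t) :: l2.
Proof.
  intros H. induction l1 as [ | a l1 IH]; cbn.
  - rewrite Nat.leb_refl. f_equal. apply StronglySorted_inv in H. destruct H as [_ H].
    rewrite Forall_forall in H. induction l2 as [ | b l2 IH]; cbn; trivial.
    assert (Hb : snd b < t) by (apply H; now left).
    destruct (Nat.leb_spec (snd b) t); [ | lia ]. f_equal. apply IH. intros x Hx. apply H. now right.
  - apply StronglySorted_inv in H. destruct H as [H1 H2]. rewrite Forall_forall in H2.
    specialize (H2 (w, t) (in_elt _ _ _)). cbn in H2.
    destruct (Nat.leb_spec (snd a) t); [ lia | ]. now apply IH.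
Qed.

Definition stable (i m : nat) : Prop := (exists p, rn m i = Some p) /\ forall n, m <= n -> keeps n i.

Lemma stable_run i m p : stable i m -> rn m i = Some p -> forall n, m <= n -> rn n i = Some p.
Proof. intros [_ K] E n L. induction L as [ | n L IH]; trivial. apply run_keep; auto. Qed.

Lemma run_next n i p : rn n i = Some p -> (forall j, j < i -> keeps n j) ->
  keeps n i \/ exists p', rn (S n) i = Some p' /\ own n i p p'.
Proof.
  intros E K. destruct (classic (keeps n i)) as [ | N]; [ now left | right ].
  assert (X : exists p', rn (S n) i = Some p').
  { pose proof (stage_ok_holds n) as SO. unfold keeps in *.
    assert (G : forall j R q, rn n j = Some q -> ~ i < j -> (forall i', i' < i -> i' < j) ->
              Rn (S n) = trunc j (Rn n) R -> exists p', rn (S n) i = Some p').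
    { intros j R q Eq N' K' ER. assert (j = i).
      { destruct (Nat.lt_trichotomy j i) as [Lj | [ | ]]; [ | trivial | lia ]. specialize (K' j Lj). lia. }
      subst j. exists R. rewrite (rn_trunc _ _ _ _ _ Eq ER), Nat.ltb_irrefl, Nat.eqb_refl. trivial. }
    destruct (stage_event n) as [ | kap1 k1 | kap1 k1 j c | j | j t | j b]; try easy; cbn in SO.
    - destruct SO as (q & Eq & SO). destruct SO as (_ & _ & _ & _ & _ & _ & _ & SO & _). eapply G; eauto.
    - destruct SO as (q & Eq & _ & _ & _ & _ & _ & SO). eapply G; eauto.
    - destruct SO as (q & Eq & _ & _ & _ & _ & _ & SO). eapply G; eauto.
    - destruct SO as (q & Eq & _ & _ & _ & _ & _ & SO). eapply G; eauto. }
  destruct X as [p' E']. exists p'. split; trivial. apply run_step in E'.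
  destruct E' as [[_ Q] | [(Q & _) | (q & Eq & O)]]; [ contradiction | | ].
  - exfalso. apply N. unfold keeps. now rewrite Q.
  - congruence.
Qed.

Lemma keeps_all_present n i p : rn n i = Some p -> (forall j, j < i -> keeps n j) -> exists p', rn (S n) i = Some p'.
Proof.
  intros E K. destruct (run_next n i p E K) as [Q | (p' & Q & _)]; eauto.
  exists p. now apply run_keep.
Qed.

Lemma infinitely_many_looks q N : exists n, N <= n /\ pi1 n = q.
Proof. exists (pair q N). rewrite pi1_pair. split; trivial. apply pair_bound. Qed.


Lemma push_when_missing n i : pi1 n = pair 1 i -> rn n i = None -> stage_event n = Push.
Proof.
  intros Q E. change (stage_event n) with (ev n (St n)). unfold ev, ev_run.
  rewrite Q, pi1_pair, pi2_pair. cbn. unfold rn, Rn in E. now rewrite E.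
Qed.

(** Finite injury: once the higher strategies are stable, strategy [i] gets started and is never
    cancelled. Its mode becomes constant, and as long as it acts in mode 0 its word and its list
    form a system as in [stack_terminates]. *)
Lemma stable_exists i : exists m, stable i m.
Proof.
  induction i as [i IHi] using lt_wf_ind.
  assert (LOW : exists m0, forall j n, j < i -> m0 <= n -> keeps n j /\ exists q, rn n j = Some q).
  { destruct i as [ | i]; [ exists 0; lia | ].
    destruct (IHi i (le_n _)) as [m Hm]. exists m. intros j n Lj Ln. split.
    - apply keeps_lt with i; [ lia | now apply Hm ].
    - destruct Hm as [[q Eq] Hm]. pose proof (stable_run i m q (conj (ex_intro _ q Eq) Hm) Eq n Ln) as E.
      destruct (Nat.eq_dec j i) as [-> | ]; [ eauto | ]. apply (rn_lt n j i q); trivial. lia. }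
  destruct LOW as [m0 LOW].
  assert (APP : exists m1 p, m0 <= m1 /\ rn m1 i = Some p).
  { destruct (infinitely_many_looks (pair 1 i) m0) as (n & Ln & Qn).
    destruct (rn n i) as [p | ] eqn:E; [ eauto | ].
    pose proof (push_when_missing n i Qn E) as EV.
    pose proof (stage_ok_holds n) as SO. rewrite EV in SO. destruct SO as (_ & _ & SO).
    exists (S n), (new_run n). split; [ lia | ]. unfold rn in *. rewrite SO.
    apply nth_error_None in E.
    assert (LEN : length (Rn n) = i).
    { destruct (Nat.eq_dec (length (Rn n)) i) as [ | Ne]; trivial. exfalso.
      destruct (LOW (length (Rn n)) n ltac:(lia) Ln) as [_ [q Eq]]. unfold rn in Eq.
      assert (nth_error (Rn n) (length (Rn n)) <> None) by congruence.
      apply nth_error_Some in H. lia. }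
    rewrite nth_error_app2 by lia. now rewrite LEN, Nat.sub_diag. }
  destruct APP as (m1 & p1 & L1 & E1).
  assert (EX : forall n, m1 <= n -> exists p, rn n i = Some p).
  { intros n L. induction L as [ | n L [p IH]]; [ eauto | ].
    apply (keeps_all_present n i p IH). intros j Lj. apply LOW; trivial. lia. }
  assert (NEXT : forall n, m1 <= n -> forall p, rn n i = Some p -> keeps n i \/ exists p', rn (S n) i = Some p' /\ own n i p p').
  { intros n L p E. apply run_next; trivial. intros j Lj. apply LOW; trivial. lia. }
  (* [Act2] and [Act3] raise the mode, which is at most 2; after the maximal mode is reached the
     strategy can act only in mode 0, by letters and [Fwd]. *)
  assert (MODE : exists m2, m1 <= m2 /\ (forall n, m2 <= n -> forall p p', own n i p p' ->
      rn n i = Some p -> mode p = 0 /\ mode p' = 0)).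
  { assert (GR : forall n p p', rn n i = Some p -> own n i p p' -> (mode p = 0 /\ mode p' = 0) \/ mode p < mode p').
    { intros n p p' E [kap k c O -> | O -> | t O -> | b O ->].
      - left. split; cbn; apply (stage_mode0 n i p E); eauto.
      - left. split; cbn; apply (stage_mode0 n i p E); eauto.
      - right. cbn. assert (mode p = 0) by (apply (stage_mode0 n i p E); eauto). lia.
      - right. cbn. apply act3_spec in O. destruct O as (q & Eq & M & _).
        assert (q = p) by congruence. subst. lia. }
    destruct (greatest (fun d => exists n p, m1 <= n /\ rn n i = Some p /\ mode p = d) 2 (mode p1)) as (d & (n & p & Ln & En & Md) & Dm).
    - eauto 6.
    - intros k (n & p & _ & E & <-). apply rn_ok in E. apply E.
    - exists n. split; trivial.
      assert (CONST : forall n', n <= n' -> forall q, rn n' i = Some q -> mode q = d).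
      { intros n' L. induction L as [ | n' L IH]; intros q Eq; [ congruence | ].
        destruct (EX n' ltac:(lia)) as [q0 Eq0]. specialize (IH q0 Eq0).
        apply Nat.le_antisymm; [ apply Dm; exists (S n'), q; split; [ lia | now split ] | ].
        destruct (NEXT n' ltac:(lia) q0 Eq0) as [K | (q' & Eq' & O)].
        - pose proof (run_keep _ _ _ K Eq0). assert (q = q0) by congruence. subst. lia.
        - assert (q' = q) by congruence. subst q'. destruct (GR n' q0 q Eq0 O); lia. }
      intros n' L q q' O Eq. destruct (GR n' q q' Eq O) as [ | Lt]; trivial. exfalso.
      destruct (EX (S n') ltac:(lia)) as [q2 Eq2].
      destruct (NEXT n' ltac:(lia) q Eq) as [K | (q3 & Eq3 & O3)].
      + pose proof (own_keeps n' i i q q' O). unfold keeps in K.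
        destruct O as [kap k c O _ | O _ | t O _ | b O _]; rewrite O in K; lia.
      + assert (q3 = q').
        { destruct O as [kap k c O -> | O -> | t O -> | b O ->], O3 as [kap' k' c' O' -> | O' -> | t' O' -> | b' O' ->]; congruence. }
        subst q3. pose proof (CONST n' L q Eq). pose proof (CONST (S n') ltac:(lia) q' Eq3). lia. }
  destruct MODE as (m2 & L2 & MODE).
  destruct (classic (exists n p p', m2 <= n /\ rn n i = Some p /\ own n i p p')) as [(n0 & p0 & p0' & Ln0 & En0 & O0) | NO].
  2:{ exists m2. split; [ apply EX; lia | ]. intros n L. destruct (EX n ltac:(lia)) as [p E].
      destruct (NEXT n ltac:(lia) p E) as [ | (p' & E' & O)]; trivial. exfalso. apply NO. eauto 6. }
  destruct (MODE n0 Ln0 p0 p0' O0 En0) as [M0 _].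
  assert (ALL : forall n, n0 <= n -> exists p, rn n i = Some p /\ mode p = 0 /\ rst p = rst p0).
  { intros n L. induction L as [ | n L (p & E & M & R)]; [ eauto | ].
    destruct (NEXT n ltac:(lia) p E) as [K | (p' & E' & O)].
    - exists p. split; [ now apply run_keep | auto ].
    - exists p'. split; trivial. destruct (MODE n ltac:(lia) p p' O E) as [_ M']. split; trivial.
      destruct O as [kap k c O -> | O -> | t O -> | b O ->]; trivial. }
  (* Shifted by [n0] so that the abstract system starts at 0; by [ALL] the default [p0] never stands
     for a missing strategy. *)
  set (f := fun n => match rn (n0 + n) i with Some p => p | None => p0 end).
  assert (F : forall n, rn (n0 + n) i = Some (f n) /\ mode (f n) = 0 /\ rst (f n) = rst p0).
  { intros n. destruct (ALL (n0 + n) ltac:(lia)) as (p & E & K). unfold f. rewrite E. auto. }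
  assert (STEP : forall n, keeps (n0 + n) i /\ f (S n) = f n \/ own (n0 + n) i (f n) (f (S n))).
  { intros n. destruct (F n) as (E & _). destruct (F (S n)) as (E' & _). rewrite Nat.add_succ_r in E'.
    destruct (NEXT (n0 + n) ltac:(lia) _ E) as [K | (p' & E2 & O)].
    - left. split; trivial. apply run_keep in E; trivial. congruence.
    - right. congruence. }
  destruct (stack_terminates (fun n => word (f n)) (fun n => map fst (live (f n))) (rst p0)) as [N HN].
  - intros n. destruct (F n) as (E & M & R). rewrite <- R. now apply (word_ok (n0 + n) i).
  - intros n. destruct (F n) as (E & M & R). split; [ now apply (live_nodup (n0 + n) i) | ].
    intros w Hw. apply in_map_iff in Hw. destruct Hw as ([w' t] & <- & Hw). cbn.
    destruct (live_origin _ _ _ _ _ E M Hw) as (pt & G1 & G2 & G3 & <- & G4).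
    pose proof (ok_live _ _ (rn_ok _ _ _ E) _ _ Hw). pose proof (ok_pos _ _ (rn_ok _ _ _ E)).
    destruct (since_in _ _ _ _ (n0 + n) G4) as (q & Eq & _ & RR & _); [ lia | ].
    assert (q = f n) by congruence. subst q. rewrite <- R, RR. now apply (word_ok t i).
  - intros n. destruct (F n) as (E & M & R). destruct (F (S n)) as (E' & M' & R').
    destruct (STEP n) as [[_ Q] | O].
    + left. unfold idle. now rewrite Q.
    + destruct O as [kap k c O Q | O Q | t O Q | b O Q].
      * right; right. split; [ exists kap; now rewrite Q | ].
        pose proof (stage_ok_holds (n0 + n)) as SO. rewrite O in SO.
        destruct SO as (p & Ep & _ & _ & _ & _ & _ & _ & _ & _ & SO).
        assert (p = f n) by congruence. subst p. rewrite Q. destruct c as [ | c]; [ now left | right ].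
        destruct SO as (w & l1 & l2 & El & Pw & NP).
        pose proof (ok_sorted _ _ (rn_ok _ _ _ E)) as SS. rewrite El in SS.
        apply filter_sorted_live in SS.
        exists w, (map fst l1), (map fst l2). rewrite El, map_app. split; trivial. rewrite Q.
        cbn [letter_run live Nat.eqb pred word]. rewrite El. split; [ now rewrite SS | ]. split; trivial.
        intros q Hq. apply in_map_iff in Hq. destruct Hq as (x & <- & Hx). now apply NP.
      * right; left. unfold pushes. rewrite Q. cbn. repeat split.
        apply fwd_spec in O. destruct O as (q & Eq & _ & _ & NN & _).
        assert (q = f n) by congruence. subst q.
        intros K. apply in_map_iff in K. destruct K as (x & Ex & Hx). now apply (NN x).
      * rewrite Q in M'. discriminate.
      * rewrite Q in M'. discriminate.
  - exists (n0 + N). split; [ apply EX; lia | ]. intros n L.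
    replace n with (n0 + (n - n0)) by lia. destruct (STEP (n - n0)) as [[K _] | O]; trivial. exfalso.
    destruct (HN (n - n0) ltac:(lia)) as [I1 I2]. destruct (F (n - n0)) as (E & M & R).
    destruct (F (S (n - n0))) as (_ & M' & _).
    destruct O as [kap k c O Q | O Q | t O Q | b O Q]; rewrite Q in *; cbn in I1, I2, M'; try discriminate.
    + apply (f_equal (@length nat)) in I1. rewrite length_app in I1. cbn in I1. lia.
    + apply (f_equal (@length _)) in I2. cbn in I2. lia.
Qed.

(** * Stages after which small numbers are left alone *)

Definition cut (i m : nat) : Prop := stable i m /\ rn m (S i) = None.

Lemma index_le_rst n i : forall p, rn n i = Some p -> i <= rst p.
Proof.
  induction i as [ | i IH]; intros p E; [ lia | ].
  destruct (rn_lt n i (S i) p ltac:(lia) E) as [q Eq].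
  pose proof (pos_lt_rst n i (S i) q p ltac:(lia) Eq E). specialize (IH q Eq).
  apply rn_ok in Eq. destruct Eq. lia.
Qed.

(** The least stage from which [i] is stable will do: the step leading to it starts strategy [i] or
    is an action of it, and in both cases no lower strategy is left. *)
Lemma cut_exists i : exists m, i <= m /\ cut i m.
Proof.
  destruct (stable_exists i) as [m0 H0]. destruct (least (stable i) m0 H0) as (m & Hm & _ & Min).
  exists m. destruct Hm as [[p E] K]. split.
  - pose proof (index_le_rst m i p E). apply rn_ok in E. destruct E. lia.
  - split; [ split; eauto | ]. destruct m as [ | n]; [ now destruct i | ].
    assert (NS := Min n (le_n _)).
    pose proof E as E'. apply run_step in E'. destruct E' as [[E' Kn] | [(EV & -> & Lt) | (q & E' & O)]].
    + exfalso. apply NS. split; [ eauto | ]. intros n' L.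
      destruct (Nat.eq_dec n' n) as [-> | ]; trivial. apply K. lia.
    + destruct (rn (S n) (S i)) as [q | ] eqn:Q; trivial. exfalso.
      apply run_step in Q. destruct Q as [[Q _] | [(_ & -> & Q) | (q0 & Q & _)]].
      * assert (S i < i) by (apply Lt; eauto). lia.
      * destruct (proj1 (Q i) ltac:(lia)) as [q0 Q0].
        assert (i < i) by (apply Lt; eauto). lia.
      * assert (S i < i) by (apply Lt; eauto). lia.
    + destruct O as [kap k c O _ | O _ | t O _ | b O _]; apply (run_gone n i (S i)); rewrite ?O; easy || lia.
Qed.

Section Cut.
Variables (i m : nat).
Hypothesis C : cut i m.

Lemma cut_rst n : m <= n -> forall j q, i < j -> rn n j = Some q -> m <= rst q.
Proof.
  destruct C as [_ N]. intros L. induction L as [ | n L IH]; intros j q Lj E.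
  - exfalso. destruct (Nat.eq_dec j (S i)) as [-> | ]; [ congruence | ].
    destruct (rn_lt m (S i) j q ltac:(lia) E) as [q' E']. congruence.
  - apply run_step in E. destruct E as [[E _] | [(_ & -> & _) | (q0 & E & O)]].
    + eauto.
    + cbn. lia.
    + specialize (IH j q0 Lj E).
      destruct O as [? ? ? _ -> | _ -> | ? _ -> | ? _ ->]; exact IH.
Qed.

Lemma cut_event n : m <= n ->
  m <= parent n /\
  (forall j p, stage_event n = Fwd j -> rn n j = Some p -> m <= pos p) /\
  (forall kap k j c, stage_event n = Letter kap k j c -> m < k).
Proof.
  intros L. pose proof (cut_rst n L) as R. destruct C as [[_ K] _]. specialize (K n L). unfold keeps, parent in *.
  destruct (stage_event n) as [ | kap k | kap k j c | j | j t | j b] eqn:EV; repeat split; try easy.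
  - intros kap' k' j' c' [= <- <- <- <-].
    destruct (letter_next _ _ _ _ _ EV) as (p & E & _ & _ & Lp & _).
    specialize (R j p K E). apply rn_ok in E. destruct E. lia.
  - intros j' p [= <-] E. specialize (R j p K E). apply rn_ok in E. destruct E. lia.
  - apply act2_spec in EV. destruct EV as (p & E & _ & _ & _ & Lt & _). specialize (R j p K E). lia.
  - apply act3_spec in EV. destruct EV as (p & E & _ & _ & _ & Lt & _). specialize (R j p K E).
    apply rn_ok in E. destruct E. lia.
Qed.

Lemma cut_strong : strong m.
Proof.
  intros n. induction n as [n IH] using lt_wf_ind. intros L.
  destruct (Nat.eq_dec m n) as [-> | Ne]; [ intros y Hy; easy | ].
  destruct n as [ | n]; [ lia | ]. destruct (cut_event n ltac:(lia)) as (P1 & P2 & _).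
  pose proof (parent_le n).
  assert (Q : agr m (parent n)) by (apply IH; lia).
  destruct (stage_growth n) as [E EA _ _ | kap' k' E EA _ _ _ | j p E EE Ep _ EA _ | t E _ EA _];
    intros y Hy; rewrite EA; rewrite E in Q; try (now apply Q).
  specialize (P2 j p EE Ep). specialize (Q y Hy). cbn. intuition lia.
Qed.
End Cut.

Lemma cut_inf N : exists i u, N <= i /\ N <= u /\ cut i u.
Proof. destruct (cut_exists N) as (m & L & C). exists N, m. auto. Qed.

Lemma strong_inf N : exists u, N <= u /\ strong u.
Proof. destruct (cut_inf N) as (i & u & _ & L & C). exists u. split; trivial. now apply cut_strong with i. Qed.

(** * Recorded computations and computations from the limit *)

(** Halting with oracle [limA], expressed by a use so that it can be compared with the records. *)
Definition limW (kap : nat) : Prop :=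
  exists k, forall L, agree_below k L limA -> hcomp kap k L = true.

Lemma true_ind_limW v kap : true_at v -> ind v kap -> limW kap.
Proof.
  intros T [k Hk]. exists k. intros L HL.
  apply hcomp_same with (A := An v); [ | now apply (so_sound _ (state_ok_holds v)) ].
  apply C_lt in Hk. intros x Hx. rewrite (T x) by lia. symmetry. now apply HL.
Qed.

Lemma enters n kap k0 : pi1 n = pair 0 kap -> ~ ind n kap -> k0 <= n -> hcomp kap k0 (An n) = true ->
  exists k, k <= k0 /\ (stage_event n = Enter kap k \/ exists j c, stage_event n = Letter kap k j c).
Proof.
  intros Q NI L H.
  assert (EV : stage_event n = ev_enter n kap (St n)).
  { change (stage_event n) with (ev n (St n)). unfold ev. now rewrite Q, pi1_pair, pi2_pair. }
  unfold ev_enter in EV.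
  destruct (existsb _ _) eqn:X1.
  { exfalso. apply NI. apply existsb_exists in X1. destruct X1 as ([a b] & K & E).
    apply Nat.eqb_eq in E. cbn in E. subst. now exists b. }
  destruct (find _ _) as [k | ] eqn:X2.
  - apply find_seq in X2. destruct X2 as (_ & _ & M). exists k. split.
    { apply Nat.nlt_ge; intros Q'. specialize (M k0 Q'). unfold An in H. congruence. }
    unfold ev_enter1 in EV. destruct (find _ (seq 0 (length _))) as [j | ] eqn:X3; [ | auto ].
    apply find_seq in X3. destruct X3 as (_ & X3 & _). unfold letters in X3.
    destruct (nth_error (stR (St n)) j) as [p | ]; [ | discriminate ].
    right. exists j. unfold ev_letter in EV. destruct (find _ (live p)); eauto.
  - exfalso. pose proof (find_none _ _ X2 k0) as N. unfold An in H. rewrite N in H; [ discriminate | ].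
    apply in_seq. lia.
Qed.

(** Suppose not, and take a cut stage [u] beyond the true use [k0]. New records of [kap] have the
    least possible use, at most [k0 < u], and nothing after [u] changes the set below [u]. So the
    record, once made, stays, and returns preserve it by [carry]. *)
Lemma limW_inf kap : limW kap -> forall N, exists v, N <= v /\ strong v /\ ind v kap.
Proof.
  intros [k0 H0] N. apply NNPP. intros NO.
  destruct (cut_inf (max N (S k0))) as (i & u & _ & Lu & C).
  pose proof (cut_strong i u C) as Su.
  assert (NI : ~ ind u kap) by (intros K; apply NO; exists u; split; [ lia | auto ]).
  assert (AG : forall n, u <= n -> agree_below k0 (An n) limA).
  { intros n L y Hy. rewrite (limA_strong u y Su) by lia. symmetry. apply Su; trivial. lia. }
  assert (NEWK : forall n k, u <= n -> new_comp n kap k -> k <= k0).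
  { intros n k L (_ & _ & _ & M). apply Nat.nlt_ge; intros Q. specialize (M k0 Q).
    rewrite H0 in M; [ discriminate | now apply AG ]. }
  assert (SMALL : forall n, u <= n -> forall k, In (kap, k) (Cn n) -> k <= k0).
  { intros n. induction n as [n IH] using lt_wf_ind; intros L k Hk.
    destruct (Nat.eq_dec u n) as [-> | Ne]; [ destruct NI; now exists k | ].
    destruct n as [ | n]; [ lia | ]. destruct (cut_event i u C n ltac:(lia)) as (P1 & _).
    destruct (stage_growth n) as [E _ EC _ | kap' k' E _ EC NC _ | j p E EE Ep _ _ EC | t E Lt _ EC];
      rewrite EC in Hk.
    - apply (IH n); trivial; lia.
    - destruct Hk as [[= -> ->] | Hk]; [ apply (NEWK n); trivial; lia | apply (IH n); trivial; lia ].
    - apply filter_In in Hk. apply (IH n); [ lia | lia | tauto ].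
    - apply carry_iff in Hk. destruct Hk as [Hk | [Hk _]]; [ apply (IH t) | apply (IH n) ]; trivial; lia. }
  destruct (infinitely_many_looks (pair 0 kap) u) as (n0 & L0 & Q0).
  assert (IND0 : exists n1, u <= n1 /\ ind n1 kap).
  { destruct (classic (ind n0 kap)) as [K | K]; [ eauto | ].
    destruct (enters n0 kap k0 Q0 K) as (k & Lk & [EV | (j & c & EV)]); [ lia | now apply H0, AG | | ].
    - exists (S n0). split; [ lia | ]. pose proof (stage_ok_holds n0) as SO. rewrite EV in SO.
      destruct SO as (_ & EC & _). exists k. rewrite EC. now left.
    (* A letter requires a strategy with a number below the use; after the cut this use would exceed
       [u], whereas it is at most [k0]. *)
    - destruct (cut_event i u C n0 L0) as (_ & _ & P3). specialize (P3 _ _ _ _ EV). lia. }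
  destruct IND0 as (n1 & L1 & K1).
  assert (STAY : forall n, n1 <= n -> ind n kap).
  { intros n L. induction L as [ | n L [k Hk]]; trivial.
    pose proof (SMALL n ltac:(lia) k Hk) as Sk.
    destruct (cut_event i u C n ltac:(lia)) as (P1 & P2 & _).
    destruct (stage_growth n) as [E _ EC _ | kap' k' E _ EC NC _ | j p E EE Ep _ _ EC | t E Lt _ EC].
    - exists k. now rewrite EC.
    - exists k. rewrite EC. now right.
    - exists k. rewrite EC. apply filter_In. split; trivial. apply Nat.leb_le. cbn.
      specialize (P2 j p EE Ep). lia.
    - destruct (classic (ind t kap)) as [[k' Hk'] | Nt].
      + exists k'. rewrite EC. apply carry_iff. now left.
      + exists k. rewrite EC. apply carry_iff. right. split; trivial. split; trivial.
        intros y Hy. rewrite <- (Su t ltac:(lia) y), <- (Su n ltac:(lia) y) by lia. easy. }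
  destruct (strong_inf (max N n1)) as (v & Lv & Sv).
  apply NO. exists v. split; [ lia | ]. split; trivial. apply STAY. lia.
Qed.

Lemma good_stage kap N : exists v, N <= v /\ true_at v /\ (ind v kap <-> limW kap).
Proof.
  destruct (classic (limW kap)) as [H | H].
  - destruct (limW_inf kap H N) as (v & L & S & I). exists v. split; trivial.
    split; [ now apply strong_true | tauto ].
  - destruct (strong_inf N) as (v & L & S). exists v. split; trivial.
    pose proof (strong_true v S) as T. split; trivial. split; [ | easy ].
    intros K. now apply (true_ind_limW v).
Qed.

(** * The limit is not equivalent to a set with two r.e. columns *)

Definition bit (b : bool) : nat := if b then 1 else 0.

Lemma eqon_iff o b : eqon o b = true <-> o = Some (bit b).
Proof.
  unfold eqon, bit. destruct o as [y | ]; [ | easy ]. rewrite Nat.eqb_eq. split; [ now intros -> | congruence ].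
Qed.

Lemma J1_iff e s m : In m (J1 e s) <-> exists u, m = pair 1 u /\ u < s /\ exec s [] e u <> None.
Proof.
  unfold J1. rewrite in_map_iff. split.
  - intros (u & <- & H). apply filter_In in H. destruct H as [H K]. apply in_seq in H.
    exists u. repeat split; [ lia | ]. now destruct exec.
  - intros (u & -> & L & K). exists u. split; trivial. apply filter_In. split; [ apply in_seq; lia | ].
    now destruct exec.
Qed.

Lemma J2_iff e e' s g w m : In m (J2 e e' s g w) <-> In m (J1 e s) \/
  exists v, m = pair 2 v /\ v < w /\ exec g (J1 e s) e' v <> None.
Proof.
  unfold J2. rewrite in_app_iff, in_map_iff. apply or_iff_compat_l. split.
  - intros (u & <- & H). apply filter_In in H. destruct H as [H K]. apply in_seq in H.
    exists u. repeat split; [ lia | ]. now destruct exec.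
  - intros (u & -> & L & K). exists u. split; trivial. apply filter_In. split; [ apply in_seq; lia | ].
    now destruct exec.
Qed.

Lemma J1_mono e s s' m : s <= s' -> In m (J1 e s) -> In m (J1 e s').
Proof.
  intros L H. apply J1_iff in H. destruct H as (u & -> & Lu & H). apply J1_iff. exists u.
  repeat split; [ lia | ]. destruct (exec s [] e u) as [y | ] eqn:E; [ | easy ].
  now rewrite (exec_mono s [] s' [] e u y L (fun m _ => iff_refl _) E).
Qed.

Lemma agreeb_iff i last n A : agreeb i last n A = true <->
  exists z sg g w, z <= n /\ sg = pi1 z /\ g = pi1 (pi2 z) /\ w = pi2 (pi2 z) /\
    last <= sg /\ last <= g /\ last <= w /\
    let eP := pi1 i in let eQ := pi1 (pi2 i) in let eU := pi1 (pi2 (pi2 i)) in let eV := pi2 (pi2 (pi2 i)) in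
    (forall y, y <= last -> exec w (J2 eU eV sg g w) eQ y = Some (bit (memb y A))) /\
    (forall m, m < w -> exec n A eP m = Some (bit (memb m (J2 eU eV sg g w)))) /\
    (forall m, m < g -> pi1 m <> 2 -> exec n A eP m = Some (bit (memb m (J1 eU sg)))).
Proof.
  unfold agreeb. rewrite existsb_exists. split.
  - intros (z & Hz & H). unfold agree1 in H. rewrite !andb_true_iff, !Nat.leb_le, !forallb_forall in H.
    destruct H as [[[[[H1 H2] H3] H4] H5] H6]. apply in_seq in Hz.
    exists z, (pi1 z), (pi1 (pi2 z)), (pi2 (pi2 z)). repeat (split; [ trivial; lia | ]). cbv zeta.
    split; [ | split ].
    + intros y Hy. apply eqon_iff, H4, in_seq. lia.
    + intros m Hm. apply eqon_iff, H5, in_seq. lia.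
    + intros m Hm N. specialize (H6 m). rewrite in_seq, orb_true_iff, Nat.eqb_eq in H6.
      apply eqon_iff. destruct H6; [ lia | contradiction | trivial ].
  - intros (z & sg & g & w & Lz & -> & -> & -> & H1 & H2 & H3 & H4 & H5 & H6). cbv zeta in *.
    exists z. split; [ apply in_seq; lia | ]. unfold agree1.
    rewrite !andb_true_iff, !Nat.leb_le, !forallb_forall. repeat split; trivial.
    + intros y Hy. apply in_seq in Hy. apply eqon_iff, H4. lia.
    + intros y Hy. apply in_seq in Hy. apply eqon_iff, H5. lia.
    + intros y Hy. apply in_seq in Hy. apply orb_true_iff.
      destruct (Nat.eq_dec (pi1 y) 2) as [E | E]; [ left; now apply Nat.eqb_eq | right ].
      apply eqon_iff, H6; trivial; lia.
Qed.

Lemma uniform_bound (P : nat -> nat -> Prop) k :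
  (forall m, m < k -> exists b, forall b', b <= b' -> P m b') ->
  exists b, forall m, m < k -> forall b', b <= b' -> P m b'.
Proof.
  induction k as [ | k IH]; intros H; [ exists 0; lia | ].
  destruct IH as [b Hb]; [ intros m Hm; apply H; lia | ].
  destruct (H k ltac:(lia)) as [c Hc]. exists (max b c). intros m Hm b' Lb.
  destruct (Nat.eq_dec m k) as [-> | ]; [ apply Hc; lia | apply Hb; lia ].
Qed.

Lemma memb_bit m L (P : Prop) : (In m L <-> P) -> forall b, (P /\ b = 1) \/ (~ P /\ b = 0) -> b = bit (memb m L).
Proof.
  intros H b [[HP ->] | [HP ->]].
  - apply H, memb_iff in HP. now rewrite HP.
  - destruct (memb m L) eqn:E; trivial. apply memb_iff in E. tauto.
Qed.

Lemma limA_agree K : exists N, forall n, N <= n -> agree_below K (An n) limA.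
Proof.
  destruct (strong_inf K) as (u & L & S). exists u. intros n Ln m Hm.
  rewrite (limA_strong u m S) by lia. symmetry. apply S; trivial. lia.
Qed.

Section NotTwo.
Variables cP cQ cU cV : code.

Definition J1set : set := fun m => exists u, m = pair 1 u /\ exists y, eval empty cU u y.
Definition J2set : set := fun m => J1set m \/ exists v, m = pair 2 v /\ exists y, eval J1set cV v y.

Hypothesis HP : forall m, (J2set m -> eval limA cP m 1) /\ (~ J2set m -> eval limA cP m 0).
Hypothesis HQ : forall y, (limA y -> eval J2set cQ y 1) /\ (~ limA y -> eval J2set cQ y 0).

Let eP := encode cP.
Let eQ := encode cQ.
Let eU := encode cU.
Let eV := encode cV.
Let ix := pair eP (pair eQ (pair eU eV)).

Lemma J1_sound s m : In m (J1 eU s) -> J1set m.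
Proof.
  intros H. apply J1_iff in H. destruct H as (u & -> & _ & H). exists u. split; trivial.
  destruct (exec s [] eU u) as [y | ] eqn:E; [ | easy ]. exists y.
  apply (exec_sound empty s []); trivial. intros x _. easy.
Qed.

Lemma J1_complete K : exists s0, forall s, s0 <= s -> agree_below K (J1 eU s) J1set.
Proof.
  destruct (uniform_bound (fun m s => In m (J1 eU s) <-> J1set m) K) as [b Hb].
  - intros m _. destruct (classic (J1set m)) as [H | H].
    + destruct H as (u & -> & y & E). apply exec_complete in E. destruct E as [k Hk].
      exists (max k (S u)). intros s Ls. split; [ apply J1_sound | ]. intros _.
      apply J1_iff. exists u. repeat split; [ lia | ]. unfold eU. rewrite (Hk s []); [ easy | lia | ].
      intros x _. easy.
    + exists 0. intros s _. split; [ apply J1_sound | easy ].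
  - exists b. intros s Ls m Hm. now apply Hb.
Qed.

(** For correct reductions an agreement must be seen eventually. The clocks are chosen backwards
    along the dependencies: [w] for the use of the reduction [cQ], [g] for the second column below
    [w], [s] for the first column. At a late stage devoted to [ix] the test succeeds, and the
    strategy acts in spite of its stability. *)
Lemma no_late_agreement i p m : i = ix -> stable i m -> rn m i = Some p -> mode p <= 1 -> False.
Proof.
  intros -> ST E M. pose proof (stable_run _ _ _ ST E) as ER. destruct ST as [_ KP].
  set (last := pos p).
  destruct (uniform_bound (fun y w => forall L, agree_below w L J2set ->
              exists b, exec w L eQ y = Some b /\ ((limA y /\ b = 1) \/ (~ limA y /\ b = 0))) (S last)) as [w0 Hw0].
  { intros y _. assert (X : exists b, eval J2set cQ y b /\ ((limA y /\ b = 1) \/ (~ limA y /\ b = 0))).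
    { destruct (HQ y) as [Q1 Q0]. destruct (classic (limA y)); [ exists 1 | exists 0 ]; auto. }
    destruct X as (b & Eb & Hb). apply exec_complete in Eb. destruct Eb as [k Hk]. exists k.
    intros w Lw L HL. exists b. split; trivial. apply Hk; trivial. intros x Hx. apply HL. lia. }
  set (w := max w0 last).
  destruct (uniform_bound (fun v g => forall L, agree_below g L J1set ->
              (exec g L eV v <> None <-> exists y, eval J1set cV v y)) w) as [g0 Hg0].
  { intros v _. destruct (classic (exists y, eval J1set cV v y)) as [[y Ey] | N].
    - pose proof Ey as Ey'. apply exec_complete in Ey. destruct Ey as [k Hk]. exists k.
      intros g Lg L HL. split; [ eauto | ]. intros _. unfold eV. rewrite (Hk g L); trivial; [ easy | ].
      intros x Hx. apply HL. lia.
    - exists 0. intros g _ L HL. split; [ | easy ]. intros H. destruct (exec g L eV v) as [y | ] eqn:Ex; [ | easy ].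
      exists y. now apply (exec_sound J1set g L). }
  set (g := max g0 last).
  destruct (J1_complete (max g w)) as [s0 Hs0]. set (s := max s0 last).
  assert (HJ1 : agree_below (max g w) (J1 eU s) J1set) by (apply Hs0; lia).
  assert (HJ2 : agree_below w (J2 eU eV s g w) J2set).
  { intros x Hx. rewrite J2_iff. unfold J2set. rewrite (HJ1 x) by lia. apply or_iff_compat_l.
    split; intros (v & -> & H).
    - exists v. split; trivial. destruct H as [Lv H]. apply (Hg0 v Lv g) with (L := J1 eU s); trivial; [ lia | ].
      intros x' Hx'. apply HJ1. lia.
    - exists v. split; trivial. assert (Lv : v < w) by (pose proof (pair_bound 2 v); lia). split; trivial.
      apply (Hg0 v Lv g) with (L := J1 eU s); trivial; [ lia | ]. intros x' Hx'. apply HJ1. lia. }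
  destruct (uniform_bound (fun x n => exec n (An n) eP x = Some 1 /\ J2set x \/ exec n (An n) eP x = Some 0 /\ ~ J2set x) (max g w))
    as [n0 Hn0].
  { intros x _. assert (X : exists b, eval limA cP x b /\ ((b = 1 /\ J2set x) \/ (b = 0 /\ ~ J2set x))).
    { destruct (HP x) as [P1 P0]. destruct (classic (J2set x)); [ exists 1 | exists 0 ]; auto. }
    destruct X as (b & Eb & Hb). apply exec_complete in Eb. destruct Eb as [k Hk].
    destruct (limA_agree k) as [N HN]. exists (max k N). intros n Ln.
    unfold eP. rewrite (Hk n (An n)); [ | lia | apply HN; lia ].
    destruct Hb as [[-> H] | [-> H]]; auto. }
  destruct (limA_agree (S last)) as [n1 Hn1].
  set (z := pair s (pair g w)).
  destruct (infinitely_many_looks (pair 1 ix) (max (max n0 n1) (max z m))) as (n & Ln & Qn).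
  assert (AG : agreeb ix last n (An n) = true).
  { apply agreeb_iff. exists z, s, g, w. unfold z, ix. rewrite !pi2_pair, !pi1_pair. cbv zeta.
    split; [ fold z; lia | ]. do 3 (split; [ trivial | ]).
    do 3 (split; [ apply Nat.le_max_r | ]). split; [ | split ].
    - intros y Hy. destruct (Hw0 y ltac:(lia) w ltac:(lia) _ HJ2) as (b & -> & Hb). f_equal.
      apply memb_bit with (P := limA y); trivial. apply Hn1; lia.
    - intros x Hx. destruct (Hn0 x ltac:(lia) n ltac:(lia)) as [[-> H] | [-> H]]; f_equal;
        apply memb_bit with (P := J2set x); auto.
    - intros x Hx Nx. assert (JJ : J2set x <-> J1set x).
      { unfold J2set. split; auto. intros [H | (v & -> & _)]; trivial. now rewrite pi1_pair in Nx. }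
      destruct (Hn0 x ltac:(lia) n ltac:(lia)) as [[-> H] | [-> H]]; f_equal;
        apply memb_bit with (P := J1set x); try (apply HJ1; lia); rewrite <- JJ; auto. }
  specialize (ER n ltac:(lia)). specialize (KP n ltac:(lia)). unfold keeps in KP.
  assert (EV : stage_event n = ev_run1 ix p).
  { change (stage_event n) with (ev n (St n)). unfold ev, ev_run. rewrite Qn, pi1_pair, pi2_pair. cbn [Nat.eqb].
    change (nth_error (stR (St n)) ix) with (rn n ix). rewrite ER.
    change (stA (St n)) with (An n). fold last. now rewrite AG. }
  rewrite EV in KP. unfold ev_run1 in KP. destruct (Nat.eqb_spec (mode p) 0).
  - destruct (find _ _); lia.
  - destruct (Nat.eqb_spec (mode p) 1); lia.
Qed.

Lemma exec_same k L k' L' e n a b : k <= k' -> same_below k L L' ->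
  exec k L e n = Some a -> exec k' L' e n = Some b -> a = b.
Proof. intros Lk HS Ea Eb. apply (exec_mono k L k' L') in Ea; trivial. congruence. Qed.

Lemma bit_iff m L L' : bit (memb m L) = bit (memb m L') -> (In m L <-> In m L').
Proof.
  rewrite <- !memb_iff. destruct (memb m L), (memb m L'); cbn; try easy; try discriminate.
Qed.

(** The stable strategy has ended in mode 2. Snapshots 0, 1 and 2 belong to its agreements at [t],
    at the [Act2] and at the [Act3]. The first and the last come from sets equal below [t], so they
    agree below the uses of the first, and the middle one is caught between them. Thus snapshots 0
    and 1 agree below [w0], yet they yield different values at [x]. *)
Lemma not_two_columns : False.
Proof.
  destruct (stable_exists ix) as [m ST]. destruct ST as [[p E] KP].
  pose proof (conj (ex_intro (fun q => rn m ix = Some q) p E) KP : stable ix m) as ST.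
  destruct (Nat.le_gt_cases (mode p) 1) as [M | M]; [ now apply (no_late_agreement ix p m) | ].
  assert (M2 : mode p = 2) by (apply rn_ok in E as []; lia).
  destruct (limA_agree (S (pos p))) as [N HN].
  pose proof (stable_run ix m p ST E (max m N) ltac:(lia)) as E'.
  destruct (mode2_origin (max m N) ix p E' M2) as (b & p1 & H1 & H2 & H3 & H4 & H5 & H6).
  pose proof (ok_pos _ _ (rn_ok _ _ _ E')) as Lm.
  assert (FIN : agree_below (S (pos p)) (An (S (pos p))) limA).
  { intros y Hy. rewrite (H6 (max m N) ltac:(lia) y Hy). apply HN; lia. }
  remember (pos p) as n2 eqn:En2. clear H4 En2 M M2 H5 H6 E' E ST KP HN N Lm p.
  destruct (act3_origin _ _ _ H1) as (q1 & t & pb & F1 & F2 & F3 & F4 & F5 & F6 & F7 & F8 & F9 & F10 & F11 & F12).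
  destruct (act2_origin _ _ _ F4) as (pb' & pt & G1 & G2 & G3 & G4 & G5 & G6 & G7 & G8 & G9 & G10).
  assert (pb' = pb) by congruence. subst pb'.
  apply act3_spec in H1 as D3. destruct D3 as (q2 & Q1 & _ & AG2 & _ & Pq & _ & A3 & _).
  assert (q2 = p1) by congruence. assert (q1 = p1) by congruence. subst q1 q2.
  apply act2_spec in F4 as D2. destruct D2 as (q2 & Q2 & _ & AG1 & _ & _ & Lt & _ & A2 & _).
  assert (q2 = pb) by congruence. subst q2.
  apply fwd_spec in G5 as D1. destruct D1 as (q2 & Q3 & _ & AG0 & _ & A1 & _).
  assert (q2 = pt) by congruence. subst q2.
  apply agreeb_iff in AG0, AG1, AG2.
  destruct AG0 as (z0 & s0 & g0 & w0 & Z0 & S0 & GG0 & W0 & LS0 & LG0 & LW0 & a0 & b0 & c0).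
  destruct AG1 as (z1 & s1 & g1 & w1 & Z1 & S1 & GG1 & W1 & LS1 & LG1 & LW1 & a1 & b1 & c1).
  destruct AG2 as (z2 & s2 & g2 & w2 & Z2 & S2 & GG2 & W2 & LS2 & LG2 & LW2 & a2 & b2 & c2).
  assert (B : forall z n, z <= n -> pi1 z <= n /\ pi1 (pi2 z) <= n /\ pi2 (pi2 z) <= n).
  { intros z n L. pose proof (pair_bound (pi1 z) (pi2 z)) as K1. rewrite pair_pi in K1.
    pose proof (pair_bound (pi1 (pi2 z)) (pi2 (pi2 z))) as K2. rewrite pair_pi in K2. lia. }
  apply B in Z0, Z1. rewrite <- S0, <- GG0, <- W0 in Z0. rewrite <- S1, <- GG1, <- W1 in Z1. clear B Z2.
  clear S0 GG0 W0 S1 GG1 W1 S2 GG2 W2.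
  unfold ix in a0, b0, c0, a1, b1, c1, a2, b2, c2.
  assert (PE : pi2 (pair eU eV) = eV) by apply pi2_pair.
  rewrite ?pi2_pair, ?pi1_pair in a0, b0, c0, a1, b1, c1, a2, b2, c2.
  rewrite PE in a0, b0, a1, b1, a2, b2.
  set (x := pos pt) in *.
  pose proof (ok_pos _ _ (rn_ok _ _ _ G6)) as Lx. fold x in Lx.
  (* The [Act2] restores the set of stage [t], and until the [Act3] nothing changes up to [b]. *)
  assert (At2 : same_below t (An t) (An n2)).
  { intros y Hy. rewrite <- A2. apply (F12 n2); lia. }
  assert (X02 : forall y, y < w0 -> In y (J2 eU eV s0 g0 w0) <-> In y (J2 eU eV s2 g2 w2)).
  { intros y Hy. apply bit_iff. apply (exec_same t (An t) n2 (An n2) eP y); try lia; trivial;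
      [ now apply b0 | apply b2; lia ]. }
  assert (J1pi : forall s y, In y (J1 eU s) -> pi1 y <> 2).
  { intros s y Hy. apply J1_iff in Hy. destruct Hy as (u & -> & _). now rewrite pi1_pair. }
  assert (Y02 : same_below g0 (J1 eU s0) (J1 eU s2)).
  { intros y Hy. destruct (Nat.eq_dec (pi1 y) 2) as [P | P].
    - split; intros K; apply J1pi in K; contradiction.
    - apply bit_iff. apply (exec_same t (An t) n2 (An n2) eP y); try lia; trivial;
      [ now apply c0 | apply c2; trivial; lia ]. }
  (* Here the requirement that the clocks be at least [last] is used: [s0 <= t <= pos pb <= s1], and
     likewise [s1 <= b = pos p1 <= s2]. *)
  assert (M01 : forall y, In y (J1 eU s0) -> In y (J1 eU s1)) by (intros; apply J1_mono with s0; trivial; lia).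
  assert (M12 : forall y, In y (J1 eU s1) -> In y (J1 eU s2)) by (intros; apply J1_mono with s1; trivial; lia).
  assert (HX0 : ~ In x (An t)) by (apply (fresh_fwd t ix pt G5 G6); lia).
  assert (HX1 : In x (An b)).
  { apply (anc_mono (S t)); [ apply (since_anc _ _ _ _ b G10); lia | ]. rewrite A1. now left. }
  assert (a0' := a0 x (le_n _)). assert (a1' := a1 x ltac:(lia)).
  destruct (classic (same_below w0 (J2 eU eV s0 g0 w0) (J2 eU eV s1 g1 w1))) as [SB | SB].
  { pose proof (exec_same w0 _ w1 _ eQ x _ _ ltac:(lia) SB a0' a1') as K.
    apply bit_iff in K. tauto. }
  apply SB. intros y Hy.
  assert (C1 : In y (J1 eU s1) -> In y (J1 eU s0)).
  { intros K. assert (K2 : In y (J2 eU eV s0 g0 w0)).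
    { apply X02; trivial. apply J2_iff. left. auto. }
    apply J2_iff in K2. destruct K2 as [ | (v & -> & _)]; trivial.
    apply J1pi in K. rewrite pi1_pair in K. contradiction. }
  split; intros K.
  - apply J2_iff in K. destruct K as [K | (v & -> & Lv & K)]; [ apply J2_iff; auto | ].
    apply J2_iff. right. exists v. split; trivial. split; [ lia | ].
    destruct (exec g0 (J1 eU s0) eV v) as [r | ] eqn:Er; [ | easy ].
    rewrite (exec_mono g0 (J1 eU s0) g1 (J1 eU s1) eV v r); [ easy | lia | | trivial ].
    intros u Hu. split; auto. intros Ku. apply Y02; auto.
  - apply J2_iff in K. destruct K as [K | (v & -> & Lv & K)]; [ apply J2_iff; auto | ].
    apply X02; trivial. apply J2_iff. right. exists v. split; trivial. split; [ lia | ].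
    destruct (exec g1 (J1 eU s1) eV v) as [r | ] eqn:Er; [ | easy ].
    rewrite (exec_mono g1 (J1 eU s1) g2 (J1 eU s2) eV v r); [ easy | lia | | trivial ].
    (* [limA] agrees with stage [b], so the second snapshot was already final below [g1]. *)
    intros u Hu. split; auto. intros Ku.
    assert (N2 : pi1 u <> 2) by now apply J1pi in Ku.
    pose proof (c1 u Hu N2) as Eu.
    apply (exec_sound limA) in Eu.
    2:{ intros z Hz. rewrite <- A3. apply FIN. lia. }
    assert (J2u : J2set u) by (left; now apply J1_sound in Ku).
    apply HP in J2u. pose proof (eval_functional _ _ _ _ _ Eu J2u) as Q.
    apply memb_iff. destruct (memb u (J1 eU s1)); trivial. discriminate.
Qed.
End NotTwo.

(** * Complexity of the relations of the construction *)

Definition tag (n : nat) := fst (ev_tuple (stage_event n)).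
Definition arg1 (n : nat) := fst (snd (ev_tuple (stage_event n))).
Definition arg2 (n : nat) := fst (snd (snd (ev_tuple (stage_event n)))).
Definition arg4 (n : nat) := snd (snd (snd (snd (ev_tuple (stage_event n))))).

Definition skip3_at (n s : nat) : Prop := tag n = 5 /\ arg2 n < s /\ s <= n.
Definition skip2_at (n s : nat) : Prop := tag n = 4 /\ arg2 n < s /\ s <= n.
Definition commit_at (w kap d : nat) : Prop :=
  tag w = 2 /\ arg1 w = kap /\ arg4 w <> 0 /\ pred (arg4 w) <= d /\ d < w.

Lemma skip3_at_iff n s : skip3_at n s <-> exists i b, stage_event n = Act3 i b /\ b < s <= n.
Proof.
  unfold skip3_at, tag, arg2. split.
  - intros (H & K). destruct (stage_event n); try discriminate. cbn in K. eauto.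
  - intros (i & b & -> & H). cbn. lia.
Qed.

Lemma skip2_at_iff n s : skip2_at n s <-> exists i t, stage_event n = Act2 i t /\ t < s <= n.
Proof.
  unfold skip2_at, tag, arg2. split.
  - intros (H & K). destruct (stage_event n); try discriminate. cbn in K. eauto.
  - intros (i & b & -> & H). cbn. lia.
Qed.

Lemma commit_at_iff w kap d : commit_at w kap d <->
  exists k i c, d < w /\ stage_event w = Letter kap k i (S c) /\ c <= d.
Proof.
  unfold commit_at, tag, arg1, arg4. split.
  - intros (H & K). destruct (stage_event w) as [ | | kap' k i [ | c] | | | ]; try discriminate; cbn in K.
    + lia.
    + destruct K as (<- & _ & K). exists k, i, c. repeat split; trivial; lia.
  - intros (k & i & c & L & -> & H). cbn. lia.
Qed.

Lemma skip3_iff s : skip3 s <-> exists n, skip3_at n s.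
Proof.
  unfold skip3. split.
  - intros (n & i & b & H). exists n. apply skip3_at_iff. eauto.
  - intros (n & H). apply skip3_at_iff in H. destruct H as (i & b & H). eauto.
Qed.

Lemma skip2_iff s : skip2 s <-> exists n, skip2_at n s /\ ~ skip3 (S n).
Proof.
  unfold skip2. split.
  - intros (n & i & b & H1 & H2 & H3). exists n. split; trivial. apply skip2_at_iff. eauto.
  - intros (n & H & K). apply skip2_at_iff in H. destruct H as (i & b & H). exists n, i, b. tauto.
Qed.

Lemma commit_before_iff u kap d : commit_before u kap d <-> exists w, w < u /\ commit_at w kap d.
Proof.
  unfold commit_before. split.
  - intros (w & k & i & c & H1 & H2 & H3 & H4). exists w. split; trivial. apply commit_at_iff. eauto 6.
  - intros (w & H & K). apply commit_at_iff in K. destruct K as (k & i & c & K). exists w, k, i, c. tauto.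
Qed.

(** The parent as a total function of the child, so that ancestry becomes a bounded iteration of a
    computable function. *)
Definition up (n : nat) : nat := if n =? 0 then 0 else
  if (tag (pred n) =? 4) || (tag (pred n) =? 5) then arg2 (pred n) else pred n.

Lemma up_succ n : up (S n) = parent n.
Proof.
  unfold up, parent, tag, arg2. cbn [Nat.eqb pred]. destruct (stage_event n); reflexivity.
Qed.

Lemma anc_iff s u : anc s u <-> exists k, k < S u /\ Nat.iter k up u = s.
Proof.
  split.
  - induction 1 as [ | n H (k & L & E)]; [ exists 0; split; [ lia | easy ] | ].
    exists (S k). pose proof (parent_le n). split; [ lia | ]. rewrite Nat.iter_succ_r, up_succ. exact E.
  - intros (k & _ & <-). induction k as [ | k IH]; [ constructor | ].
    apply anc_trans with (Nat.iter k up u); trivial. cbn [Nat.iter nat_rect].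
    change (nat_rect (fun _ => nat) u (fun _ => up) k) with (Nat.iter k up u).
    destruct (Nat.iter k up u) as [ | m]; [ constructor | ]. rewrite up_succ. constructor. constructor.
Qed.

Definition kickb (kap d : nat) : bool :=
  (tag d =? 3) &&
  match nth_error (Rn d) (arg1 d) with
  | None => false
  | Some p => existsb (fun q => (fst q =? kap) && (pos p <? snd q)) (Cn d) && (kap <=? rst p)
  end.

Lemma kickb_iff kap d : kickb kap d = true <-> kick kap d.
Proof.
  unfold kickb, kick. rewrite andb_true_iff, Nat.eqb_eq. unfold tag, arg1. split.
  - intros [H K]. destruct (stage_event d) as [ | | | i | | ]; try discriminate. cbn [ev_tuple fst snd] in K.
    destruct (nth_error (Rn d) i) as [p | ] eqn:E; [ | discriminate ].
    rewrite andb_true_iff, Nat.leb_le, existsb_exists in K. destruct K as [([a k] & K1 & K2) K3].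
    apply andb_true_iff in K2. destruct K2 as [K2 K4]. apply Nat.eqb_eq in K2. apply Nat.ltb_lt in K4.
    cbn in K2, K4. subst a.
    exists i, p, k. auto.
  - intros (i & p & k & -> & E & K1 & K2 & K3). cbn [ev_tuple fst snd]. split; trivial. unfold rn in E. rewrite E.
    rewrite andb_true_iff, Nat.leb_le, existsb_exists. split; trivial. exists (kap, k). split; trivial.
    apply andb_true_iff. split; [ apply Nat.eqb_refl | now apply Nat.ltb_lt ].
Qed.

Section CmpRel.
Variable X : set.
Context {T : Type} `{Enc T}.

Lemma cmp_tag (n : T -> nat) : cmp X n -> cmp X (fun x => tag (n x)).
Proof. intros. unfold tag. repeat first [ cmp_step | eapply cmp_stage_event ]. Qed.
Lemma cmp_arg1 (n : T -> nat) : cmp X n -> cmp X (fun x => arg1 (n x)).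
Proof. intros. unfold arg1. repeat first [ cmp_step | eapply cmp_stage_event ]. Qed.
Lemma cmp_arg2 (n : T -> nat) : cmp X n -> cmp X (fun x => arg2 (n x)).
Proof. intros. unfold arg2. repeat first [ cmp_step | eapply cmp_stage_event ]. Qed.
Lemma cmp_arg4 (n : T -> nat) : cmp X n -> cmp X (fun x => arg4 (n x)).
Proof. intros. unfold arg4. repeat first [ cmp_step | eapply cmp_stage_event ]. Qed.
Lemma cmp_An (n : T -> nat) : cmp X n -> cmp X (fun x => An (n x)).
Proof. intros. unfold An, stA. repeat first [ cmp_step | eapply cmp_St ]. Qed.
Lemma cmp_Cn (n : T -> nat) : cmp X n -> cmp X (fun x => Cn (n x)).
Proof. intros. unfold Cn, stI. repeat first [ cmp_step | eapply cmp_St ]. Qed.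
Lemma cmp_Rn (n : T -> nat) : cmp X n -> cmp X (fun x => Rn (n x)).
Proof. intros. unfold Rn, stR. repeat first [ cmp_step | eapply cmp_St ]. Qed.
End CmpRel.

Ltac cmp_rel := repeat first
  [ cmp_step | eapply cmp_tag | eapply cmp_arg1 | eapply cmp_arg2 | eapply cmp_arg4
  | eapply cmp_An | eapply cmp_Cn | eapply cmp_Rn ].

Section DecRel.
Variable X : set.
Context {T : Type} `{Enc T}.

Lemma dec_skip3_at (n s : T -> nat) : cmp X n -> cmp X s -> dec X (fun x => skip3_at (n x) (s x)).
Proof.
  intros. apply dec_and; [ apply decn_eq; cmp_rel | apply dec_and; [ apply decn_lt | apply decn_le ]; cmp_rel ].
Qed.

Lemma dec_skip2_at (n s : T -> nat) : cmp X n -> cmp X s -> dec X (fun x => skip2_at (n x) (s x)).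
Proof.
  intros. apply dec_and; [ apply decn_eq; cmp_rel | apply dec_and; [ apply decn_lt | apply decn_le ]; cmp_rel ].
Qed.

Lemma dec_commit_at (w a d : T -> nat) : cmp X w -> cmp X a -> cmp X d ->
  dec X (fun x => commit_at (w x) (a x) (d x)).
Proof.
  intros. apply dec_and; [ apply decn_eq; cmp_rel | ]. apply dec_and; [ apply decn_eq; cmp_rel | ].
  apply dec_and; [ apply dec_not, decn_eq; cmp_rel | ].
  apply dec_and; [ apply decn_le | apply decn_lt ]; cmp_rel.
Qed.

Lemma dec_kick (a d : T -> nat) : cmp X a -> cmp X d -> dec X (fun x => kick (a x) (d x)).
Proof.
  intros. apply dec_ext with (P := fun x => kickb (a x) (d x) = true); [ intros; apply kickb_iff | ].
  apply dec_istrue.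
  apply (cmp_comp X (fun q : nat * nat => kickb (fst q) (snd q)) (fun x => (a x, d x))); [ | cmp_auto ].
  unfold kickb. cmp_rel.
Qed.

Lemma dec_agr (s u : T -> nat) : cmp X s -> cmp X u -> dec X (fun x => agr (s x) (u x)).
Proof.
  intros. apply dec_bool with (f := fun x => sameb (s x) (An (s x)) (An (u x))); [ | intros; apply sameb_iff ].
  apply (cmp_comp X (fun q : nat * nat => sameb (fst q) (An (fst q)) (An (snd q))) (fun x => (s x, u x))); [ | cmp_auto ].
  unfold sameb. cmp_rel.
Qed.

Lemma dec_ind (n a : T -> nat) : cmp X n -> cmp X a -> dec X (fun x => ind (n x) (a x)).
Proof.
  intros. apply dec_bool with (f := fun x => existsb (fun q => fst q =? a x) (Cn (n x))); [ cmp_rel | ].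
  intros x. rewrite existsb_exists. split.
  - intros ([b k] & K & E). apply Nat.eqb_eq in E. cbn in E. subst. now exists k.
  - intros [k K]. exists (a x, k). split; trivial. apply Nat.eqb_refl.
Qed.

Lemma dec_In_An (y n : T -> nat) : cmp X y -> cmp X n -> dec X (fun x => In (y x) (An (n x))).
Proof.
  intros. apply dec_bool with (f := fun x => memb (y x) (An (n x))); [ | intros; apply memb_iff ].
  eapply cmp_memb; cmp_rel.
Qed.

Lemma dec_anc (s u : T -> nat) : cmp X s -> cmp X u -> dec X (fun x => anc (s x) (u x)).
Proof.
  intros. apply dec_ext with (P := fun x => exists k, k < S (u x) /\ Nat.iter k up (u x) = s x).
  { intros; symmetry; apply anc_iff. }
  apply (dec_ex_lt X (fun x k => Nat.iter k up (u x) = s x) (fun x => S (u x))); [ | cmp_auto ].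
  apply decn_eq; [ | cmp_auto ]. eapply cmp_iter; [ | cmp_auto | cmp_auto ]. unfold up. cmp_rel.
Qed.
End DecRel.

Section DecRel2.
Variable X : set.
Context {T : Type} `{Enc T}.

Lemma dec_skip3_before (u s : T -> nat) : cmp X u -> cmp X s ->
  dec X (fun x => exists n, n < u x /\ skip3_at n (s x)).
Proof.
  intros. apply (dec_ex_lt X (fun x n => skip3_at n (s x))); trivial. apply dec_skip3_at; cmp_auto.
Qed.

Lemma dec_commit_before (u a d : T -> nat) : cmp X u -> cmp X a -> cmp X d ->
  dec X (fun x => commit_before (u x) (a x) (d x)).
Proof.
  intros. apply dec_ext with (P := fun x => exists w, w < u x /\ commit_at w (a x) (d x)).
  { intros; symmetry; apply commit_before_iff. }
  apply (dec_ex_lt X (fun x w => commit_at w (a x) (d x))); trivial. apply dec_commit_at; cmp_auto.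
Qed.
End DecRel2.

Section DecRel3.
Variable X : set.
Context {T : Type} `{Enc T}.

Lemma dec_skip2_before (u s : T -> nat) : cmp X u -> cmp X s ->
  dec X (fun x => exists n, n < u x /\ skip2_at n (s x) /\ ~ exists m, m < u x /\ skip3_at m (S n)).
Proof.
  intros.
  apply (dec_ex_lt X (fun x n => skip2_at n (s x) /\ ~ exists m, m < u x /\ skip3_at m (S n))); trivial.
  apply dec_and; [ apply dec_skip2_at; cmp_auto | ]. apply dec_not, dec_skip3_before; cmp_auto.
Qed.

Lemma dec_kicked_before (u a b s : T -> nat) : cmp X u -> cmp X a -> cmp X b -> cmp X s ->
  dec X (fun x => kicked_before (u x) (a x) (b x) (s x)).
Proof.
  intros. unfold kicked_before.
  apply dec_and; [ apply dec_and; apply decn_le; cmp_auto | ].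
  apply dec_and; [ apply dec_agr; cmp_auto | ]. apply dec_and; [ apply dec_ind; cmp_auto | ].
  apply dec_ext with (P := fun x => exists d, d < u x /\ (s x <= d /\ kick (a x) d /\ agr (b x) d /\
     anc (s x) d /\ ~ commit_before (u x) (a x) d)).
  { intros x; split; intros (d & K); exists d; tauto. }
  apply (dec_ex_lt X (fun x d => s x <= d /\ kick (a x) d /\ agr (b x) d /\
     anc (s x) d /\ ~ commit_before (u x) (a x) d)); trivial.
  apply dec_and; [ apply decn_le; cmp_auto | ]. apply dec_and; [ apply dec_kick; cmp_auto | ].
  apply dec_and; [ apply dec_agr; cmp_auto | ]. apply dec_and; [ apply dec_anc; cmp_auto | ].
  apply dec_not, dec_commit_before; cmp_auto.
Qed.
End DecRel3.

(** * Commitments, kicks and presence read off at a settled stage *)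

Definition commits (kap d : nat) : Prop := exists u, commit_before u kap d.
Definition kicked (kap be s0 : nat) : Prop :=
  kap <= be <= s0 /\ agr be s0 /\ ind s0 kap /\
  exists d, s0 <= d /\ kick kap d /\ agr be d /\ anc s0 d /\ ~ commits kap d.
Definition present (kap be : nat) : Prop :=
  exists s0, kap <= be <= s0 /\ agr be s0 /\ ind s0 kap /\ good s0 /\ ~ kicked kap be s0.

Lemma true_good u : true_at u -> good u.
Proof. intros T. apply (good_true strong_inf u u); trivial. constructor. Qed.

Lemma skip3_at_lt u s n : true_at u -> s <= u -> skip3_at n s -> n < u.
Proof.
  intros T L H. apply Nat.nle_gt; intros Q. destruct (true_good u T) as [N _]. apply N, skip3_iff.
  exists n. unfold skip3_at in *. lia.
Qed.

Lemma skip3_true u s : true_at u -> s <= u -> (skip3 s <-> exists n, n < u /\ skip3_at n s).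
Proof.
  intros T L. rewrite skip3_iff. split; intros (n & H).
  - exists n. split; trivial. now apply (skip3_at_lt u s n).
  - exists n. tauto.
Qed.

Lemma skip2_true u s : true_at u -> s <= u ->
  (skip2 s <-> exists n, n < u /\ skip2_at n s /\ ~ exists m, m < u /\ skip3_at m (S n)).
Proof.
  intros T L. rewrite skip2_iff. split.
  - intros (n & H & K). assert (Ln : n < u).
    { apply Nat.nle_gt; intros Q. destruct (true_good u T) as [_ N]. apply N, skip2_iff.
      exists n. split; trivial. unfold skip2_at in *. lia. }
    exists n. split; trivial. split; trivial. now rewrite <- (skip3_true u (S n)).
  - intros (n & Ln & H & K). exists n. split; trivial. now rewrite (skip3_true u (S n)).
Qed.

Definition settled (u kap : nat) : Prop := true_at u /\ (ind u kap <-> limW kap).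

Lemma settled_agree u v kap : settled u kap -> settled v kap -> u <= v ->
  agr u v /\ (ind u kap <-> ind v kap).
Proof. intros [T1 W1] [T2 W2] L. split; [ now apply true_agr | tauto ]. Qed.

Lemma commits_settled u kap d : settled u kap -> d < u -> (commits kap d <-> commit_before u kap d).
Proof.
  intros S L. split; [ | intros; now exists u ]. intros [N HN].
  destruct (good_stage kap (max u N)) as (v & Lv & Sv).
  destruct (settled_agree u v kap S Sv ltac:(lia)) as [A V].
  apply (commit_stable u v kap ltac:(lia) A V d L).
  apply commit_before_mono with N; trivial. lia.
Qed.

Lemma kicked_settled u kap be s0 : settled u kap -> s0 <= u ->
  (kicked kap be s0 <-> kicked_before u kap be s0).
Proof.
  intros S L. split.
  - intros (H1 & H2 & H3 & d & H4 & H5 & H6 & H7 & H8).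
    destruct (good_stage kap (max u (Datatypes.S d))) as (v & Lv & Sv).
    destruct (settled_agree u v kap S Sv ltac:(lia)) as [A V].
    apply (kicked_stable u v kap ltac:(lia) A V be s0 L).
    split; trivial. split; trivial. split; trivial. exists d. split; [ lia | ].
    do 3 (split; trivial). intros Q. apply H8. now exists v.
  - intros (H1 & H2 & H3 & d & H4 & H5 & H6 & H7 & H8).
    split; trivial. split; trivial. split; trivial. exists d. split; [ lia | ].
    do 3 (split; trivial). rewrite (commits_settled u) by (trivial; lia). exact H8.
Qed.

(** If the computation diverges, [last_kick] on the path from the witness [s0] to a late settled
    stage produces a kick, excluded by [present]. If it converges, [u] itself is a witness, because
    a settled stage shows all kicks and none can lie both at or after [u] and before [u]. *)
Lemma present_settled u kap be : settled u kap -> kap <= be <= u -> agr be u ->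
  (present kap be <-> limW kap).
Proof.
  intros S L A. split.
  - intros (s0 & H1 & H2 & H3 & H4 & H5). apply NNPP. intros N.
    destruct (good_stage kap (max u s0)) as (v & Lv & Sv).
    destruct (settled_agree u v kap S Sv ltac:(lia)) as [Auv V].
    assert (As : anc s0 v) by (apply (good_true strong_inf v); trivial; [ apply Sv | lia ]).
    assert (Abv : agr be v) by (apply agr_trans with u; trivial; lia).
    assert (Abe : anc be v) by (apply agr_anc; trivial; lia).
    destruct (last_kick s0 v As kap be H1 Abv H3) as (d & K1 & K2 & K3 & K4 & K5).
    { destruct Sv as [_ Wv]. tauto. }
    apply H5, (kicked_settled v); trivial; [ lia | ].
    split; trivial. split; trivial. split; trivial. exists d. split; trivial. split; trivial.
    split; [ | now split ].
    assert (Ad : anc d v).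
    { apply succ_anc; trivial. destruct K4 as (j & _ & _ & E & _). now apply parent_fwd with j. }
    apply agr_sandwich with v; trivial. apply anc_linear with v; trivial. lia.
  - intros WK. exists u. destruct S as [T I]. split; trivial. split; trivial. split; [ tauto | ].
    split; [ now apply true_good | ]. rewrite (kicked_settled u) by (trivial; now split).
    intros (_ & _ & _ & d & K & _). lia.
Qed.

(** A good stage from [u] on descends from [u], so its agreement with [be] would pass to [u]. Hence
    the witness is smaller than [u] and the search is bounded. *)
Lemma present_unsettled u kap be : settled u kap -> kap <= be <= u -> ~ agr be u ->
  (present kap be <-> exists s0, s0 < u /\ be <= s0 /\ agr be s0 /\ ind s0 kap /\ anc s0 u /\
      ~ kicked_before u kap be s0).
Proof.
  intros S L A. split.
  - intros (s0 & H1 & H2 & H3 & H4 & H5). assert (Ls : s0 < u).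
    { apply Nat.nle_gt; intros Q. apply A.
      destruct (strong_inf s0) as (v & Lv & Sv). pose proof (strong_true v Sv) as Tv.
      assert (As : anc s0 v) by (now apply (good_true strong_inf v)).
      assert (Au : anc u v) by (apply agr_anc; [ lia | ]; apply true_agr; trivial; [ apply S | lia ]).
      assert (Ab : anc be s0) by (apply agr_anc; trivial; lia).
      pose proof (anc_linear _ _ _ Au As Q) as Aus.
      apply agr_sandwich with s0; trivial. apply anc_linear with s0; trivial. lia. }
    exists s0. split; trivial. split; [ lia | ]. split; trivial. split; trivial.
    split; [ apply (good_true strong_inf u); trivial; [ apply S | lia ] | ].
    rewrite <- (kicked_settled u) by (trivial; lia). exact H5.
  - intros (s0 & Ls & H1 & H2 & H3 & H4 & H5). exists s0. split; [ lia | ]. split; trivial. split; trivial.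
    split; [ apply (good_true strong_inf u); trivial; [ apply S | lia ] | ].
    rewrite (kicked_settled u) by (trivial; lia). exact H5.
Qed.

(** * Presentations of REA sets *)

Definition column (k : nat) (Z : set) : set := fun z => pi1 z = k /\ Z (pi2 z).
Definition union (X Y : set) : set := fun z => X z \/ Y z.

Lemma eval_same X Y c n y : same_set X Y -> (eval X c n y <-> eval Y c n y).
Proof. intros E; split; apply eval_ext; trivial. intros x. symmetry. apply E. Qed.

Lemma re_W X e : re X (W e X).
Proof.
  destruct (classic (exists c, encode c = e)) as [[c <-] | N].
  - apply re_iff_code. exists c. intros x. split.
    + intros (y & d & E & H). apply encode_inj in E. subst. eauto.
    + intros (y & H). exists y, c. auto.
  - apply re_ext with (P := fun _ => False).
    + intros x; split; [ easy | ]. intros (y & d & E & _). apply N. eauto.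
    + apply re_dec, dec_const.
Qed.

Lemma W_at_code f k : (forall e e', f k e -> f k e' -> e = e') ->
  exists c, forall Y x, W_at f k Y x <-> exists y, eval Y c x y.
Proof.
  intros F. destruct (classic (exists c, f k (encode c))) as [[c Hc] | N].
  - exists c. intros Y x. split.
    + intros (e & He & y & d & E & H). rewrite <- E in He. pose proof (F _ _ He Hc) as Q.
      apply encode_inj in Q. subst. eauto.
    + intros (y & H). exists (encode c). split; trivial. exists y, c. auto.
  (* This program searches for a zero of the constant 1 and never halts; it stands for a column
     whose index diverges or is not the number of a program. *)
  - exists (Mu (Comp Succ Zero)). intros Y x. split.
    + intros (e & He & y & d & <- & _). exfalso; eauto.
    + intros (y & H & _). cbn in H. destruct H as (z & -> & H). discriminate.
Qed.

Lemma J_0 f : same_set (J f 0 empty) empty.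
Proof. intros z; split; [ now intros (x & [] & _) | easy ]. Qed.

Lemma pair_eq_iff k x z : z = pair k x <-> pi1 z = k /\ pi2 z = x.
Proof.
  split; [ intros ->; now rewrite pi1_pair, pi2_pair | intros [<- <-]; symmetry; apply pair_pi ].
Qed.

(** Columns missing for [m < 2] are supplied by a program that never halts, so one family of
    strategies covers all three levels. *)
Lemma REA_two_columns m C : m < 3 -> REA m C -> exists cU cV, same_set C (J2set cU cV).
Proof.
  intros L (f & [e Hf] & HC).
  assert (F : forall k a b, f k a -> f k b -> a = b).
  { intros k a b Ha Hb. apply Hf in Ha, Hb. destruct Ha as (c & E & Ha), Hb as (d & E' & Hb).
    assert (c = d) by (apply encode_inj; congruence). subst d. eapply eval_functional; eauto. }
  destruct (W_at_code f 0 (F 0)) as [c1 H1]. destruct (W_at_code f 1 (F 1)) as [c2 H2].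
  set (cD := Mu (Comp Succ Zero)).
  assert (HD : forall Y x y, ~ eval Y cD x y).
  { intros Y x y [H _]. cbn in H. destruct H as (z & -> & H). discriminate. }
  assert (E1 : same_set (J f 1 empty) (J1set c1)).
  { intros z. cbn [J]. split.
    - intros [(x & [] & _) | (x & Hx & ->)]. exists x. split; trivial. apply H1 in Hx.
      destruct Hx as [y Hy]. exists y. now apply (eval_same _ _ _ _ _ (J_0 f)).
    - intros (u & -> & y & Hy). right. exists u. split; trivial. apply H1. exists y.
      now apply (eval_same _ _ _ _ _ (J_0 f)). }
  destruct m as [ | [ | [ | m]]]; [ | | | lia ].
  - exists cD, cD. intros z. rewrite (HC z). split; [ intros (x & [] & _) | ].
    intros [(u & _ & y & Hy) | (u & _ & y & Hy)]; now apply HD in Hy.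
  - exists c1, cD. intros z. rewrite (HC z), (E1 z). unfold J2set. split; auto.
    intros [ | (u & _ & y & Hy)]; trivial. now apply HD in Hy.
  - exists c1, c2. intros z. rewrite (HC z). change (J f 2 empty z) with
      (J f 1 empty z \/ exists x, W_at f 1 (J f 1 empty) x /\ z = pair 2 x).
    unfold J2set. rewrite (E1 z). apply or_iff_compat_l. split.
    + intros (x & Hx & ->). exists x. split; trivial. apply H2 in Hx. destruct Hx as [y Hy].
      exists y. now apply (eval_same _ _ _ _ _ E1).
    + intros (x & -> & y & Hy). exists x. split; trivial. apply H2. exists y.
      now apply (eval_same _ _ _ _ _ E1).
Qed.

Lemma REA_three_columns (Z1 Z2 Z3 : set) :
  re empty Z1 -> re (column 1 Z1) Z2 -> re (union (column 1 Z1) (column 2 Z2)) Z3 ->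
  REA 3 (union (union (column 1 Z1) (column 2 Z2)) (column 3 Z3)).
Proof.
  intros R1 R2 R3. apply re_iff_code in R1, R2, R3.
  destruct R1 as [c1 R1], R2 as [c2 R2], R3 as [c3 R3].
  (* Only the values at 0, 1 and 2 enter into the three columns. *)
  set (g := fun m => if m =? 0 then encode c1 else if m =? 1 then encode c2 else encode c3).
  assert (Hg : cmp empty g) by (unfold g; cmp_auto).
  destruct Hg as [c Hc]. exists (fun m e => e = g m). split.
  - exists (encode c). intros n y. split.
    + intros ->. exists c. split; trivial. apply (Hc n).
    + intros (d & E & H). apply encode_inj in E. subst d. eapply eval_functional; [ exact H | apply (Hc n) ].
  - set (f := fun m e => e = g m).
    assert (HW : forall k cc Y x, g k = encode cc -> (W_at f k Y x <-> exists y, eval Y cc x y)).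
    { intros k cc Y x Eg. split.
      - intros (e & -> & y & d & E & H). rewrite Eg in E. apply encode_inj in E. subst. eauto.
      - intros (y & H). exists (g k). split; [ reflexivity | ]. exists y, cc. auto. }
    assert (E1 : same_set (column 1 Z1) (J f 1 empty)).
    { intros z. cbn [J]. unfold column. split.
      - intros [P Hz]. right. exists (pi2 z). split; [ | now apply pair_eq_iff ].
        apply R1 in Hz. destruct Hz as [y Hy]. apply (HW 0 c1); [ reflexivity | ]. exists y.
        now apply (eval_same _ _ _ _ _ (J_0 f)).
      - intros [(x & [] & _) | (x & Hx & ->)]. rewrite pi1_pair, pi2_pair. split; trivial.
        apply R1. apply (HW 0 c1) in Hx; [ | reflexivity ]. destruct Hx as [y Hy]. exists y.
        now apply (eval_same _ _ _ _ _ (J_0 f)). }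
    assert (E2 : same_set (union (column 1 Z1) (column 2 Z2)) (J f 2 empty)).
    { intros z. change (J f 2 empty z) with
        (J f 1 empty z \/ exists x, W_at f 1 (J f 1 empty) x /\ z = pair 2 x).
      unfold union. rewrite (E1 z). apply or_iff_compat_l. unfold column. split.
      - intros [P Hz]. exists (pi2 z). split; [ | now apply pair_eq_iff ].
        apply R2 in Hz. destruct Hz as [y Hy]. apply (HW 1 c2); [ reflexivity | ]. exists y.
        now apply (eval_same _ _ _ _ _ E1).
      - intros (x & Hx & ->). rewrite pi1_pair, pi2_pair. split; trivial.
        apply R2. apply (HW 1 c2) in Hx; [ | reflexivity ]. destruct Hx as [y Hy]. exists y.
        now apply (eval_same _ _ _ _ _ E1). }
    intros z. change (J f 3 empty z) with
        (J f 2 empty z \/ exists x, W_at f 2 (J f 2 empty) x /\ z = pair 3 x).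
    unfold union at 1. rewrite (E2 z). apply or_iff_compat_l. unfold column at 1. split.
    + intros [P Hz]. exists (pi2 z). split; [ | now apply pair_eq_iff ].
      apply R3 in Hz. destruct Hz as [y Hy]. apply (HW 2 c3); [ reflexivity | ]. exists y.
      now apply (eval_same _ _ _ _ _ E2).
    + intros (x & Hx & ->). rewrite pi1_pair, pi2_pair. split; trivial.
      apply R3. apply (HW 2 c3) in Hx; [ | reflexivity ]. destruct Hx as [y Hy]. exists y.
      now apply (eval_same _ _ _ _ _ E2).
Qed.

(** * The three columns of the set and of its extensions *)

Section Columns.
(* [P] selects the computations that are represented: none for the set itself, those of
   the program of [W_e] for its extension by [W_e]. *)
Variable P : nat -> Prop.
Hypothesis P_dec : dec empty P.

Let Pc (X : set) {T} `{Enc T} (f : T -> nat) : cmp X f -> dec X (fun x => P (f x)).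
Proof. intros Hf. apply (dec_comp X P f); trivial. now apply cmp_any. Qed.

(** In each column the component [pi1 z] separates facts about the set, marked 0, from facts about
    the selected computations, marked 1. *)
Definition col1 : set := fun z =>
  (pi1 z = 0 /\ skip3 (pi2 z)) \/
  (pi1 z = 1 /\ P (pi1 (pi2 z)) /\ commits (pi1 (pi2 z)) (pi2 (pi2 z))).
Definition col2 : set := fun z =>
  (pi1 z = 0 /\ skip2 (pi2 z)) \/
  (pi1 z = 1 /\ P (pi1 (pi2 z)) /\
     kicked (pi1 (pi2 z)) (pi1 (pi2 (pi2 z))) (pi2 (pi2 (pi2 z)))).
Definition col3 : set := fun z =>
  (pi1 z = 0 /\ limA (pi2 z)) \/
  (pi1 z = 1 /\ P (pi1 (pi2 z)) /\ present (pi1 (pi2 z)) (pi2 (pi2 z))).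
Definition cols : set := union (union (column 1 col1) (column 2 col2)) (column 3 col3).
Definition limWP (kap : nat) : Prop := P kap /\ limW kap.

Lemma col1_skip3 s : col1 (pair 0 s) <-> skip3 s.
Proof. unfold col1. rewrite pi1_pair, pi2_pair. intuition lia. Qed.
Lemma col1_commits a d : col1 (pair 1 (pair a d)) <-> P a /\ commits a d.
Proof. unfold col1. rewrite !pi2_pair, !pi1_pair. intuition lia. Qed.
Lemma col2_skip2 s : col2 (pair 0 s) <-> skip2 s.
Proof. unfold col2. rewrite pi1_pair, pi2_pair. intuition lia. Qed.
Lemma col2_kicked a b s : col2 (pair 1 (pair a (pair b s))) <-> P a /\ kicked a b s.
Proof. unfold col2. rewrite ?pi2_pair, ?pi1_pair, ?pi2_pair, ?pi1_pair. intuition lia. Qed.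
Lemma col3_limA s : col3 (pair 0 s) <-> limA s.
Proof. unfold col3. rewrite pi1_pair, pi2_pair. intuition lia. Qed.
Lemma col3_present a b : col3 (pair 1 (pair a b)) <-> P a /\ present a b.
Proof. unfold col3. rewrite !pi2_pair, !pi1_pair. intuition lia. Qed.

Lemma column_pair k j Z z : column k Z (pair j z) <-> j = k /\ Z z.
Proof. unfold column. now rewrite pi1_pair, pi2_pair. Qed.

Lemma re_col1 : re empty col1.
Proof.
  apply re_or.
  - apply re_and; [ apply re_dec, decn_eq; cmp_auto | ].
    apply re_ext with (P := fun z => exists n, skip3_at n (pi2 z)).
    { intros z; symmetry; apply skip3_iff. }
    apply re_ex, dec_skip3_at; cmp_auto.
  - apply re_and; [ apply re_dec, decn_eq; cmp_auto | ].
    apply re_and; [ apply re_dec, Pc; cmp_auto | ].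
    apply (re_ex empty (fun z u => commit_before u (pi1 (pi2 z)) (pi2 (pi2 z)))).
    apply dec_commit_before; cmp_auto.
Qed.

Section FromCol1.
Variable X : set.
Hypothesis X_skip3 : dec X skip3.
Hypothesis X_commits : dec X (fun q : nat * nat => P (fst q) /\ commits (fst q) (snd q)).

(** The first column is consulted negatively: for a return that is not undone and for a kick that is
    never committed. *)
Lemma re_col2 : re X col2.
Proof.
  apply re_or.
  - apply re_and; [ apply re_dec, decn_eq; cmp_auto | ].
    apply re_ext with (P := fun z => exists n, skip2_at n (pi2 z) /\ ~ skip3 (S n)).
    { intros z; symmetry; apply skip2_iff. }
    apply (re_ex X (fun z n => skip2_at n (pi2 z) /\ ~ skip3 (S n))).
    apply dec_and; [ apply dec_skip2_at; cmp_auto | ]. apply dec_not.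
    apply (dec_comp X skip3 (fun q => S (snd q))); trivial. cmp_auto.
  - apply re_and; [ apply re_dec, decn_eq; cmp_auto | ].
    (* The first column knows only the commitments of computations in [P], so [P] has to accompany
       the negated part. *)
    apply re_ext with (P := fun z => exists d,
      P (pi1 (pi2 z)) /\ (pi1 (pi2 z) <= pi1 (pi2 (pi2 z)) /\ pi1 (pi2 (pi2 z)) <= pi2 (pi2 (pi2 z))) /\
      agr (pi1 (pi2 (pi2 z))) (pi2 (pi2 (pi2 z))) /\ ind (pi2 (pi2 (pi2 z))) (pi1 (pi2 z)) /\
      pi2 (pi2 (pi2 z)) <= d /\ kick (pi1 (pi2 z)) d /\ agr (pi1 (pi2 (pi2 z))) d /\
      anc (pi2 (pi2 (pi2 z))) d /\ ~ (P (pi1 (pi2 z)) /\ commits (pi1 (pi2 z)) d)).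
    { intros z. unfold kicked. split.
      - intros (d & K). split; [ tauto | ]. do 3 (split; [ tauto | ]). exists d. tauto.
      - intros (K0 & K1 & K2 & K3 & d & K). exists d. tauto. }
    apply (re_ex X (fun z d =>
      P (pi1 (pi2 z)) /\ (pi1 (pi2 z) <= pi1 (pi2 (pi2 z)) /\ pi1 (pi2 (pi2 z)) <= pi2 (pi2 (pi2 z))) /\
      agr (pi1 (pi2 (pi2 z))) (pi2 (pi2 (pi2 z))) /\ ind (pi2 (pi2 (pi2 z))) (pi1 (pi2 z)) /\
      pi2 (pi2 (pi2 z)) <= d /\ kick (pi1 (pi2 z)) d /\ agr (pi1 (pi2 (pi2 z))) d /\
      anc (pi2 (pi2 (pi2 z))) d /\ ~ (P (pi1 (pi2 z)) /\ commits (pi1 (pi2 z)) d))).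
    apply dec_and; [ apply Pc; cmp_auto | ].
    apply dec_and; [ apply dec_and; apply decn_le; cmp_auto | ].
    apply dec_and; [ apply dec_agr; cmp_auto | ]. apply dec_and; [ apply dec_ind; cmp_auto | ].
    apply dec_and; [ apply decn_le; cmp_auto | ]. apply dec_and; [ apply dec_kick; cmp_auto | ].
    apply dec_and; [ apply dec_agr; cmp_auto | ]. apply dec_and; [ apply dec_anc; cmp_auto | ].
    apply dec_not.
    apply (dec_comp X (fun q : nat * nat => P (fst q) /\ commits (fst q) (snd q))
      (fun q : nat * nat => (pi1 (pi2 (fst q)), snd q))); trivial. cmp_auto.
Qed.

Hypothesis X_skip2 : dec X skip2.
Hypothesis X_kicked : dec X (fun q : nat * (nat * nat) =>
  P (fst q) /\ kicked (fst q) (fst (snd q)) (snd (snd q))).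

Lemma dec_good {T} `{Enc T} (s : T -> nat) : cmp X s -> dec X (fun x => good (s x)).
Proof.
  intros Hs. apply dec_and; apply dec_not;
    [ apply (dec_comp X skip3 s) | apply (dec_comp X skip2 s) ]; trivial.
Qed.

Lemma re_col3 : re X col3.
Proof.
  apply re_or.
  - apply re_and; [ apply re_dec, decn_eq; cmp_auto | ].
    apply re_ext with (P := fun z => exists s, good s /\ In (pi2 z) (An s)).
    { intros z; symmetry; apply limA_good, strong_inf. }
    apply (re_ex X (fun z s => good s /\ In (pi2 z) (An s))).
    apply dec_and; [ apply dec_good; cmp_auto | apply dec_In_An; cmp_auto ].
  - apply re_and; [ apply re_dec, decn_eq; cmp_auto | ].
    apply re_ext with (P := fun z => exists s,
      P (pi1 (pi2 z)) /\ (pi1 (pi2 z) <= pi2 (pi2 z) /\ pi2 (pi2 z) <= s) /\ agr (pi2 (pi2 z)) s /\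
      ind s (pi1 (pi2 z)) /\ good s /\ ~ (P (pi1 (pi2 z)) /\ kicked (pi1 (pi2 z)) (pi2 (pi2 z)) s)).
    { intros z. unfold present. split.
      - intros (s & K). split; [ tauto | ]. exists s. tauto.
      - intros (K0 & s & K). exists s. tauto. }
    apply (re_ex X (fun z s =>
      P (pi1 (pi2 z)) /\ (pi1 (pi2 z) <= pi2 (pi2 z) /\ pi2 (pi2 z) <= s) /\ agr (pi2 (pi2 z)) s /\
      ind s (pi1 (pi2 z)) /\ good s /\ ~ (P (pi1 (pi2 z)) /\ kicked (pi1 (pi2 z)) (pi2 (pi2 z)) s))).
    apply dec_and; [ apply Pc; cmp_auto | ].
    apply dec_and; [ apply dec_and; apply decn_le; cmp_auto | ].
    apply dec_and; [ apply dec_agr; cmp_auto | ]. apply dec_and; [ apply dec_ind; cmp_auto | ].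
    apply dec_and; [ apply dec_good; cmp_auto | ]. apply dec_not.
    apply (dec_comp X (fun q : nat * (nat * nat) => P (fst q) /\ kicked (fst q) (fst (snd q)) (snd (snd q)))
      (fun q : nat * nat => (pi1 (pi2 (fst q)), (pi2 (pi2 (fst q)), snd q)))); trivial. cmp_auto.
Qed.
End FromCol1.

Lemma dec_via X {T} `{Enc T} (Q : T -> Prop) (f : T -> nat) :
  cmp X f -> (forall x, X (f x) <-> Q x) -> dec X Q.
Proof. intros Hf E. apply dec_ext with (P := fun x => X (f x)); trivial. now apply dec_oracle. Qed.

Lemma cols_REA : REA 3 cols.
Proof.
  assert (D1 : forall Y, (forall z, Y (pair 1 z) <-> col1 z) ->
     dec Y skip3 /\ dec Y (fun q : nat * nat => P (fst q) /\ commits (fst q) (snd q))).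
  { intros Y HY. split.
    - apply dec_via with (f := fun s => pair 1 (pair 0 s)); [ cmp_auto | ].
      intros s. rewrite HY. apply col1_skip3.
    - apply dec_via with (f := fun q : nat * nat => pair 1 (pair 1 (pair (fst q) (snd q)))); [ cmp_auto | ].
      intros q. rewrite HY. apply col1_commits. }
  apply REA_three_columns.
  - apply re_col1.
  - destruct (D1 (column 1 col1)) as [K1 K2].
    { intros z. rewrite column_pair. tauto. }
    now apply re_col2.
  - destruct (D1 (union (column 1 col1) (column 2 col2))) as [K1 K2].
    { intros z. unfold union. rewrite !column_pair. intuition lia. }
    apply re_col3; trivial.
    + apply dec_via with (f := fun s => pair 2 (pair 0 s)); [ cmp_auto | ].
      intros s. unfold union. rewrite !column_pair, col2_skip2. intuition lia.
    + apply dec_via with (f := fun q : nat * (nat * nat) =>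
        pair 2 (pair 1 (pair (fst q) (pair (fst (snd q)) (snd (snd q)))))); [ cmp_auto | ].
      intros q. unfold union. rewrite !column_pair, col2_kicked. intuition lia.
Qed.

Section Decide.
Variable X : set.
Hypothesis X_limA : dec X limA.

Lemma dec_true_at {T} `{Enc T} (u : T -> nat) : cmp X u -> dec X (fun x => true_at (u x)).
Proof.
  intros Hu. apply (dec_all_lt X (fun x y => In y (An (u x)) <-> limA y)); trivial.
  apply dec_iff; [ apply dec_In_An; cmp_auto | ].
  apply (dec_comp X limA snd); trivial. cmp_auto.
Qed.

Lemma true_inf N : exists u, N <= u /\ true_at u.
Proof. destruct (strong_inf N) as (u & L & H). exists u. split; trivial. now apply strong_true. Qed.

Lemma dec_skip3 : dec X skip3.
Proof.
  apply (dec_witness X (fun s u => s <= u /\ true_at u) (fun s u => exists n, n < u /\ skip3_at n s)).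
  - apply dec_and; [ apply decn_le; cmp_auto | apply dec_true_at; cmp_auto ].
  - intros s. apply true_inf.
  - apply dec_skip3_before; cmp_auto.
  - intros s u [L Tu]. symmetry. now apply skip3_true.
Qed.

Lemma dec_skip2 : dec X skip2.
Proof.
  apply (dec_witness X (fun s u => s <= u /\ true_at u)
    (fun s u => exists n, n < u /\ skip2_at n s /\ ~ exists m, m < u /\ skip3_at m (S n))).
  - apply dec_and; [ apply decn_le; cmp_auto | apply dec_true_at; cmp_auto ].
  - intros s. apply true_inf.
  - apply dec_skip2_before; cmp_auto.
  - intros s u [L Tu]. symmetry. now apply skip2_true.
Qed.

Hypothesis X_limWP : dec X limWP.

(** Coincides with [settled] on [P], but is decidable from [limA] and [limWP]. *)
Definition settledP (u kap : nat) : Prop := true_at u /\ (P kap -> (ind u kap <-> limWP kap)).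

Lemma settledP_iff u kap : P kap -> (settledP u kap <-> settled u kap).
Proof. unfold settledP, settled, limWP. tauto. Qed.

Lemma settledP_inf kap N : exists u, N <= u /\ settledP u kap.
Proof.
  destruct (good_stage kap N) as (u & L & Hu). exists u. split; trivial.
  split; [ apply Hu | ]. intros K. unfold limWP. destruct Hu as [_ Hu]. tauto.
Qed.

Lemma dec_settledP {T} `{Enc T} (u a : T -> nat) : cmp X u -> cmp X a ->
  dec X (fun x => settledP (u x) (a x)).
Proof.
  intros. apply dec_and; [ now apply dec_true_at | ]. apply dec_imp; [ now apply Pc | ].
  apply dec_iff; [ now apply dec_ind | ]. now apply (dec_comp X limWP a).
Qed.

Lemma dec_commits : dec X (fun q : nat * nat => P (fst q) /\ commits (fst q) (snd q)).
Proof.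
  apply (dec_witness X (fun q u => snd q < u /\ settledP u (fst q))
    (fun q u => P (fst q) /\ commit_before u (fst q) (snd q))).
  - apply dec_and; [ apply decn_lt; cmp_auto | apply dec_settledP; cmp_auto ].
  - intros [a d]. apply settledP_inf.
  - apply dec_and; [ apply Pc; cmp_auto | apply dec_commit_before; cmp_auto ].
  - intros [a d] u [L S]; cbn in *. split; intros [K1 K2]; split; trivial;
      apply (commits_settled u a d); trivial; now apply settledP_iff.
Qed.

Lemma dec_kicked : dec X (fun q : nat * (nat * nat) =>
  P (fst q) /\ kicked (fst q) (fst (snd q)) (snd (snd q))).
Proof.
  apply (dec_witness X (fun q u => snd (snd q) <= u /\ settledP u (fst q))
    (fun q u => P (fst q) /\ kicked_before u (fst q) (fst (snd q)) (snd (snd q)))).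
  - apply dec_and; [ apply decn_le; cmp_auto | apply dec_settledP; cmp_auto ].
  - intros [a [b s]]. apply settledP_inf.
  - apply dec_and; [ apply Pc; cmp_auto | apply dec_kicked_before; cmp_auto ].
  - intros [a [b s]] u [L S]; cbn in *. split; intros [K1 K2]; split; trivial;
      apply (kicked_settled u a b s); trivial; now apply settledP_iff.
Qed.

Definition present_at (u kap be : nat) : Prop :=
  (agr be u /\ limWP kap) \/
  (~ agr be u /\ exists s0, s0 < u /\ be <= s0 /\ agr be s0 /\ ind s0 kap /\ anc s0 u /\
      ~ kicked_before u kap be s0).

Lemma dec_present : dec X (fun q : nat * nat => P (fst q) /\ present (fst q) (snd q)).
Proof.
  apply (dec_witness X (fun q u => snd q <= u /\ settledP u (fst q))
    (fun q u => P (fst q) /\ fst q <= snd q /\ present_at u (fst q) (snd q))).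
  - apply dec_and; [ apply decn_le; cmp_auto | apply dec_settledP; cmp_auto ].
  - intros [a b]. apply settledP_inf.
  - apply dec_and; [ apply Pc; cmp_auto | ]. apply dec_and; [ apply decn_le; cmp_auto | ].
    apply dec_or.
    + apply dec_and; [ apply dec_agr; cmp_auto | ].
      apply (dec_comp X limWP (fun q => fst (fst q))); trivial. cmp_auto.
    + apply dec_and; [ apply dec_not, dec_agr; cmp_auto | ].
      apply (dec_ex_lt X (fun (q : nat * nat * nat) s0 =>
        snd (fst q) <= s0 /\ agr (snd (fst q)) s0 /\ ind s0 (fst (fst q)) /\ anc s0 (snd q) /\
        ~ kicked_before (snd q) (fst (fst q)) (snd (fst q)) s0)); [ | cmp_auto ].
      apply dec_and; [ apply decn_le; cmp_auto | ]. apply dec_and; [ apply dec_agr; cmp_auto | ].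
      apply dec_and; [ apply dec_ind; cmp_auto | ]. apply dec_and; [ apply dec_anc; cmp_auto | ].
      apply dec_not, dec_kicked_before; cmp_auto.
  - intros [a b] u [L S]; cbn in *. unfold present_at. split.
    + intros (K1 & K2 & K3). split; trivial. apply settledP_iff in S; trivial.
      destruct K3 as [[A K3] | [A K3]].
      * apply (present_settled u a b S (conj K2 L) A), K3.
      * now apply (present_unsettled u a b S (conj K2 L) A).
    + intros (K1 & K2). split; trivial. apply settledP_iff in S; trivial.
      assert (L' : a <= b) by (destruct K2 as (s0 & K2 & _); lia). split; trivial.
      destruct (classic (agr b u)) as [A | A]; [ left | right ]; split; trivial.
      * split; trivial. now apply (present_settled u a b S (conj L' L) A).
      * now apply (present_unsettled u a b S (conj L' L) A).
Qed.

Lemma dec_cols : dec X cols.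
Proof.
  assert (K : forall k (Z : set), dec X Z -> dec X (column k Z)).
  { intros k Z HZ. apply dec_and; [ apply decn_eq; cmp_auto | ]. apply (dec_comp X Z pi2); trivial.
    apply (cmp_pi2 X (fun z => z)). cmp_auto. }
  apply dec_or; [ apply dec_or | ]; apply K.
  - apply dec_or; (apply dec_and; [ apply decn_eq; cmp_auto | ]).
    + apply (dec_comp X skip3 (fun z => pi2 z)); [ apply dec_skip3 | cmp_auto ].
    + apply (dec_comp X _ (fun z => (pi1 (pi2 z), pi2 (pi2 z))) dec_commits). cmp_auto.
  - apply dec_or; (apply dec_and; [ apply decn_eq; cmp_auto | ]).
    + apply (dec_comp X skip2 (fun z => pi2 z)); [ apply dec_skip2 | cmp_auto ].
    + apply (dec_comp X _ (fun z => (pi1 (pi2 z), (pi1 (pi2 (pi2 z)), pi2 (pi2 (pi2 z))))) dec_kicked). cmp_auto.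
  - apply dec_or; (apply dec_and; [ apply decn_eq; cmp_auto | ]).
    + apply (dec_comp X limA (fun z => pi2 z)); trivial. cmp_auto.
    + apply (dec_comp X _ (fun z => (pi1 (pi2 z), pi2 (pi2 z))) dec_present). cmp_auto.
Qed.
End Decide.

Lemma cols_limA : dec cols limA.
Proof.
  apply dec_via with (f := fun s => pair 3 (pair 0 s)); [ cmp_auto | ].
  intros s. unfold cols, union. rewrite !column_pair, col3_limA. intuition lia.
Qed.

(** With [be] chosen as a correct stage beyond [a], which [limA] recognizes, membership in the third
    column becomes convergence. *)
Lemma cols_limWP : dec cols limWP.
Proof.
  apply (dec_witness cols (fun a u => a <= u /\ true_at u) (fun a u => P a /\ present a u)).
  - apply dec_and; [ apply decn_le; cmp_auto | apply dec_true_at; [ apply cols_limA | cmp_auto ] ].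
  - intros a. apply true_inf.
  - apply dec_via with (f := fun q : nat * nat => pair 3 (pair 1 (pair (fst q) (snd q)))); [ cmp_auto | ].
    intros q. unfold cols, union. rewrite !column_pair, col3_present. intuition lia.
  - intros a u [L Tu]. unfold limWP.
    destruct (good_stage a u) as (v & Lv & Sv).
    assert (A : agr u v) by (apply true_agr; trivial; apply Sv).
    rewrite (present_settled v a u); trivial; [ tauto | lia ].
Qed.
End Columns.

(** * The set, its lower bound and its extensions *)

Lemma limW_code c x : limW (pair (encode c) x) <-> exists y, eval limA c x y.
Proof.
  unfold limW, hcomp. rewrite pi1_pair, pi2_pair. split.
  - intros [k Hk]. specialize (Hk _ (initial_agree limA k)).
    destruct (exec k (initial limA k) (encode c) x) as [y | ] eqn:E; [ | discriminate ].
    exists y. apply (exec_sound limA k) in E; trivial. apply initial_agree.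
  - intros [y E]. apply exec_complete in E. destruct E as [k Hk]. exists k. intros L HL.
    now rewrite (Hk k L (le_n k) HL).
Qed.

Lemma dec_join X A B : dec X A -> dec X B -> dec X (join A B).
Proof.
  intros HA HB.
  apply dec_ext with (P := fun z => (exists x, x < S z /\ (A x /\ z = x + x)) \/
                                    (exists x, x < S z /\ (B x /\ z = S (x + x)))).
  - intros z. unfold join. split.
    + intros [(x & _ & K & E) | (x & _ & K & E)]; [ left | right ]; exists x; split; trivial; lia.
    + intros [(x & K & E) | (x & K & E)]; [ left | right ]; exists x; repeat split; trivial; lia.
  - apply dec_or.
    + apply (dec_ex_lt X (fun z x => A x /\ z = x + x) (fun z => S z)); [ | cmp_auto ].
      apply dec_and; [ apply (dec_comp X A (fun q => snd q)); trivial | apply decn_eq ]; cmp_auto.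
    + apply (dec_ex_lt X (fun z x => B x /\ z = S (x + x)) (fun z => S z)); [ | cmp_auto ].
      apply dec_and; [ apply (dec_comp X B (fun q => snd q)); trivial | apply decn_eq ]; cmp_auto.
Qed.

Lemma join_left A B : dec (join A B) A.
Proof.
  apply dec_via with (f := fun x => x + x); [ cmp_auto | ]. intros x. unfold join. split.
  - intros [(y & K & E) | (y & _ & E)]; [ now replace x with y by lia | lia ].
  - intros K. left. exists x. split; trivial. lia.
Qed.

Lemma join_right A B : dec (join A B) B.
Proof.
  apply dec_via with (f := fun x => S (x + x)); [ cmp_auto | ]. intros x. unfold join. split.
  - intros [(y & _ & E) | (y & K & E)]; [ lia | now replace x with y by lia ].
  - intros K. right. exists x. split; trivial. lia.
Qed.

Definition no_comp : nat -> Prop := fun _ => False.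
(** [limA] is one part of the third column; the three columns together have the form required of a
    3-REA set and the same degree as [limA]. *)
Definition theA : set := cols no_comp.

Lemma no_comp_dec : dec empty no_comp.
Proof. apply dec_const. Qed.

Lemma theA_REA : REA 3 theA.
Proof. apply cols_REA, no_comp_dec. Qed.

Lemma limA_theA : dec limA theA.
Proof.
  apply dec_cols; [ apply no_comp_dec | | ].
  - apply (dec_oracle limA (fun x => x)). cmp_auto.
  - apply dec_ext with (P := fun _ => False); [ unfold limWP, no_comp; tauto | apply dec_const ].
Qed.

Lemma theA_limA : dec theA limA.
Proof. apply cols_limA. Qed.

Lemma theA_not_lower m C : m < 3 -> REA m C -> ~ turing_equiv theA C.
Proof.
  intros L R [H1 H2]. destruct (REA_two_columns m C L R) as (cU & cV & E).
  apply turing_le_dec in H1, H2.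
  assert (K1 : dec limA (J2set cU cV)).
  { apply dec_ext with (P := C); [ exact E | ]. apply (dec_oracle_trans theA); trivial. apply limA_theA. }
  assert (K2 : dec (J2set cU cV) limA).
  { apply (dec_oracle_trans C); [ | apply (dec_oracle_trans theA); trivial; apply theA_limA ].
    apply dec_ext with (P := J2set cU cV); [ intros x; symmetry; apply E | ].
    apply (dec_oracle _ (fun x => x)). cmp_auto. }
  apply dec_chi_eval in K1, K2. destruct K1 as [cP K1], K2 as [cQ K2].
  exact (not_two_columns cP cQ cU cV K1 K2).
Qed.

(** The construction records computations from approximations to [limA], so [W e theA] is first
    rewritten as the domain of a program [c] with oracle [limA]; the columns for the computations of
    [c] then have the degree of the join. *)
Lemma join_W_REA e : exists C, REA 3 C /\ turing_equiv (join theA (W e theA)) C.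
Proof.
  pose proof (re_oracle theA limA (W e theA) limA_theA (re_W theA e)) as R.
  apply re_iff_code in R. destruct R as [c R].
  set (P := fun kap => pi1 kap = encode c).
  assert (HP : dec empty P) by (apply decn_eq; cmp_auto).
  exists (cols P). split; [ now apply cols_REA | ].
  assert (EW : forall x, limWP P (pair (encode c) x) <-> W e theA x).
  { intros x. unfold limWP, P. rewrite pi1_pair, limW_code, R. tauto. }
  assert (EW' : forall kap, limWP P kap <-> P kap /\ W e theA (pi2 kap)).
  { intros kap. rewrite <- EW. unfold limWP, P. rewrite pi1_pair. split.
    - intros [K1 K2]. rewrite <- K1, pair_pi. auto.
    - intros [K1 [_ K2]]. split; trivial. now rewrite <- K1, pair_pi in K2. }
  set (Y := join theA (W e theA)).
  assert (YL : dec Y limA) by (apply (dec_oracle_trans theA); [ apply join_left | apply theA_limA ]).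
  split; apply turing_le_dec.
  - apply dec_join.
    + apply (dec_oracle_trans limA); [ apply cols_limA | apply limA_theA ].
    + apply dec_ext with (P := fun x => limWP P (pair (encode c) x)); trivial.
      apply (dec_comp _ (limWP P) (fun x => pair (encode c) x)); [ now apply cols_limWP | cmp_auto ].
  - apply dec_cols; trivial.
    apply dec_ext with (P := fun kap => P kap /\ W e theA (pi2 kap)); [ intros; symmetry; apply EW' | ].
    apply dec_and; [ now apply (dec_oracle_trans empty); [ apply dec_empty | ] | ].
    apply (dec_comp Y (W e theA) (fun kap => pi2 kap)); [ apply join_right | cmp_auto ].
Qed.

(** * Approximation of the set in the limit *)

Definition limit_of (f : nat -> nat -> Prop) (Z : set) : Prop :=
  forall x, exists N, forall n, N <= n -> (f x n <-> Z x).

(** One direction of Shoenfield's limit lemma. *)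
Lemma limit_Delta02 (f : nat -> nat -> Prop) Z :
  dec empty (fun q : nat * nat => f (fst q) (snd q)) -> limit_of f Z -> Delta02 Z.
Proof.
  intros Hf HL.
  assert (D : forall T (HT : Enc T) (a b : T -> nat), cmp empty a -> cmp empty b -> dec empty (fun x => f (a x) (b x))).
  { intros T HT a b Ha Hb. apply (dec_comp empty (fun q => f (fst q) (snd q)) (fun x => (a x, b x))); trivial.
    cmp_auto. }
  split.
  - exists (fun z => pi1 (pi2 z) <= pi2 (pi2 z) -> f (pi1 z) (pi2 (pi2 z))). split.
    + apply turing_le_dec. apply dec_imp; [ apply decn_le | apply D ]; cmp_auto.
    + intros x. destruct (HL x) as [N HN]. split.
      * intros Hx. exists N. intros b. rewrite !pi2_pair, !pi1_pair. intros L. now apply HN.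
      * intros [a Ha]. specialize (Ha (max a N)). rewrite !pi2_pair, !pi1_pair in Ha.
        apply (HN (max a N)); [ lia | ]. apply Ha. lia.
  - exists (fun z => pi1 (pi2 z) <= pi2 (pi2 z) /\ f (pi1 z) (pi2 (pi2 z))). split.
    + apply turing_le_dec. apply dec_and; [ apply decn_le | apply D ]; cmp_auto.
    + intros x. destruct (HL x) as [N HN]. split.
      * intros Hx a. exists (max a N). rewrite !pi2_pair, !pi1_pair. split; [ lia | ]. apply HN; trivial. lia.
      * intros H. destruct (H N) as [b Hb]. rewrite !pi2_pair, !pi1_pair in Hb. now apply (HN b).
Qed.

Lemma limit_skip3 : limit_of (fun s n => exists m, m < n /\ skip3_at m s) skip3.
Proof.
  intros s. destruct (strong_inf s) as (u & L & S). exists u. intros n Ln. rewrite skip3_iff. split.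
  - intros (m & _ & K). eauto.
  - intros (m & K). exists m. split; trivial.
    pose proof (skip3_at_lt u s m (strong_true u S) L K). lia.
Qed.

(** The negated condition has to converge as well. Only returns before the cut stage [u] can jump
    over [s], and for these the value of [skip3] at [S m] is final from stage [u] on. *)
Lemma limit_skip2 :
  limit_of (fun s n => exists m, m < n /\ skip2_at m s /\ ~ exists k, k < n /\ skip3_at k (S m)) skip2.
Proof.
  intros s. destruct (cut_inf s) as (i & u & _ & L & C). pose proof (cut_strong i u C) as Su.
  assert (LT : forall m, skip2_at m s -> m < u).
  { intros m K. apply skip2_at_iff in K. destruct K as (j & t & EV & K).
    apply Nat.nle_gt; intros Q. destruct (cut_event i u C m Q) as (P & _).
    rewrite (parent_act2 _ _ _ EV) in P. lia. }
  assert (S3 : forall m n, m < u -> u <= n -> (skip3 (S m) <-> exists k, k < n /\ skip3_at k (S m))).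
  { intros m n Lm Ln. rewrite skip3_iff. split; intros (k & K); [ | exists k; tauto ].
    exists k. split; trivial. pose proof (skip3_at_lt u (S m) k (strong_true u Su) Lm K). lia. }
  exists u. intros n Ln. rewrite skip2_iff. split.
  - intros (m & _ & K1 & K2). exists m. split; trivial. rewrite (S3 m n); auto.
  - intros (m & K1 & K2). pose proof (LT m K1). exists m. split; [ lia | ]. split; trivial.
    now rewrite <- (S3 m n).
Qed.

Lemma limit_limA : limit_of (fun y n => In y (An n)) limA.
Proof.
  intros y. destruct (limA_agree (S y)) as [N HN]. exists N. intros n Ln. apply (HN n Ln). lia.
Qed.

Lemma limit_and (f g : nat -> nat -> Prop) Z Y : limit_of f Z -> limit_of g Y ->
  limit_of (fun x n => f x n /\ g x n) (fun x => Z x /\ Y x).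
Proof.
  intros Hf Hg x. destruct (Hf x) as [N HN], (Hg x) as [M HM]. exists (max N M). intros n L.
  rewrite (HN n), (HM n) by lia. tauto.
Qed.

Lemma limit_or (f g : nat -> nat -> Prop) Z Y : limit_of f Z -> limit_of g Y ->
  limit_of (fun x n => f x n \/ g x n) (fun x => Z x \/ Y x).
Proof.
  intros Hf Hg x. destruct (Hf x) as [N HN], (Hg x) as [M HM]. exists (max N M). intros n L.
  rewrite (HN n), (HM n) by lia. tauto.
Qed.

Lemma limit_const Z : limit_of (fun x _ => Z x) Z.
Proof. intros x. exists 0. tauto. Qed.

Lemma limit_comp (f : nat -> nat -> Prop) Z (h : nat -> nat) :
  limit_of f Z -> limit_of (fun x n => f (h x) n) (fun x => Z (h x)).
Proof. intros Hf x. apply Hf. Qed.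

Lemma theA_Delta02 : Delta02 theA.
Proof.
  apply limit_Delta02 with (f := fun z n =>
    (pi1 z = 1 /\ (pi1 (pi2 z) = 0 /\ exists m, m < n /\ skip3_at m (pi2 (pi2 z)))) \/
    (pi1 z = 2 /\ (pi1 (pi2 z) = 0 /\
       exists m, m < n /\ skip2_at m (pi2 (pi2 z)) /\ ~ exists k, k < n /\ skip3_at k (S m))) \/
    (pi1 z = 3 /\ (pi1 (pi2 z) = 0 /\ In (pi2 (pi2 z)) (An n)))).
  - apply dec_or; [ | apply dec_or ]; (apply dec_and; [ apply decn_eq; cmp_auto | ]);
      (apply dec_and; [ apply decn_eq; cmp_auto | ]).
    + apply dec_skip3_before; cmp_auto.
    + apply dec_skip2_before; cmp_auto.
    + apply dec_In_An; cmp_auto.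
  - intros z.
    destruct (limit_or _ _ _ _ (limit_and _ _ _ _ (limit_const (fun z => pi1 z = 1))
        (limit_and _ _ _ _ (limit_const (fun z => pi1 (pi2 z) = 0))
           (limit_comp _ _ (fun z => pi2 (pi2 z)) limit_skip3)))
      (limit_or _ _ _ _ (limit_and _ _ _ _ (limit_const (fun z => pi1 z = 2))
        (limit_and _ _ _ _ (limit_const (fun z => pi1 (pi2 z) = 0))
           (limit_comp _ _ (fun z => pi2 (pi2 z)) limit_skip2)))
      (limit_and _ _ _ _ (limit_const (fun z => pi1 z = 3))
        (limit_and _ _ _ _ (limit_const (fun z => pi1 (pi2 z) = 0))
           (limit_comp _ _ (fun z => pi2 (pi2 z)) limit_limA)))) z) as [N HN].
    exists N. intros n L. rewrite (HN n L).
    unfold theA, cols, union, column, col1, col2, col3, no_comp. tauto.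
Qed.

Theorem theorem1p4 :
  exists A : set,
    properly_REA 3 A /\
    ~ extends_to_properly_REA_succ 3 A /\
    Delta02 A.
Proof.
  exists theA. split; [ | split ].
  - split; [ exact theA_REA | exact theA_not_lower ].
  - intros (B & [_ HB] & e & HE). destruct (join_W_REA e) as (C & HC & EC).
    apply (HB 3 C); trivial; [ lia | ]. now apply turing_equiv_trans with (join theA (W e theA)).
  - exact theA_Delta02.
Qed.
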